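(* Let $\mathcal E=\{e^{it}:0\le t\le t_0\}$, where $0<t_0\le\pi$, and let $F\in H^\infty$ be an outer function such that $\|F\|_\infty=1$, $F'\in\mathcal A$, and $|F|=1$ on $\mathcal E$. Further, suppose $\{z_n\}_{n\in\mathbb N}\subset\mathbb D$ is a thick sequence such that $\operatorname{Im}z_n>0$ for all $n\in\mathbb N$, $\lim_{n\to\infty}z_n=1$ and $$\sum_n\frac{1-|z_n|^2}{|1-z_n|^2}<\infty.$$ Finally, assume that the Blaschke product $B$ with zero sequence $\{z_n\}$ satisfies $B'\in\mathcal N^+$, and put $f:=BF$. Then $f'$ lies in $\mathcal N^+$ and has a nontrivial (i.e., nonconstant) inner factor $J$ with $1\in\sigma(J)$.
   Context: Notation: $\mathbb D=\{z\in\mathbb C:|z|<1\}$, $\mathbb T=\partial\mathbb D$, $m$ is normalized Lebesgue measure on $\mathbb T$; $H^\infty$ is the space of bounded holomorphic functions on $\mathbb D$ with the sup norm; $\mathcal A=H^\infty\cap C(\mathbb T)$ is the disk algebra (holomorphic functions on $\mathbb D$ extending continuously to $\overline{\mathbb D}$). A function $\theta\in H^\infty$ is inner if $\lim_{r\to1^-}|\theta(r\zeta)|=1$ for $m$-a.e. $\zeta\in\mathbb T$. The Blaschke product with zero sequence $\{z_n\}\subset\mathbb D$, $\sum_n(1-|z_n|)<\infty$, is $B(z)=\prod_n\frac{|z_n|}{z_n}\frac{z_n-z}{1-\bar z_nz}$. An outer function is a zero-free holomorphic $F$ on $\mathbb D$ such that $\log|F|$ is the Poisson integral of a function in $L^1(\mathbb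 T,m)$. The Smirnov class $\mathcal N^+$ is the set of ratios $u/v$ with $u,v\in H^\infty$ and $v$ outer; every $f\in\mathcal N^+$, $f\not\equiv0$, factors as an inner function times an outer function, uniquely up to unimodular constants, and the inner function is called the inner factor of $f$. For an inner function $J$, the boundary spectrum $\sigma(J)$ is the smallest closed set $E\subset\mathbb T$ such that $J$ extends analytically across $\mathbb T\setminus E$. An infinite sequence $\{z_j\}\subset\mathbb D$ with $\sum_j(1-|z_j|)<\infty$ is thin if $\lim_{k\to\infty}\prod_{j\ne k}\left|\frac{z_j-z_k}{1-\bar z_jz_k}\right|=1$; otherwise it is called thick. *)

(* Defs.v *)
From HB Require Import structures.
From mathcomp Require Import all_boot all_order all_algebra.
From mathcomp Require Import complex.
From mathcomp Require Import all_classical all_reals all_analysis.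

Set Implicit Arguments.
Unset Strict Implicit.
Unset Printing Implicit Defensive.

Import Order.TTheory GRing.Theory Num.Theory.
Import numFieldNormedType.Exports.
Import ComplexField.Normc.

Local Open Scope classical_set_scope.
Local Open Scope complex_scope.
Local Open Scope ring_scope.

(* [R[i]] with the topology of its own norm, as [numFieldNormedType] does for the
   abstract number fields. *)
HB.instance Definition _ (R : rcfType) := PseudoPointedMetric.copy R[i] R[i]^o.
HB.instance Definition _ (R : rcfType) := NormedModule.copy R[i] R[i]^o.

(* [normc z : R] is the modulus as a real number; [`|z|] would be a complex
   number.  Functions on the disk are total functions on [R[i]] whose values
   outside the disk are irrelevant; their derivative [derive1 f] is the limit of the
   difference quotient with complex increments. *)

Section FunctionTheory.
Variable R : realType.
Implicit Types (f g u v F G J : R[i] -> R[i]) (z zeta a : R[i]) (t : R).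

Definition disk : set R[i] := [set z | normc z < 1].
Definition closed_disk : set R[i] := [set z | normc z <= 1].
Definition circle : set R[i] := [set z | normc z = 1].

Definition expi t : R[i] := cos t +i* sin t.

Definition holomorphic (U : set R[i]) f :=
  forall z, U z -> derivable f z 1.

Definition Hinfty f :=
  holomorphic disk f /\ exists M : R, forall z, disk z -> normc (f z) <= M.

Definition Hinfty_norm f : R := sup [set normc (f z) | z in disk].

Definition disk_algebra f :=
  holomorphic disk f /\
  exists g, {within closed_disk, continuous g} /\
    forall z, disk z -> g z = f z.

(* Boundary values of functions in [Hinfty] are taken as radial limits. *)
Definition radial_limit f zeta (w : R[i]) :=
  f (r%:C * zeta) @[r --> (1 : R)^'-] --> w.

(* The circle with normalized Lebesgue measure is parametrized by
   [t |-> expi t] on [[0, 2 pi]] with [(2 pi)^-1 dt]. *)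
Definition period : set R := `[0, pi *+ 2].

Definition ae_circle (P : R[i] -> Prop) :=
  {ae (@lebesgue_measure R), forall t, period t -> P (expi t)}.

Definition circle_integrable (h : R[i] -> R) :=
  (@lebesgue_measure R).-integrable period (fun t => (h (expi t))%:E).

Definition circle_integral (h : R[i] -> R) : R :=
  (pi *+ 2)^-1 * \int[@lebesgue_measure R]_(t in period) h (expi t).

Definition poisson_kernel z zeta : R :=
  (1 - normc z ^+ 2) / normc (zeta - z) ^+ 2.

Definition poisson_integral (h : R[i] -> R) z : R :=
  circle_integral (fun zeta => poisson_kernel z zeta * h zeta).

Definition inner_function f :=
  Hinfty f /\
  ae_circle (fun zeta => normc (f (r%:C * zeta)) @[r --> (1 : R)^'-] --> (1 : R)).

Definition outer_function f :=
  holomorphic disk f /\ (forall z, disk z -> f z <> 0) /\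
  exists h : R[i] -> R, circle_integrable h /\
    forall z, disk z -> ln (normc (f z)) = poisson_integral h z.

Definition smirnov f :=
  exists u v, Hinfty u /\ Hinfty v /\ outer_function v /\
    forall z, disk z -> f z = u z / v z.

Definition inner_factor f J :=
  inner_function J /\ exists G, outer_function G /\ forall z, disk z -> f z = J z * G z.

Definition constant_on_disk f := exists c, forall z, disk z -> f z = c.

Definition extends_analytically_across f (A : set R[i]) :=
  forall zeta, A zeta -> exists (U : set R[i]) g,
    open U /\ U zeta /\ holomorphic U g /\
    forall z, U z -> disk z -> g z = f z.

(* Being analytically continuable is a local property, so the family below is
   stable under intersection and its intersection is its smallest member. *)
Definition boundary_spectrum J : set R[i] :=
  \bigcap_(E in [set E : set R[i] | closed E /\ E `<=` circle /\
                   extends_analytically_across J (circle `\` E)]) E.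

Definition blaschke_sequence (z_ : nat -> R[i]) :=
  (forall n, disk (z_ n)) /\ cvgn (series (fun n => 1 - normc (z_ n))).

(* Usual convention at [a = 0], where the quotient [|a| / a] is read as [-1]. *)
Definition blaschke_factor a z : R[i] :=
  if a == 0 then z else (normc a)%:C / a * ((a - z) / (1 - a^* * z)).

Definition blaschke_product (z_ : nat -> R[i]) z : R[i] :=
  limn (fun n => \prod_(0 <= k < n) blaschke_factor (z_ k) z).

Definition pseudohyperbolic a z : R := normc ((a - z) / (1 - a^* * z)).

(* The partial products are nonincreasing and nonnegative, so they converge. *)
Definition separation (z_ : nat -> R[i]) (k : nat) : R :=
  limn (fun n => \prod_(0 <= j < n | j != k) pseudohyperbolic (z_ j) (z_ k)).

Definition thin (z_ : nat -> R[i]) :=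
  blaschke_sequence z_ /\ separation z_ @ \oo --> (1 : R).

Definition thick (z_ : nat -> R[i]) := blaschke_sequence z_ /\ ~ thin z_.

Definition circle_arc (t0 : R) : set R[i] := [set expi t | t in `[0, t0]].

End FunctionTheory.

(* Main.v *)
(* The zeros of [B] accumulate only at [1], so [f'] extends continuously to the closed
   disk without [1]; let [h = log |f'|] on the circle.  Since [f' = u / v] with [u]
   bounded and [v] outer, comparing [f'] with Poisson integrals by the maximum principle
   gives [h] in [L^1] and [|f'| <= exp P[h]], so [f' = J exp H[h]] with [H] the Herglotz
   integral and [J] inner; radial limits only matter at points of continuity.  The
   maximum principle is needed only for twice differentiable functions, for which it
   follows from a Taylor expansion.

   At a point [zeta] of the arc, Julia's inequality gives
   [|f'(zeta)| >= P_{z_n}(zeta)]; off the arc [P_{z_n} <= P_{z_n}(1)], which tends to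
   [0].  As [P[log P_a](a) >= - log (1 - |a|^2)], it follows that
   [|exp H[h](z_n)| >= (1 - o(1)) / (1 - |z_n|^2)], while
   [|f'(z_n)| <= delta_n / (1 - |z_n|^2)], where [delta_n] is the separation at [z_n].
   Hence [|J(z_n)| <= (1 + o(1)) delta_n].  If [J] were analytic at [1], then [|J| = 1]
   on the arc would give [|J(z_n)| -> 1], so [delta_n -> 1] and the sequence would be
   thin. *)

Require Import Defs.
From mathcomp Require Import all_boot all_order all_algebra.
From mathcomp Require Import complex.
From mathcomp Require Import all_classical all_reals all_analysis.
From mathcomp Require Import measurable_realfun.
From mathcomp Require Import ring lra.
Import Order.TTheory GRing.Theory Num.Theory.
Import numFieldNormedType.Exports.
Import ComplexField.Normc.
Local Open Scope classical_set_scope.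
Local Open Scope complex_scope.
Local Open Scope ring_scope.
Set Implicit Arguments.
Unset Strict Implicit.
Unset Printing Implicit Defensive.

(** Complex differentiability is used as a pointwise notion, so higher derivatives come from
    explicit formulas rather than from Cauchy's theorem. Hence Cauchy-type integrals are
    differentiated by hand, an outer function is recovered as a constant times the exponential of a
    Herglotz integral, and Blaschke products are summed with bounds on several derivatives at once.
    Together these make [f'] twice differentiable, as the maximum principle requires. The other
    obstacle is the point [1], where the only information on [f'] is the majorant supplied by the
    Smirnov class. The logarithm of [|f'|] is therefore reached through two truncations. Its
    positive part is cut down near [1] and bounded by the majorant before passing to the limit; then
    the logarithm is cut from below at height [-N], with an extra density on a shrinking arc that
    absorbs the majorant. A point of the disk where [f'] does not vanish controls what is lost below
    [-N]. Nonconstancy of [J] comes with the presence of [1] in its spectrum, since a constant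
    continues analytically everywhere. *)

Section ComplexBasics.
Variable R : realType.
Implicit Types (z w a b : R[i]) (f g : R[i] -> R[i]) (U : set R[i]).

(** * Modulus, limits and complex derivatives in [R[i]] *)

Lemma normc_ge0 z : 0 <= normc z.
Proof. by case: z => x y; rewrite /= sqrtr_ge0. Qed.

Lemma normc_eq0 z : (normc z == 0) = (z == 0).
Proof. by apply/eqP/eqP => [/eq0_normc//|->]; rewrite normc0. Qed.

Lemma normc_gt0 z : (0 < normc z) = (z != 0).
Proof. by rewrite lt_def normc_ge0 andbT normc_eq0. Qed.

Lemma normcBC z w : normc (z - w) = normc (w - z).
Proof. by rewrite -normcN opprB. Qed.

Lemma normc_real (x : R) : normc x%:C = `|x|.
Proof. by rewrite /= expr0n addr0 sqrtr_sqr. Qed.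

Lemma sqr_normc_ReIm z : normc z ^+ 2 = complex.Re z ^+ 2 + complex.Im z ^+ 2.
Proof. by case: z => x y; rewrite /= sqr_sqrtr // addr_ge0 // sqr_ge0. Qed.

Lemma normcJ z : normc (conjc z) = normc z.
Proof. by case: z => x y; rewrite /= sqrrN. Qed.

Lemma normcX z n : normc (z ^+ n) = normc z ^+ n.
Proof. by elim: n => [|n IH]; rewrite ?expr0 ?normc1// !exprS normcM IH. Qed.

Lemma le_normcB a b : normc (a - b) <= normc a + normc b.
Proof. by rewrite -(normcN b) le_normcD. Qed.

Lemma ler_distc a b c : normc (a - c) <= normc (a - b) + normc (b - c).
Proof. by rewrite (_ : a - c = (a - b) + (b - c)) ?le_normcD//; ring. Qed.

Lemma ler_normcB a b : normc a - normc b <= normc (a - b).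
Proof. by rewrite lerBlDr (le_trans _ (le_normcD _ _))// subrK. Qed.

Lemma ler_abs_normcB a b : `|normc a - normc b| <= normc (a - b).
Proof.
by rewrite ler_norml ler_normcB andbT lerNl opprB normcBC ler_normcB.
Qed.

Lemma abs_Re_le z : `|complex.Re z| <= normc z.
Proof.
by case: z => x y /=; rewrite -sqrtr_sqr ler_wsqrtr// lerDl sqr_ge0.
Qed.

Lemma abs_Im_le z : `|complex.Im z| <= normc z.
Proof.
by case: z => x y /=; rewrite -sqrtr_sqr ler_wsqrtr// lerDr sqr_ge0.
Qed.

Lemma Re_le_normc z : complex.Re z <= normc z.
Proof. exact: le_trans (ler_norm _) (abs_Re_le z). Qed.

Lemma normc_le_ReIm z : normc z <= `|complex.Re z| + `|complex.Im z|.
Proof.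
rewrite [z in normc z]complexE (le_trans (le_normcD _ _))//.
by rewrite normcM !normc_real /= expr0n add0r expr1n sqrtr1 mul1r.
Qed.

Lemma real_complexB (x y : R) : (x - y)%:C = x%:C - y%:C :> R[i].
Proof. by apply/eqP; rewrite eq_complex /= subr0 !eqxx. Qed.

Lemma real_complexD (x y : R) : (x + y)%:C = x%:C + y%:C :> R[i].
Proof. by apply/eqP; rewrite eq_complex /= addr0 !eqxx. Qed.

Lemma real_complexM (x y : R) : (x * y)%:C = x%:C * y%:C :> R[i].
Proof. by apply/eqP; rewrite eq_complex /= !mulr0 mul0r subr0 addr0 !eqxx. Qed.

(** The norm of [R[i]] is itself a complex number, and a positive complex radius is real; its real
    part serves as radius here, so that later estimates stay in [R]. *)
Lemma nbhsC z (P : set R[i]) :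
  nbhs z P <-> exists2 e : R, 0 < e & forall w, normc (w - z) < e -> P w.
Proof.
split.
  move/nbhs_ballP => [e /= e0 H]; exists (complex.Re e).
    by move: e0; rewrite ltcE => /andP[].
  move=> w hw; apply: H; rewrite -ball_normE /=.
  rewrite [ltLHS](_ : _ = (normc (z - w))%:C)// normcBC ltcE /= hw andbT.
  by move: e0; rewrite ltcE => /andP[].
move=> [e e0 H]; apply/nbhs_ballP; exists e%:C => /=; first by rewrite ltcR.
move=> w; rewrite -ball_normE /= => hw; apply: H.
by move: hw; rewrite [ltLHS](_ : _ = (normc (z - w))%:C)// ltcR normcBC.
Qed.

Lemma cvgC (T : Type) (G : set_system T) {FG : Filter G} (f : T -> R[i]) z :
  f @ G --> z <-> forall e : R, 0 < e -> \forall t \near G, normc (f t - z) < e.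
Proof.
split=> [H e e0|H A /nbhsC[e e0 HA]].
  by apply: (H [set w | normc (w - z) < e]); apply/nbhsC; exists e.
by move: (H e e0); apply: filterS => t; apply: HA.
Qed.

Lemma cvgnC (u : nat -> R[i]) z :
  u @ \oo --> z <-> forall e : R, 0 < e -> \forall n \near \oo, normc (u n - z) < e.
Proof. exact: cvgC. Qed.

Lemma openC U : open U <->
  forall z, U z -> exists2 e : R, 0 < e & forall w, normc (w - z) < e -> U w.
Proof.
rewrite openE; split => H z Uz; first by apply/nbhsC; apply: H.
by apply/nbhsC; apply: H.
Qed.

Lemma cvgc_cst_eq (T : Type) (G : set_system T) {FG : ProperFilter G} (f : T -> R[i]) a b :
  f @ G --> a -> f @ G --> b -> a = b.
Proof.
move=> /cvgC Ha /cvgC Hb; apply/eqP; rewrite -subr_eq0 -normc_eq0.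
rewrite eq_le normc_ge0 andbT; apply/ler_addgt0Pr => e e0.
have e2 : 0 < e / 2 by rewrite divr_gt0.
have [t [h1 h2]] := @filter_ex _ G FG _ (filterI (Ha _ e2) (Hb _ e2)).
rewrite add0r (le_trans (ler_distc a (f t) b))// normcBC.
by rewrite ltW// (splitr e) ltrD.
Qed.

Lemma limnC (u : nat -> R[i]) a : u @ \oo --> a -> limn u = a.
Proof. by move=> cv; exact: cvgc_cst_eq (cvgP _ cv) cv. Qed.

Lemma normc_cvg (T : Type) (G : set_system T) {FG : Filter G} (f : T -> R[i]) a :
  f @ G --> a -> (fun t => normc (f t)) @ G --> normc a.
Proof.
move=> /cvgC H; apply/cvgrPdist_lt => e e0; have := H e e0.
by apply: filterS => t ht; rewrite distrC (le_lt_trans (ler_abs_normcB _ _)).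
Qed.

Lemma cvgcM (T : Type) (G : set_system T) {FG : Filter G} (f g : T -> R[i]) a b :
  f @ G --> a -> g @ G --> b -> (fun t => f t * g t) @ G --> a * b.
Proof.
move=> /cvgC Ha /cvgC Hb; apply/cvgC => e e0.
set M := normc a + normc b + 1.
have M0 : 0 < M by rewrite /M ltr_wpDl// addr_ge0// normc_ge0.
have d0 : 0 < Num.min 1 (e / (M + M)).
  by rewrite lt_min ltr01/= divr_gt0// addr_gt0.
near=> t.
have h1 : normc (f t - a) < Num.min 1 (e / (M + M)) by near: t; exact: Ha.
have h2 : normc (g t - b) < Num.min 1 (e / (M + M)) by near: t; exact: Hb.
move: h1 h2; rewrite !lt_min => /andP[h1 h1'] /andP[h2 h2'].
rewrite (_ : _ - _ = (f t - a) * g t + a * (g t - b)); last by ring.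
rewrite (le_lt_trans (le_normcD _ _))// !normcM.
have hg : normc (g t) <= M.
  rewrite -(subrK b (g t)) (le_trans (le_normcD _ _))// /M.
  by have := normc_ge0 a; move/ltW: h2; lra.
have ha : normc a <= M by rewrite /M; have := normc_ge0 b; lra.
have k1 : normc (f t - a) * normc (g t) <= normc (f t - a) * M.
  by rewrite ler_wpM2l ?normc_ge0.
have k2 : normc a * normc (g t - b) <= M * normc (g t - b).
  by rewrite ler_wpM2r ?normc_ge0.
have MM : 0 < M + M by rewrite addr_gt0.
have k3 : normc (f t - a) * (M + M) < e by rewrite -ltr_pdivlMr.
have k4 : normc (g t - b) * (M + M) < e by rewrite -ltr_pdivlMr.
nra.
Unshelve. all: by end_near. Qed.

Lemma cvgcD (T : Type) (G : set_system T) {FG : Filter G} (f g : T -> R[i]) a b :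
  f @ G --> a -> g @ G --> b -> (fun t => f t + g t) @ G --> a + b.
Proof.
move=> /cvgC Ha /cvgC Hb; apply/cvgC => e e0.
have d0 : 0 < e / 2 by rewrite divr_gt0.
near=> t.
rewrite (_ : _ - _ = (f t - a) + (g t - b)); last by ring.
rewrite (le_lt_trans (le_normcD _ _))// (splitr e) ltrD//.
  by near: t; exact: Ha.
by near: t; exact: Hb.
Unshelve. all: by end_near. Qed.

(** The increment form has no quotient: [w = z] needs no separate treatment, and error terms add up
    directly in chain rules and series. The next two lemmas identify it with [is_derive]. *)
Definition cder f z (d : R[i]) := forall e : R, 0 < e -> exists2 r : R, 0 < r &
  forall w, normc (w - z) < r ->
    normc (f w - f z - d * (w - z)) <= e * normc (w - z).

Lemma cder_is_derive f z d : cder f z d -> is_derive z 1 f d.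
Proof.
move=> H.
have cv : (fun h => h^-1 *: (f (h *: 1 + z) - f z)) @ 0^' --> d.
  apply/cvgC => e e0; have e2 : 0 < e / 2 by rewrite divr_gt0.
  have [r r0 Hr] := H _ e2.
  apply/nbhsC; exists r => // h; rewrite subr0 => hr h0.
  have hz : (h *: (1 : R[i]) + z) - z = h by rewrite addrK [h *: _]mulr1.
  have := Hr (h *: 1 + z); rewrite hz => /(_ hr) hle.
  have hn : 0 < normc h by rewrite normc_gt0.
  rewrite (_ : _ - d = h^-1 * (f (h *: 1 + z) - f z - d * h)); last first.
    by rewrite [X in X - d](_ : _ = h^-1 * (f (h *: 1 + z) - f z))//; field.
  rewrite normcM normcV mulrC ltr_pdivrMr// (le_lt_trans hle)//.
  by rewrite ltr_pM2r// ltr_pdivrMr// mulr_natr mulr2n ltrDl.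
apply: DeriveDef; first by apply/cvg_ex; exists d.
exact: cvgc_cst_eq (cvgP _ cv) cv.
Qed.

Lemma is_derive_cder f z d : is_derive z 1 f d -> cder f z d.
Proof.
move=> [dv dE] e e0.
have : (fun h => h^-1 *: (f (h *: 1 + z) - f z)) @ 0^' --> d by rewrite -dE; exact: dv.
move/cvgC => /(_ e e0) /nbhsC[r r0 H]; exists r => // w hw.
have [->|wz] := eqVneq w z; first by rewrite !subrr mulr0 subrr normc0 mulr0.
have wz0 : w - z != 0 by rewrite subr_eq0.
have := H (w - z); rewrite subr0 => /(_ hw wz0) /ltW.
rewrite [_ *: (1 : R[i])]mulr1 subrK.
rewrite (_ : _ - d = (w - z)^-1 * (f w - f z - d * (w - z))); last first.
  by rewrite [X in X - d](_ : _ = (w - z)^-1 * (f w - f z))//; field.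
by rewrite normcM normcV mulrC ler_pdivrMr// normc_gt0.
Qed.

Lemma cder_derivable f z d : cder f z d -> derivable f z 1.
Proof. by move=> /cder_is_derive []. Qed.

Lemma cder_derive1 f z d : cder f z d -> derive1 f z = d.
Proof. by move=> /cder_is_derive [_ <-]; rewrite derive1E. Qed.

Lemma derivable_cder f z : derivable f z 1 -> cder f z (derive1 f z).
Proof. by move=> /derivableP; rewrite -derive1E => /is_derive_cder. Qed.

Lemma cder_near_eq f g z d :
  (exists2 r : R, 0 < r & forall w, normc (w - z) < r -> f w = g w) ->
  cder f z d -> cder g z d.
Proof.
move=> [r r0 fg] H e e0; have [s s0 Hs] := H e e0.
exists (Num.min r s) => [|w]; first by rewrite lt_min r0.
rewrite lt_min => /andP[wr ws]; rewrite -!fg//; last by rewrite subrr normc0.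
exact: Hs.
Qed.

Lemma cder_cst c z : cder (fun=> c) z 0.
Proof.
by move=> e e0; exists 1 => // w _; rewrite subrr mul0r subr0 normc0 mulr_ge0 ?normc_ge0// ltW.
Qed.

Lemma cder_id z : cder id z 1.
Proof.
by move=> e e0; exists 1 => // w _; rewrite mul1r subrr normc0 mulr_ge0 ?normc_ge0// ltW.
Qed.

Lemma cder_continuous f z d : cder f z d ->
  forall e : R, 0 < e -> exists2 r : R, 0 < r &
    forall w, normc (w - z) < r -> normc (f w - f z) < e.
Proof.
move=> H e e0; have [r r0 Hr] := H 1 ltr01.
have M0 : 0 < 1 + normc d by rewrite ltr_wpDr ?normc_ge0.
exists (Num.min r (e / (1 + normc d))) => [|w].
  by rewrite lt_min r0 divr_gt0.
rewrite lt_min => /andP[wr we]; have h := Hr _ wr.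
rewrite -(subrK (d * (w - z)) (f w - f z)) (le_lt_trans (le_normcD _ _))//.
move: h; rewrite mul1r normcM => h.
apply: (le_lt_trans (lerD h (lexx _))).
by move: we; rewrite ltr_pdivlMr//; nra.
Qed.

Lemma cder_cvg f z d : cder f z d -> f @ z --> f z.
Proof.
move=> /cder_continuous H; apply/(@cvgC _ _ (nbhs_filter z)) => e /H[r r0 Hr].
by apply/nbhsC; exists r.
Qed.

Lemma cderD f g z df dg : cder f z df -> cder g z dg ->
  cder (fun w => f w + g w) z (df + dg).
Proof.
move=> /cder_is_derive Hf /cder_is_derive Hg; exact: is_derive_cder (is_deriveD Hf Hg).
Qed.

Lemma cderM f g z df dg : cder f z df -> cder g z dg ->
  cder (fun w => f w * g w) z (df * g z + f z * dg).
Proof.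
move=> /cder_is_derive Hf /cder_is_derive Hg.
rewrite (_ : _ + _ = f z *: dg + g z *: df); last by rewrite addrC [g z *: df]mulrC.
exact: is_derive_cder (is_deriveM Hf Hg).
Qed.

Lemma cderN f z df : cder f z df -> cder (fun w => - f w) z (- df).
Proof.
move=> /cder_is_derive Hf; exact: is_derive_cder (is_deriveN Hf).
Qed.

Lemma cder_comp f g z df dg : cder f z df -> cder g (f z) dg ->
  cder (g \o f) z (dg * df).
Proof.
move=> Hf Hg e e0 /=.
set M := normc df + 1 + normc dg.
have nf := normc_ge0 df; have ng := normc_ge0 dg.
have M0 : 0 < M by rewrite /M; lra.
have MM : 0 < M + M by rewrite addr_gt0.
have d0 : 0 < Num.min 1 (e / (M + M)) by rewrite lt_min ltr01 divr_gt0.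
have [r r0 Hr] := Hg _ d0.
have [s s0 Hs] := Hf _ d0.
have [t t0 Ht] := cder_continuous Hf r0.
exists (Num.min s t) => [|w]; first by rewrite lt_min s0.
rewrite lt_min => /andP[ws wt].
have h1 := Hr _ (Ht _ wt); have h2 := Hs _ ws.
rewrite (_ : _ - _ = (g (f w) - g (f z) - dg * (f w - f z)) +
   dg * (f w - f z - df * (w - z))); last by ring.
rewrite (le_trans (le_normcD _ _))// normcM.
have hf : normc (f w - f z) <= M * normc (w - z).
  rewrite -(subrK (df * (w - z)) (f w - f z)) (le_trans (le_normcD _ _))// normcM.
  apply: (le_trans (lerD h2 (lexx _))); rewrite -mulrDl ler_wpM2r ?normc_ge0// /M.
  have : Num.min 1 (e / (M + M)) <= 1 by rewrite ge_min lexx.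
  lra.
set k := Num.min _ _ in h1 h2 d0.
have hk : k * (M + M) <= e by rewrite -ler_pdivlMr// /k ge_min lexx orbT.
have nw := normc_ge0 (w - z).
have a1 : normc (g (f w) - g (f z) - dg * (f w - f z)) <= k * (M * normc (w - z)).
  by rewrite (le_trans h1)// ler_wpM2l// ltW.
have a2 : normc dg * normc (f w - f z - df * (w - z)) <= M * (k * normc (w - z)).
  by apply: ler_pM => //; rewrite ?normc_ge0// /M; lra.
have := ler_wpM2r nw hk; nra.
Qed.

Lemma cderV z : z != 0 -> cder GRing.inv z (- z^-1 ^+ 2).
Proof.
move=> z0 e e0; have nz : 0 < normc z by rewrite normc_gt0.
have c0 : 0 < e * normc z ^+ 3 / 2 by rewrite divr_gt0// mulr_gt0// exprn_gt0.
exists (Num.min (normc z / 2) (e * normc z ^+ 3 / 2)) => [|w].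
  by rewrite lt_min c0 divr_gt0.
rewrite lt_min => /andP[w1 w2].
have hw : normc z / 2 < normc w.
  have := ler_normcB z w; rewrite normcBC => h; have := le_lt_trans h w1; lra.
have w0 : w != 0 by rewrite -normc_gt0 (lt_trans _ hw)// divr_gt0.
have nw : 0 < normc w by rewrite normc_gt0.
(* The first-order remainder of the inverse is exactly this quotient, hence quadratic as long as [w]
   stays away from [0]. *)
rewrite (_ : _ - _ = (w - z) ^+ 2 / (w * z ^+ 2)); last by field; rewrite z0 w0.
have -> : normc ((w - z) ^+ 2 / (w * z ^+ 2)) =
    (normc (w - z) / (normc w * normc z ^+ 2)) * normc (w - z).
  by rewrite normcM normcX normcV normcM normcX; ring.
rewrite ler_wpM2r ?normc_ge0// ler_pdivrMr ?mulr_gt0 ?exprn_gt0//.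
have : e * normc z ^+ 2 * (normc z / 2) <= e * normc z ^+ 2 * normc w.
  by rewrite ler_wpM2l ?ltW// mulr_gt0// exprn_gt0.
by move/ltW: w2; rewrite !exprS expr0; lra.
Qed.

End ComplexBasics.

(** * The exponential, the mean value inequality and iterated derivatives *)

Section ExpAndSmooth.
Variable R : realType.
Implicit Types (z w a b : R[i]) (f g : R[i] -> R[i]) (U V : set R[i]) (s t : R).

Lemma is_derive_ltr (f : R -> R) (x d : R) : is_derive x 1 f d ->
  forall e : R, 0 < e -> exists2 r : R, 0 < r &
    forall y, `|y - x| < r -> `|f y - f x - d * (y - x)| <= e * `|y - x|.
Proof.
move=> [dv dE] e e0.
have : (fun h => h^-1 *: (f (h *: 1 + x) - f x)) @ 0^' --> d by rewrite -dE; exact: dv.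
move/cvgrPdist_lt => /(_ e e0) /nbhs_ballP[r /= r0 H]; exists r => // y hy.
have [->|yx] := eqVneq y x; first by rewrite !subrr mulr0 subrr normr0 mulr0.
have yx0 : y - x != 0 by rewrite subr_eq0.
have := H (y - x); rewrite -ball_normE /= sub0r normrN => /(_ hy yx0) /ltW.
rewrite [_ *: (1 : R)]mulr1 subrK distrC.
rewrite (_ : _ - d = (y - x)^-1 * (f y - f x - d * (y - x))); last first.
  by rewrite [X in X - d](_ : _ = (y - x)^-1 * (f y - f x))//; field.
by rewrite normrM normfV mulrC ler_pdivrMr// normr_gt0.
Qed.

Lemma ltr_is_derive (f : R -> R) (x d : R) :
  (forall e : R, 0 < e -> exists2 r : R, 0 < r &
    forall y, `|y - x| < r -> `|f y - f x - d * (y - x)| <= e * `|y - x|) ->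
  is_derive x 1 f d.
Proof.
move=> H.
have cv : (fun h => h^-1 *: (f (h *: 1 + x) - f x)) @ 0^' --> d.
  apply/cvgrPdist_lt => e e0; have e2 : 0 < e / 2 by rewrite divr_gt0.
  have [r r0 Hr] := H _ e2.
  apply/nbhs_ballP; exists r => // h; rewrite -ball_normE /= sub0r normrN => hr h0.
  have hx : (h *: (1 : R) + x) - x = h by rewrite addrK [h *: _]mulr1.
  have := Hr (h *: 1 + x); rewrite hx => /(_ hr) hle.
  have hn : 0 < `|h| by rewrite normr_gt0.
  rewrite distrC (_ : _ - d = h^-1 * (f (h *: 1 + x) - f x - d * h)); last first.
    by rewrite [X in X - d](_ : _ = h^-1 * (f (h *: 1 + x) - f x))//; field.
  rewrite normrM normfV mulrC ltr_pdivrMr// (le_lt_trans hle)//.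
  by rewrite ltr_pM2r// ltr_pdivrMr// mulr_natr mulr2n ltrDl.
apply: DeriveDef; first by apply/cvg_ex; exists d.
exact: cvg_lim cv.
Qed.

Lemma normc_expi (t : R) : normc (expi t) = 1.
Proof. by rewrite /= cos2Dsin2 sqrtr1. Qed.

Definition cexp z : R[i] := (expR (complex.Re z))%:C * expi (complex.Im z).

Lemma cexpD z w : cexp (z + w) = cexp z * cexp w.
Proof.
case: z w => [x y] [u v]; rewrite /cexp /expi /= expRD cosD sinD; simpc.
by apply/eqP; rewrite eq_complex /=; apply/andP; split; apply/eqP; ring.
Qed.

Lemma cexp0 : cexp 0 = 1.
Proof. by rewrite /cexp /expi /= expR0 cos0 sin0 mul1r. Qed.

Lemma normc_cexp z : normc (cexp z) = expR (complex.Re z).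
Proof. by rewrite /cexp normcM normc_expi mulr1 normc_real ger0_norm// expR_ge0. Qed.

Lemma cexp_neq0 z : cexp z != 0.
Proof. by rewrite -normc_eq0 normc_cexp gt_eqF// expR_gt0. Qed.

(** The functional equation reduces everything to the origin, where the real expansions of [expR],
    [cos] and [sin] are combined. *)
Lemma cder_cexp z : cder cexp z (cexp z).
Proof.
suff H : cder cexp 0 1.
  move=> e e0; have E := expR_gt0 (complex.Re z).
  have [r r0 Hr] := H (e / expR (complex.Re z)) (divr_gt0 e0 E).
  exists r => // w wz; have := Hr (w - z); rewrite !subr0 => /(_ wz).
  rewrite cexp0 mul1r => h.
  rewrite (_ : _ - _ = cexp z * (cexp (w - z) - 1 - (w - z))); last first.
    have -> : cexp w = cexp z * cexp (w - z) by rewrite -cexpD addrC subrK.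
    by ring.
  by rewrite normcM normc_cexp mulrC -ler_pdivlMr// mulrAC.
move=> e e0.
(* The errors add up to at most six times [e' |h|]. The radius [e' / 2] chosen below keeps
   [|exp x - 1| <= e']. *)
set e' := Num.min 1 (e / 8).
have e'0 : 0 < e' by rewrite lt_min ltr01 divr_gt0.
have e'1 : e' <= 1 by rewrite ge_min lexx.
have e'e : e' * 8 <= e by rewrite -ler_pdivlMr// ge_min lexx orbT.
have [r1 r10 H1] := is_derive_ltr (is_derive_expR 0) e'0.
have [r2 r20 H2] := is_derive_ltr (is_derive_cos 0) e'0.
have [r3 r30 H3] := is_derive_ltr (is_derive_sin 0) e'0.
exists (Num.min (Num.min r1 r2) (Num.min r3 (e' / 2))) => [|h].
  by rewrite !lt_min r10 r20 r30 divr_gt0.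
rewrite !subr0 cexp0 mul1r !lt_min => /andP[/andP[l1 l2] /andP[l3 l4]].
have rx := abs_Re_le h; have ry := abs_Im_le h.
move: (H1 (complex.Re h)) (H2 (complex.Im h)) (H3 (complex.Im h)).
rewrite !subr0 expR0 cos0 sin0 oppr0 mul0r !subr0 !mul1r addr0.
move=> /(_ (le_lt_trans rx l1)) k1 /(_ (le_lt_trans ry l2)) k2 /(_ (le_lt_trans ry l3)) k3.
apply: (le_trans (normc_le_ReIm _)).
rewrite /cexp /expi; case: h rx ry l1 l2 l3 l4 k1 k2 k3 => x y /=.
set N := Num.sqrt _; set E := expR x; set C := cos y; set S := sin y.
move=> rx ry _ _ _ l4 k1 k2 k3; rewrite subr0 !mul0r subr0 addr0.
have aE1 : `|E - 1| <= e'.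
  rewrite -(subrK x (E - 1)) (le_trans (ler_normD _ _))//.
  have : e' * `|x| <= 1 * `|x| by rewrite ler_wpM2r.
  lra.
have aE : `|E| <= 2.
  by rewrite -(subrK 1 E) (le_trans (ler_normD _ _))// normr1; lra.
rewrite (_ : E * C - 1 - x = E * (C - 1) + (E - 1 - x)); last by ring.
rewrite (_ : E * S - y = E * (S - y) + (E - 1) * y); last by ring.
have := ler_normD (E * (C - 1)) (E - 1 - x).
have := ler_normD (E * (S - y)) ((E - 1) * y).
rewrite !normrM => j1 j2.
have j3 : `|E| * `|C - 1| <= 2 * (e' * `|y|) by rewrite ler_pM.
have j4 : `|E| * `|S - y| <= 2 * (e' * `|y|) by rewrite ler_pM.
have j5 : `|E - 1| * `|y| <= e' * `|y| by rewrite ler_wpM2r.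
have j6 : e' * `|y| <= e' * N by rewrite ler_wpM2l ?(ltW e'0).
have j7 : e' * `|x| <= e' * N by rewrite ler_wpM2l ?(ltW e'0).
have j8 : e' * 8 * N <= e * N by rewrite ler_wpM2r// sqrtr_ge0.
have j9 : 0 <= e' * N by rewrite mulr_ge0 ?sqrtr_ge0 ?(ltW e'0).
lra.
Qed.

(** Restricting a complex function to a segment gives a curve in a real parameter; its real part
    falls under the real mean value theorem. *)
Definition rcder (c : R -> R[i]) (t : R) (d : R[i]) := forall e : R, 0 < e ->
  exists2 r : R, 0 < r & forall s, `|s - t| < r ->
    normc (c s - c t - d * (s - t)%:C) <= e * `|s - t|.

Lemma rcder_affine a b t : rcder (fun s => a + s%:C * b) t b.
Proof.
move=> e e0; exists 1 => // s _.
have -> : a + s%:C * b - (a + t%:C * b) - b * (s - t)%:C = 0.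
  by rewrite real_complexB; ring.
by rewrite normc0 mulr_ge0// ltW.
Qed.

Lemma rcder_comp (c : R -> R[i]) f t (dc df : R[i]) : rcder c t dc -> cder f (c t) df ->
  rcder (f \o c) t (df * dc).
Proof.
move=> Hf Hg e e0 /=.
set M := normc dc + 1 + normc df.
have nf := normc_ge0 dc; have ng := normc_ge0 df.
have M0 : 0 < M by rewrite /M; lra.
have MM : 0 < M + M by rewrite addr_gt0.
have d0 : 0 < Num.min 1 (e / (M + M)) by rewrite lt_min ltr01 divr_gt0.
have [r r0 Hr] := Hg _ d0.
have [s s0 Hs] := Hf _ d0.
set k := Num.min _ _ in Hr Hs d0.
have k1 : k <= 1 by rewrite ge_min lexx.
have hk : k * (M + M) <= e by rewrite -ler_pdivlMr// /k ge_min lexx orbT.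
exists (Num.min s (r / M)) => [|w]; first by rewrite lt_min s0 divr_gt0.
rewrite lt_min => /andP[ws wt].
have h2 := Hs _ ws; have nw := normr_ge0 (w - t).
have hf : normc (c w - c t) <= M * `|w - t|.
  rewrite -(subrK (dc * (w - t)%:C) (c w - c t)) (le_trans (le_normcD _ _))//.
  rewrite normcM normc_real.
  apply: (le_trans (lerD h2 (lexx _))); rewrite -mulrDl ler_wpM2r// /M; lra.
have h1 : normc (f (c w) - f (c t) - df * (c w - c t)) <= k * normc (c w - c t).
  by apply: Hr; rewrite (le_lt_trans hf)// mulrC -ltr_pdivlMr.
rewrite (_ : _ - _ = (f (c w) - f (c t) - df * (c w - c t)) +
   df * (c w - c t - dc * (w - t)%:C)); last by ring.
rewrite (le_trans (le_normcD _ _))// normcM.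
have a1 : normc (f (c w) - f (c t) - df * (c w - c t)) <= k * (M * `|w - t|).
  by rewrite (le_trans h1)// ler_wpM2l// ltW.
have a2 : normc df * normc (c w - c t - dc * (w - t)%:C) <= M * (k * `|w - t|).
  by apply: ler_pM => //; rewrite ?normc_ge0// /M; lra.
have := ler_wpM2r nw hk; lra.
Qed.

Lemma rcder_Re (c : R -> R[i]) t d : rcder c t d ->
  is_derive t 1 (fun s => complex.Re (c s)) (complex.Re d).
Proof.
move=> H; apply: ltr_is_derive => e /H[r r0 Hr]; exists r => // s /Hr.
apply: le_trans; apply: le_trans (abs_Re_le _).
case: (c s) (c t) d {Hr H} => [x y] [u v] [p q] /=.
by rewrite mulr0 subr0.
Qed.

(** The mean value theorem fails for complex values, so [f] is projected on the direction of its
    total increment: the real function [Re (conj (f b - f a) f)] grows by [|f b - f a|^2] along the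
    segment. *)
Lemma mvt_ineq f (df : R[i] -> R[i]) a b (M : R) :
  (forall s, 0 <= s <= 1 -> cder f (a + s%:C * (b - a)) (df (a + s%:C * (b - a)))) ->
  (forall s, 0 <= s <= 1 -> normc (df (a + s%:C * (b - a))) <= M) ->
  normc (f b - f a) <= M * normc (b - a).
Proof.
move=> Hd HM.
have [->|fab] := eqVneq (f b) (f a).
  rewrite subrr normc0 mulr_ge0 ?normc_ge0//.
  by rewrite (le_trans (normc_ge0 _) (HM 0 _))// lexx ler01.
set c := conjc (f b - f a).
pose phi s := complex.Re (c * f (a + s%:C * (b - a))).
pose dphi s := complex.Re (c * (df (a + s%:C * (b - a)) * (b - a))).
have D s : 0 <= s <= 1 -> is_derive s 1 phi (dphi s).
  move=> hs; apply: (@rcder_Re (fun s => c * f (a + s%:C * (b - a)))).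
  have h := rcder_comp (rcder_affine a (b - a) s) (Hd s hs).
  have hm : cder (fun w => c * w) (f (a + s%:C * (b - a))) c.
    have := cderM (cder_cst c (f (a + s%:C * (b - a)))) (cder_id _).
    by rewrite mul0r add0r mulr1.
  exact: rcder_comp h hm.
have [||s /andP[s0 s1] E] := @MVT_segment R phi dphi 0 1 ler01.
- by move=> s; rewrite in_itv /= => /andP[s0 s1]; apply: D; rewrite !ltW.
- apply: derivable_within_continuous => s; rewrite in_itv /= => hs.
  by have [] := D s hs.
have hs : 0 <= s <= 1 by apply/andP; split.
have E2 : phi 1 - phi 0 = normc (f b - f a) ^+ 2.
  rewrite /phi !mul1r !mul0r addr0 addrCA subrr addr0 sqr_normc_ReIm /c.
  case: (f b) (f a) => [x y] [u v] /=; ring.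
have n0 : 0 < normc (f b - f a) by rewrite normc_gt0 subr_eq0.
have : normc (f b - f a) ^+ 2 <= normc (f b - f a) * (M * normc (b - a)).
  rewrite -E2 E subr0 mulr1 (le_trans (Re_le_normc _))//.
  rewrite !normcM /c normcJ ler_wpM2l ?normc_ge0// ler_wpM2r ?normc_ge0//.
  exact: HM.
by rewrite expr2 ler_pM2l.
Qed.

(** Derivatives are carried as witnesses, so that closure properties follow by induction from the
    first-order rules. Order [0] imposes no condition. *)
Fixpoint smooth n U f : Prop := if n is m.+1 then
  exists g, (forall z, U z -> cder f z (g z)) /\ smooth m U g else True.

Lemma smoothW n U f : smooth n.+1 U f -> smooth n U f.
Proof.
elim: n f => [//|n IH] f [g [fg sg]]; exists g; split => //.
exact: IH.
Qed.

Lemma smooth_sub n U V f : V `<=` U -> smooth n U f -> smooth n V f.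
Proof.
move=> VU; elim: n f => [//|n IH] f [g [fg sg]]; exists g; split.
  by move=> z /VU; apply: fg.
exact: IH.
Qed.

Lemma smooth_cst n U c : smooth n U (fun=> c).
Proof.
elim: n c => [//|n IH] c; exists (fun=> 0); split => // z _; exact: cder_cst.
Qed.

Lemma smoothD n U f g : smooth n U f -> smooth n U g -> smooth n U (fun z => f z + g z).
Proof.
elim: n f g => [//|n IH] f g [f' [ff sf]] [g' [gg sg]].
exists (fun z => f' z + g' z); split; last exact: IH.
by move=> z Uz; apply: cderD; [exact: ff|exact: gg].
Qed.

Lemma smoothM n U f g : smooth n U f -> smooth n U g -> smooth n U (fun z => f z * g z).
Proof.
elim: n f g => [//|n IH] f g sf sg.
have [f' [ff sf']] := sf; have [g' [gg sg']] := sg.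
exists (fun z => f' z * g z + f z * g' z); split.
  by move=> z Uz; apply: cderM; [exact: ff|exact: gg].
by apply: smoothD; apply: IH => //; apply: smoothW.
Qed.

Lemma smooth_cexp n U f : smooth n U f -> smooth n U (fun z => cexp (f z)).
Proof.
elim: n f => [//|n IH] f sf; have [f' [ff sf']] := sf.
exists (fun z => cexp (f z) * f' z); split.
  by move=> z Uz; apply: (cder_comp (ff _ Uz)); exact: cder_cexp.
by apply: smoothM => //; apply: IH; apply: smoothW.
Qed.

Lemma smooth_eq n U f g : open U -> (forall z, U z -> f z = g z) ->
  smooth n U f -> smooth n U g.
Proof.
move=> oU fg; case: n => [//|n] [f' [ff sf]]; exists f'; split => // z Uz.
apply: cder_near_eq (ff _ Uz).
by have [r r0 Hr] := (openC U).1 oU z Uz; exists r => // w /Hr /fg.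
Qed.

Lemma smooth_derive1 n U f : open U -> smooth n.+1 U f -> smooth n U (derive1 f).
Proof.
move=> oU [g [fg sg]]; apply: smooth_eq oU _ sg => z Uz.
by rewrite (cder_derive1 (fg z Uz)).
Qed.

Lemma smooth_cder n U f z : smooth n.+1 U f -> U z -> cder f z (derive1 f z).
Proof. by move=> [g [fg _]] /fg h; rewrite (cder_derive1 h). Qed.

(** Local witnesses glue because a derivative is unique: all of them agree with [derive1 f]. *)
Lemma smooth_local n U f :
  (forall z, U z -> exists V, [/\ open V, V z & smooth n V f]) -> smooth n U f.
Proof.
elim: n f => [//|n IH] f H; exists (derive1 f); split.
  by move=> z /H[V [_ Vz sV]]; exact: smooth_cder sV Vz.
apply: IH => z /H[V [oV Vz sV]]; exists V; split => //.
exact: smooth_derive1.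
Qed.

(** Once the quadratic polynomial is subtracted, the derivative at distance [rho] from [z] is
    [o(rho)] by differentiability of [f'] at [z]; the mean value inequality turns this into
    [o(rho^2)]. *)
Lemma smooth_taylor2 U f z : open U -> U z -> smooth 2 U f ->
  exists a b, forall e : R, 0 < e -> exists2 r : R, 0 < r &
    forall h, normc h < r ->
      normc (f (z + h) - f z - a * h - b * h ^+ 2) <= e * normc h ^+ 2.
Proof.
move=> oU Uz [g [fg [g' [gg _]]]].
exists (g z), (g' z / 2) => e e0.
have [r r0 Hr] := gg z Uz e e0.
have [s s0 Hs] := (openC U).1 oU z Uz.
exists (Num.min r s) => [|h]; first by rewrite lt_min r0.
rewrite lt_min => /andP[hr hs].
pose k w := f w + (- (g z * (w - z)) + - (g' z / 2 * ((w - z) * (w - z)))).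
pose dk w := g w + (- g z + - (g' z * (w - z))).
have seg u : 0 <= u <= 1 -> normc (u%:C * h) <= normc h.
  by move=> /andP[u0 u1]; rewrite normcM normc_real ger0_norm// ler_piMl ?normc_ge0.
have dsub w : cder (fun w => w - z) w 1.
  by have := cderD (cder_id w) (cder_cst (- z) w); rewrite addr0.
have dlin c w : cder (fun w => c * (w - z)) w c.
  by have := cderM (cder_cst c w) (dsub w); rewrite mul0r add0r mulr1.
have H : normc (k (z + h) - k z) <= (e * normc h) * normc (z + h - z).
  apply: (@mvt_ineq k dk) => u hu; rewrite [z + h - z]addrC addKr.
    have zU : U (z + u%:C * h).
      by apply: Hs; rewrite addrC addKr (le_lt_trans (seg u hu)).
    rewrite /k /dk; apply: cderD; first exact: fg.
    apply: cderD; first exact: cderN.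
    apply: cderN.
    have := cderM (cder_cst (g' z / 2) (z + u%:C * h))
      (cderM (dsub (z + u%:C * h)) (dsub (z + u%:C * h))).
    set X := (X in cder _ _ X) => HX; set Y := (Y in cder _ _ Y).
    by rewrite (_ : Y = X)// /X /Y; field.
  have := Hr (z + u%:C * h); rewrite [_ + _ - z]addrC addKr.
  move=> /(_ (le_lt_trans (seg u hu) hr)).
  rewrite /dk [z + u%:C * h - z]addrC addKr addrA => /le_trans; apply.
  by rewrite ler_wpM2l ?seg// ltW.
move: H; rewrite [z + h - z]addrC addKr -mulrA -expr2.
apply: le_trans; rewrite /k !subrr !mulr0 oppr0 !addr0 [z + h - z]addrC addKr.
by rewrite le_eqVlt; apply/orP; left; apply/eqP; congr normc; ring.
Qed.

Lemma cder0_cst f U a b :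
  (forall s, 0 <= s <= 1 -> U (a + s%:C * (b - a))) ->
  (forall z, U z -> cder f z 0) -> f b = f a.
Proof.
move=> HU Hf; apply/eqP; rewrite -subr_eq0 -normc_eq0 eq_le normc_ge0 andbT.
rewrite -[leRHS](mul0r (normc (b - a))); apply: (@mvt_ineq f (fun=> 0)) => s hs.
  exact/Hf/HU.
by rewrite normc0.
Qed.

End ExpAndSmooth.

(** * The maximum principle on the disk *)

Section MaximumPrinciple.
Variable R : realType.
Implicit Types (z w a b : R[i]) (f g : R[i] -> R[i]) (U V : set R[i]) (s t : R).

Lemma diskE z : disk z = (normc z < 1). Proof. by []. Qed.

Lemma open_disk : open (@disk R).
Proof.
apply/openC => z; rewrite diskE => hz; exists (1 - normc z); first by rewrite subr_gt0.
move=> w hw; rewrite diskE -(subrK z w) (le_lt_trans (le_normcD _ _))//.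
by rewrite -ltrBrDr.
Qed.

Lemma normc_continuous : continuous (@normc R).
Proof. by move=> z; exact: (@normc_cvg R _ (nbhs z) (nbhs_filter z) id z (@cvg_id _ _)). Qed.

Lemma compact_closed_disk : compact (@closed_disk R).
Proof.
pose c (p : R * R) : R[i] := p.1 +i* p.2.
have cc : continuous c.
  move=> p; apply/(@cvgC _ _ _ (nbhs_filter p)) => e e0.
  have e2 : 0 < e / 2 by rewrite divr_gt0.
  near=> q.
  rewrite (le_lt_trans (normc_le_ReIm _))//= (splitr e) ltrD//.
    near: q; have : (fun q : R * R => q.1) @ p --> p.1 by apply: cvg_fst.
    by move/cvgrPdist_lt/(_ _ e2); apply: filterS => q; rewrite distrC.
  near: q; have : (fun q : R * R => q.2) @ p --> p.2 by apply: cvg_snd.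
  by move/cvgrPdist_lt/(_ _ e2); apply: filterS => q; rewrite distrC.
have K : compact (c @` (`[-1, 1] `*` `[-1, 1])).
  apply: continuous_compact; first exact: continuous_subspaceT.
  by apply: compact_setX; apply: segment_compact.
apply: (subclosed_compact _ K).
  rewrite (_ : @closed_disk R = @normc R @^-1` [set x | x <= 1])//.
  apply: closed_comp; last exact: closed_le.
  by move=> z _; exact: normc_continuous.
move=> z hz; exists (complex.Re z, complex.Im z); last by case: z {hz}.
have rx := abs_Re_le z; have ry := abs_Im_le z.
by split=> /=; rewrite in_itv /= -ler_norml (le_trans _ hz).
Unshelve. all: by end_near. Qed.

Lemma smooth_id n U : smooth n U id.
Proof.
case: n => [//|n]; exists (fun=> 1); split; first by move=> z _; exact: cder_id.
exact: smooth_cst.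
Qed.

Lemma normc_sqrD a b :
  normc (a + b) ^+ 2 = normc a ^+ 2 + 2 * complex.Re (conjc a * b) + normc b ^+ 2.
Proof. by rewrite !sqr_normc_ReIm; case: a b => [x y] [u v] /=; ring. Qed.

(* At an interior maximum [z0] of [|G| exp(d |z|^2)], multiplying [G] by a suitable
   exponential gives [K] with [K z0 = 1] and [|K (z0 + h)| <= exp (- d |h|^2)];
   averaging over [h], [ih], [-h], [-ih] kills the first and second order terms
   of the Taylor expansion of [K]. *)
Lemma no_interior_max (G : R[i] -> R[i]) z0 (d : R) :
  smooth 2 (@disk R) G -> disk z0 -> 0 < d -> G z0 != 0 ->
  ~ (forall z, disk z ->
       normc (G z) * expR (d * normc z ^+ 2) <=
       normc (G z0) * expR (d * normc z0 ^+ 2)).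
Proof.
move=> sG D0 d0 G0 H.
pose K w := (G z0)^-1 * (G w * cexp ((2 * d)%:C * conjc z0 * (w + - z0))).
have sK : smooth 2 (@disk R) K.
  apply: smoothM; first exact: smooth_cst.
  apply: smoothM => //; apply: smooth_cexp.
  apply: smoothM; first exact: smooth_cst.
  by apply: smoothD; [exact: smooth_id|exact: smooth_cst].
have K0 : K z0 = 1 by rewrite /K subrr mulr0 cexp0 mulr1 mulVf.
have KE h : disk (z0 + h) -> normc (K (z0 + h)) <= expR (- (d * normc h ^+ 2)).
  move=> /H h1; rewrite /K [z0 + h - z0]addrC addKr normcM normcM normcV normc_cexp.
  have n0 : 0 < normc (G z0) by rewrite normc_gt0.
  move: h1; rewrite -ler_pdivlMr ?expR_gt0// -expRN => h1.
  rewrite mulrC ler_pdivrMr// [leRHS]mulrC.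
  apply: (le_trans (ler_wpM2r (expR_ge0 _) h1)).
  rewrite -!mulrA -!expRD ler_wpM2l ?normc_ge0//.
  rewrite ler_expR normc_sqrD.
  have -> : complex.Re ((2 * d)%:C * (z0^*%C * h)) = 2 * d * complex.Re (z0^*%C * h).
    by case: z0 h {H h1 D0 G0 K sK K0 n0} => [x y] [u v] /=; ring.
  lra.
have [a [b T]] := smooth_taylor2 open_disk D0 sK.
have d4 : 0 < d / 4 by rewrite divr_gt0.
have [r r0 Hr] := T _ d4.
have [s s0 Hs] := (openC _).1 open_disk z0 D0.
set rho := Num.min (Num.min r s) (Num.min 1 (1 / d)) / 2.
have rho0 : 0 < rho by rewrite divr_gt0// !lt_min r0 s0 ltr01 divr_gt0.
have m0 : 0 < Num.min (Num.min r s) (Num.min 1 (1 / d)).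
  by rewrite !lt_min r0 s0 ltr01 divr_gt0.
have rhom : rho < Num.min (Num.min r s) (Num.min 1 (1 / d)).
  by rewrite /rho ltr_pdivrMr// mulr_natr mulr2n ltrDl.
move: rhom; rewrite !lt_min => /andP[/andP[rr rs] /andP[r1 rd]].
have B h : normc h = rho ->
    1 + complex.Re (a * h + b * h ^+ 2) - d / 4 * rho ^+ 2 <= expR (- (d * rho ^+ 2)).
  move=> hr; rewrite -hr; apply: le_trans (KE h _); last first.
    by apply: Hs; rewrite addrC addKr hr.
  apply: le_trans (Re_le_normc _).
  have := Hr h; rewrite hr K0 => /(_ rr).
  move/(le_trans (abs_Re_le _)); rewrite ler_norml => /andP[+ _].
  have -> : complex.Re (K (z0 + h) - 1 - a * h - b * h ^+ 2) =
     complex.Re (K (z0 + h)) - 1 - complex.Re (a * h + b * h ^+ 2).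
    by case: (K _) (a * h) (b * h ^+ 2) => [x y] [u v] [p q] /=; ring.
  lra.
have rhon : normc rho%:C = rho by rewrite normc_real gtr0_norm.
have := B rho%:C rhon.
have := B (- rho%:C); rewrite normcN => /(_ rhon).
have in_ : normc ('i * rho%:C) = rho :> R.
  by rewrite normcM rhon /= expr0n add0r expr1n sqrtr1 mul1r.
have := B ('i * rho%:C) in_.
have := B (- ('i * rho%:C)); rewrite normcN => /(_ in_).
(* With [x = d rho^2 <= 1], the four bounds add up to [4 - x <= 4 exp(-x)]. Together with
   [exp(-x) (1 + x) <= 1] this forces [x (3 - x) <= 0], which is impossible for [0 < x <= 1]. *)
have hE : expR (- (d * rho ^+ 2)) * (1 + d * rho ^+ 2) <= 1.
  rewrite -[leRHS](expRxMexpNx_1 (d * rho ^+ 2)) mulrC ler_wpM2r ?expR_ge0//.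
  exact: expR_ge1Dx.
case: a b {T Hr B} => [a1 a2] [b1 b2].
rewrite !expr2 /= => B1 B2 B3 B4.
have B5 : 4 - d * rho ^+ 2 <= 4 * expR (- (d * rho ^+ 2)).
  by move: B1 B2 B3 B4; rewrite expr2; lra.
have dr1 : d * rho ^+ 2 <= 1.
  have : d * rho <= 1 by rewrite mulrC -ler_pdivlMr// ltW.
  by rewrite expr2; nra.
have dr0 : 0 < d * rho ^+ 2 by rewrite mulr_gt0// exprn_gt0.
nra.
Qed.

(** If [|G|] took a value [exp s > 1], the perturbation [|G| exp(d |z|^2)] with [d = s / 2] would be
    at most [exp(3 s / 4)] near the circle, below that value. Its maximum would then be interior,
    against [no_interior_max]. *)
Lemma max_modulus (G : R[i] -> R[i]) : smooth 2 (@disk R) G ->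
  (forall zeta, circle zeta -> forall e : R, 0 < e -> exists2 r : R, 0 < r &
     forall z, disk z -> normc (z - zeta) < r -> normc (G z) <= expR e) ->
  forall z, disk z -> normc (G z) <= 1.
Proof.
move=> sG HB zs Ds; rewrite leNgt; apply/negP => L1.
set L := normc (G zs) in L1.
have s0 : 0 < ln L by rewrite ln_gt0.
set s := ln L in s0.
have Ls : L = expR s by rewrite lnK// posrE (lt_trans _ L1).
pose d := s / 2; have d0 : 0 < d by rewrite divr_gt0.
pose Phi z := normc (G z) * expR (d * normc z ^+ 2).
pose c0 := expR (s / 4 + s / 2).
(* Flooring at [c0] and extending by [c0] gives a function continuous on the whole plane, because
   [Phi <= c0] near every point of the circle; compactness of the closed disk then yields a
   maximum. *)
pose Psi z := if `[< disk z >] then Num.max (Phi z) c0 else c0.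
have HB4 zeta : circle zeta -> exists2 r : R, 0 < r &
     forall z, disk z -> normc (z - zeta) < r -> Phi z <= c0.
  have s4 : 0 < s / 4 by rewrite divr_gt0.
  move=> /HB /(_ _ s4)[r r0 Hr]; exists r => // z Dz hz.
  rewrite /Phi /c0 expRD; apply: ler_pM; rewrite ?normc_ge0 ?expR_ge0//.
    exact: Hr.
  rewrite ler_expR ler_piMr ?(ltW d0)// expr_le1 ?normc_ge0//.
  exact: ltW.
have cPsi : continuous Psi.
  move=> z; have [Dz|nDz] := boolP `[< disk z >].
    have Dz' : disk z by apply/asboolP.
    have hG : (fun w => normc (G w)) @ z --> normc (G z).
      apply: (@normc_cvg _ _ _ (nbhs_filter z)).
      exact: cder_cvg (smooth_cder sG Dz').
    have hd : (fun w => d * normc w ^+ 2) @ z --> d * normc z ^+ 2.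
      have h1 := @normc_continuous z.
      exact: (cvgM (cvg_cst d) (cvgM h1 h1)).
    have hE : (fun w => expR (d * normc w ^+ 2)) @ z --> expR (d * normc z ^+ 2).
      by apply: (cvg_comp _ _ hd); exact: continuous_expR.
    have cPhi : Phi @ z --> Phi z by exact: cvgM hG hE.
    have : (fun w => Num.max (Phi w) c0) @ z --> Num.max (Phi z) c0.
      apply/(@cvgrPdist_lt _ _ _ _ (nbhs_filter z)) => e e0.
      move/(@cvgrPdist_lt _ _ _ _ (nbhs_filter z)): cPhi => /(_ _ e0).
      apply: filterS => w; rewrite !ltr_norml => /andP[h1 h2].
      by case: (leP (Phi z) c0); case: (leP (Phi w) c0); lra.
    rewrite /continuous_at (_ : Psi z = Num.max (Phi z) c0); last by rewrite /Psi Dz.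
    apply: cvg_trans; apply: (@near_eq_cvg _ _ _ (nbhs_filter z)).
    have [r r0 Hr] := (openC _).1 open_disk z Dz'.
    by apply/nbhsC; exists r => // w /Hr Dw; rewrite /Psi asboolT.
  suff [r r0 Hr] : exists2 r : R, 0 < r & forall w, normc (w - z) < r -> Psi w = c0.
    apply/(@cvgrPdist_lt _ _ _ _ (nbhs_filter z)) => e e0; apply/nbhsC; exists r => // w /Hr ->.
    by rewrite /Psi (negbTE nDz) subrr normr0.
  have nz : 1 <= normc z by rewrite leNgt; apply: contra nDz => h; apply/asboolP.
  have [z1|z1] := eqVneq (normc z) 1.
    have [r r0 Hr] := HB4 z z1; exists r => // w hw; rewrite /Psi.
    case: ifPn => // /asboolP Dw; apply/max_idPr; exact: Hr.
  exists (normc z - 1); first by rewrite subr_gt0 lt_neqAle eq_sym z1.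
  move=> w hw; rewrite /Psi; case: ifPn => // /asboolP Dw.
  by exfalso; move: hw Dw; rewrite normcBC diskE; have := ler_normcB z w; lra.
have [|||z0 K0 M] := compact_EVT_max (f := Psi) (A := @closed_disk R).
- by exists zs; apply: ltW.
- exact: compact_closed_disk.
- exact: continuous_subspaceT.
have c0L : c0 < L by rewrite Ls ltr_expR; lra.
have PL : L <= Phi zs.
  rewrite /Phi -/L ler_peMr ?(le_trans _ (ltW L1))// -expR0 ler_expR.
  by rewrite mulr_ge0 ?(ltW d0)// sqr_ge0.
have DM z : disk z -> Phi z <= Psi z0.
  move=> Dz; have : z \in @closed_disk R by rewrite inE; apply: ltW.
  by move/M; apply: le_trans; rewrite /Psi asboolT// le_max lexx.
have h1 : L <= Psi z0 by apply: le_trans PL _; apply: DM.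
have D0 : disk z0.
  apply: contrapT => nD; move: h1; rewrite /Psi asboolF// leNgt; by rewrite c0L.
have P0 : Psi z0 = Phi z0.
  rewrite /Psi asboolT//; apply/max_idPl; rewrite leNgt; apply/negP => h.
  move: h1; rewrite /Psi asboolT// (max_idPr (ltW h)) leNgt; by rewrite c0L.
apply: (@no_interior_max G z0 d sG D0 d0).
  apply/eqP => G0; move: h1; rewrite P0 /Phi G0 normc0 mul0r leNgt.
  by rewrite (lt_trans _ L1).
by move=> z Dz; have := DM z Dz; rewrite P0.
Qed.

End MaximumPrinciple.

(** * Integration over the period and the Cauchy, Herglotz and Poisson kernels *)

Section PoissonIntegrals.
Variable R : realType.
Implicit Types (z w a b : R[i]) (f g : R[i] -> R[i]) (U V : set R[i]) (s t : R).
Implicit Types (q : R -> R) (h : R[i] -> R) (k : R -> R[i]).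
Local Notation mu := (@lebesgue_measure R).
Local Notation per := (@period R).

Definition per_measurable q := measurable_fun (per : set (measurableTypeR R)) (q : measurableTypeR R -> R).

Definition per_integrable q := mu.-integrable per (EFin \o q).
Definition per_integral q : R := \int[mu]_(t in per) q t.

Lemma pi2_gt0 : 0 < pi *+ 2 :> R.
Proof. by rewrite mulrn_wgt0// pi_gt0. Qed.

Lemma measurable_per : measurable (per : set (measurableTypeR R)).
Proof. exact: measurable_itv. Qed.

Lemma mu_per : mu per = (pi *+ 2)%:E.
Proof.
by rewrite /period lebesgue_measure_itv /= lte_fin pi2_gt0 -EFinB subr0.
Qed.

Lemma per_integrable_bounded q (M : R) : per_measurable q -> (forall t, `|q t| <= M) -> per_integrable q.
Proof.
move=> mq qM; apply: (@measurable_bounded_integrable _ _ _ mu _ _ measurable_per) => //.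
  by have := ltry (pi *+ 2 : R); rewrite -mu_per.
exists M; split; first exact: num_real.
by move=> x Mx t _; exact: le_trans (qM t) (ltW Mx).
Qed.

Lemma per_integrable_cst (c : R) : per_integrable (fun=> c).
Proof. by apply: (@per_integrable_bounded _ `|c|); [exact: measurable_cst|move=> t]. Qed.

Lemma per_integral_cst (c : R) : per_integral (fun=> c) = c * pi *+ 2.
Proof.
apply: (etrans (Rintegral_cst mu measurable_per c)).
by rewrite -mulrnAr; congr (_ * _); rewrite -[RHS]/(fine (pi *+ 2)%:E) -mu_per.
Qed.

Lemma per_integrableD q1 q2 : per_integrable q1 -> per_integrable q2 -> per_integrable (fun t => q1 t + q2 t).
Proof. by move=> h1 h2; apply: (integrableD measurable_per h1 h2). Qed.

Lemma per_integrableZ (c : R) q : per_integrable q -> per_integrable (fun t => c * q t).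
Proof. by move=> h1; apply: (integrableZl measurable_per c h1). Qed.

Lemma per_integrableN q : per_integrable q -> per_integrable (fun t => - q t).
Proof. by move=> /(per_integrableZ (-1)); rewrite /per_integrable; under eq_fun do rewrite /= mulN1r. Qed.

Lemma per_integrableB q1 q2 : per_integrable q1 -> per_integrable q2 -> per_integrable (fun t => q1 t - q2 t).
Proof. by move=> h1 /per_integrableN; apply: per_integrableD. Qed.

Lemma per_integrable_abs q : per_integrable q -> per_integrable (fun t => `|q t|).
Proof. by move=> h1; apply: (integrable_abse h1). Qed.

Lemma per_integrableM q (p : R -> R) (M : R) : per_integrable q -> per_measurable p ->
  (forall t, `|p t| <= M) -> per_integrable (fun t => q t * p t).
Proof.
move=> h1 mp pM; apply: (integrableMl measurable_per h1 mp).
exists M; split; first exact: num_real.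
by move=> x Mx t _; exact: le_trans (pM t) (ltW Mx).
Qed.

Lemma per_integrable_le q1 q2 : per_measurable q1 -> per_integrable q2 ->
  (forall t, per t -> `|q1 t| <= q2 t) -> per_integrable q1.
Proof.
move=> m1 i2 le12; apply: (le_integrable measurable_per _ _ i2).
  exact/measurable_EFinP.
by move=> t pt /=; rewrite lee_fin (le_trans (le12 _ pt))// ler_norm.
Qed.

Lemma per_integrable_measurable q : per_integrable q -> per_measurable q.
Proof. by move=> /measurable_int /measurable_EFinP. Qed.

Lemma per_integralD q1 q2 : per_integrable q1 -> per_integrable q2 -> per_integral (fun t => q1 t + q2 t) = per_integral q1 + per_integral q2.
Proof. exact: RintegralD measurable_per. Qed.

Lemma per_integralZ (c : R) q : per_integrable q -> per_integral (fun t => c * q t) = c * per_integral q.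
Proof. exact: RintegralZl measurable_per. Qed.

Lemma per_integralN q : per_integrable q -> per_integral (fun t => - q t) = - per_integral q.
Proof.
move=> h1; rewrite -mulN1r -per_integralZ//; congr per_integral; apply/funext => t.
by rewrite mulN1r.
Qed.

Lemma per_integral_le q1 q2 : per_integrable q1 -> per_integrable q2 -> (forall t, per t -> q1 t <= q2 t) -> per_integral q1 <= per_integral q2.
Proof. exact: le_Rintegral measurable_per. Qed.

Lemma per_integral_eq q1 q2 : (forall t, per t -> q1 t = q2 t) -> per_integral q1 = per_integral q2.
Proof. by move=> h1; apply: eq_Rintegral => t; rewrite inE => /h1. Qed.

Lemma per_integral_ge0 q : (forall t, per t -> 0 <= q t) -> 0 <= per_integral q.
Proof. by move=> h1; apply: Rintegral_ge0. Qed.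

Lemma continuous_mfun q : continuous q -> per_measurable q.
Proof.
move=> cq; apply: (@measurable_funTS _ _ (measurableTypeR R)).
exact: continuous_measurable_fun.
Qed.

(** Integrating componentwise against a real weight keeps everything within the real Lebesgue
    integral. *)
Definition wint q k : R[i] :=
  per_integral (fun t => q t * complex.Re (k t)) +i* per_integral (fun t => q t * complex.Im (k t)).

Definition cbounded k := continuous k /\ exists M : R, forall t, normc (k t) <= M.

Lemma continuous_Re k : continuous k -> continuous (fun t => complex.Re (k t)).
Proof.
move=> ck t; apply/cvgrPdist_lt => e e0; have /cvgC/(_ e e0) := ck t.
apply: filterS => s; rewrite normcBC; apply: le_lt_trans.
have := abs_Re_le (k t - k s).
by case: (k t) (k s) => [x y] [u v].
Qed.

Lemma continuous_Im k : continuous k -> continuous (fun t => complex.Im (k t)).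
Proof.
move=> ck t; apply/cvgrPdist_lt => e e0; have /cvgC/(_ e e0) := ck t.
apply: filterS => s; rewrite normcBC; apply: le_lt_trans.
have := abs_Im_le (k t - k s).
by case: (k t) (k s) => [x y] [u v].
Qed.

Lemma per_integrable_wRe q k : per_integrable q -> cbounded k -> per_integrable (fun t => q t * complex.Re (k t)).
Proof.
move=> iq [/continuous_Re/continuous_mfun mk [M kM]]; apply: per_integrableM iq mk _ => t.
exact: le_trans (abs_Re_le _) (kM t).
Qed.

Lemma per_integrable_wIm q k : per_integrable q -> cbounded k -> per_integrable (fun t => q t * complex.Im (k t)).
Proof.
move=> iq [/continuous_Im/continuous_mfun mk [M kM]]; apply: per_integrableM iq mk _ => t.
exact: le_trans (abs_Im_le _) (kM t).
Qed.

Lemma cbounded_cst a : cbounded (fun=> a).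
Proof. by split; [move=> t; exact: cvg_cst|exists (normc a)]. Qed.

Lemma cboundedD k1 k2 : cbounded k1 -> cbounded k2 -> cbounded (fun t => k1 t + k2 t).
Proof.
move=> [c1 [M1 h1]] [c2 [M2 h2]]; split.
  by move=> t; apply: cvgcD; [exact: c1|exact: c2].
by exists (M1 + M2) => t; rewrite (le_trans (le_normcD _ _))// lerD.
Qed.

Lemma cboundedM k1 k2 : cbounded k1 -> cbounded k2 -> cbounded (fun t => k1 t * k2 t).
Proof.
move=> [c1 [M1 h1]] [c2 [M2 h2]]; split.
  by move=> t; apply: cvgcM; [exact: c1|exact: c2].
by exists (M1 * M2) => t; rewrite normcM ler_pM ?normc_ge0.
Qed.

Lemma cboundedX k n : cbounded k -> cbounded (fun t => k t ^+ n).
Proof.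
move=> hk; elim: n => [|n IH]; first exact: (cbounded_cst 1).
by under eq_fun do rewrite exprS; exact: cboundedM.
Qed.

Lemma wintD q k1 k2 : per_integrable q -> cbounded k1 -> cbounded k2 ->
  wint q (fun t => k1 t + k2 t) = wint q k1 + wint q k2.
Proof.
move=> iq h1 h2; apply/eqP; rewrite eq_complex /=; apply/andP; split; apply/eqP.
  rewrite -per_integralD; [|exact: per_integrable_wRe|exact: per_integrable_wRe].
  by apply: per_integral_eq => t _; case: (k1 t) (k2 t) => [x y] [u v] /=; ring.
rewrite -per_integralD; [|exact: per_integrable_wIm|exact: per_integrable_wIm].
by apply: per_integral_eq => t _; case: (k1 t) (k2 t) => [x y] [u v] /=; ring.
Qed.

Lemma wintZ q a k : per_integrable q -> cbounded k ->
  wint q (fun t => a * k t) = a * wint q k.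
Proof.
move=> iq h1; case: a => [u v]; rewrite /wint /=.
apply/eqP; rewrite eq_complex /=; apply/andP; split; apply/eqP.
  rewrite -mulNr -!per_integralZ; [|exact: per_integrable_wIm|exact: per_integrable_wRe].
  rewrite -per_integralD; [|exact/per_integrableZ/per_integrable_wRe|exact/per_integrableZ/per_integrable_wIm].
  by apply: per_integral_eq => t _; case: (k t) => [x y] /=; ring.
rewrite -!per_integralZ; [|exact: per_integrable_wRe|exact: per_integrable_wIm].
rewrite -per_integralD; [|exact/per_integrableZ/per_integrable_wIm|exact/per_integrableZ/per_integrable_wRe].
by apply: per_integral_eq => t _; case: (k t) => [x y] /=; ring.
Qed.

Lemma per_integral_abs_le q (p : R -> R) (M : R) : per_integrable q -> per_integrable (fun t => q t * p t) ->
  (forall t, `|p t| <= M) -> `|per_integral (fun t => q t * p t)| <= M * per_integral (fun t => `|q t|).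
Proof.
move=> iq iqp pM; have iA := per_integrableZ M (per_integrable_abs iq).
have B t : `|q t * p t| <= M * `|q t|.
  by rewrite normrM mulrC ler_wpM2r.
rewrite ler_norml -per_integralZ; last exact: per_integrable_abs.
rewrite -per_integralN//; apply/andP; split; apply: per_integral_le => //.
- exact: per_integrableN.
- by move=> t _; have := B t; rewrite ler_norml => /andP[].
- by move=> t _; have := B t; rewrite ler_norml => /andP[].
Qed.

(** The factor [2] comes from bounding real and imaginary parts separately. *)
Lemma normc_wint_le q k (M : R) : per_integrable q -> cbounded k -> (forall t, normc (k t) <= M) ->
  normc (wint q k) <= 2 * M * per_integral (fun t => `|q t|).
Proof.
move=> iq hk kM; rewrite (le_trans (normc_le_ReIm _))//= -mulrA mulr2n.
rewrite mulrDl mul1r lerD//; apply: per_integral_abs_le => //.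
- exact: per_integrable_wRe.
- by move=> t; exact: le_trans (abs_Re_le _) (kM t).
- exact: per_integrable_wIm.
- by move=> t; exact: le_trans (abs_Im_le _) (kM t).
Qed.

Lemma continuous_expi : continuous (@expi R).
Proof.
move=> t; apply/cvgC => e e0; have e2 : 0 < e / 2 by rewrite divr_gt0.
have /cvgrPdist_lt/(_ _ e2) hc := @continuous_cos R t.
have /cvgrPdist_lt/(_ _ e2) hs := @continuous_sin R t.
near=> s; rewrite (le_lt_trans (normc_le_ReIm _))//= (splitr e) ltrD//.
  by rewrite distrC; near: s; exact: hc.
by rewrite distrC; near: s; exact: hs.
Unshelve. all: by end_near. Qed.

Lemma expi_sub_ge z t : 1 - normc z <= normc (expi t - z).
Proof. by rewrite -(normc_expi t) ler_normcB. Qed.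

Lemma expi_sub_neq0 z t : disk z -> expi t - z != 0.
Proof.
move=> Dz; rewrite -normc_gt0 (lt_le_trans _ (expi_sub_ge z t))//.
by rewrite subr_gt0.
Qed.

Lemma cauchy_kernel_le z t : disk z -> normc (expi t - z)^-1 <= (1 - normc z)^-1.
Proof.
move=> Dz; rewrite normcV lef_pV2 ?expi_sub_ge// posrE ?normc_gt0 ?expi_sub_neq0//.
by rewrite subr_gt0.
Qed.

Lemma cbounded_expi : cbounded (@expi R).
Proof.
by split; [exact: continuous_expi|exists 1 => t; rewrite normc_expi].
Qed.

Lemma cbounded_cauchy z : disk z -> cbounded (fun t => (expi t - z)^-1).
Proof.
move=> Dz; split; last by exists (1 - normc z)^-1 => t; exact: cauchy_kernel_le.
move=> t; have h1 : (fun s => expi s - z) @ t --> expi t - z.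
  by apply: cvgcD; [exact: continuous_expi|exact: cvg_cst].
apply: (cvg_comp _ _ h1); apply: cder_cvg; apply: cderV.
exact: expi_sub_neq0.
Qed.

(* The second order remainder of [z |-> (c - z)^-n], with [x = (c - z)^-1],
   [y = (c - w)^-1] and [d = w - z]. *)
Lemma cauchy_remainder (m : R) n : 0 <= m -> exists2 C : R, 0 <= C &
  forall x y d : R[i], normc x <= m -> normc y <= m -> y - x = d * x * y ->
    normc (y ^+ n - x ^+ n - n%:R * d * x ^+ n.+1) <= C * normc d ^+ 2.
Proof.
move=> m0; elim: n => [|n [C C0 H]].
  exists 0 => // x y d _ _ _.
  by rewrite !expr0 subrr mul0r mul0r subr0 normc0 mul0r.
exists (m * C + n.+1%:R * m ^+ n.+3).
  by rewrite addr_ge0// mulr_ge0// ?exprn_ge0.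
move=> x y d hx hy E.
have hxy : y = x + d * x * y by rewrite -E addrC subrK.
have -> : y ^+ n.+1 - x ^+ n.+1 - n.+1%:R * d * x ^+ n.+2 =
    y * (y ^+ n - x ^+ n - n%:R * d * x ^+ n.+1) +
    n.+1%:R * (x ^+ n.+2 * y) * d ^+ 2.
  have e1 : y - x - d * x ^+ 2 = d ^+ 2 * x ^+ 2 * y.
    rewrite E (_ : d * x * y - d * x ^+ 2 = d * x * (y - x)); last by ring.
    by rewrite E; ring.
  have -> : y ^+ n.+1 - x ^+ n.+1 - n.+1%:R * d * x ^+ n.+2 =
    y * (y ^+ n - x ^+ n - n%:R * d * x ^+ n.+1) + x ^+ n * (y - x - d * x ^+ 2)
    + n%:R * d * x ^+ n.+1 * (y - x).
    by rewrite -natr1 !exprS; ring.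
  by rewrite e1 E -natr1 !exprS; ring.
rewrite (le_trans (le_normcD _ _))// mulrDl; apply: lerD.
  rewrite normcM -[leRHS]mulrA; apply: ler_pM; rewrite ?normc_ge0//.
  exact: H hx hy E.
rewrite normcM [normc (d ^+ 2)]normcX ler_wpM2r ?sqr_ge0//.
rewrite normcM (_ : normc n.+1%:R = n.+1%:R); last first.
  by rewrite -(rmorph_nat (real_complex R)) normc_real ger0_norm.
have hX : normc (x ^+ n.+2) <= m ^+ n.+2.
  by rewrite normcX lerXn2r ?nnegrE ?normc_ge0.
by rewrite ler_wpM2l// normcM [m ^+ n.+3]exprSr ler_pM ?normc_ge0.
Qed.

(** On the circle [zeta dt = d zeta / i], so these are Cauchy integrals up to a constant factor. The
    numerator [expi t] keeps the family closed under differentiation. *)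
Definition cauchy_int q n z := wint q (fun t => expi t * (expi t - z)^-1 ^+ n).

Lemma cbounded_cauchyX z n : disk z -> cbounded (fun t => expi t * (expi t - z)^-1 ^+ n).
Proof.
move=> Dz; apply: cboundedM; first exact: cbounded_expi.
exact/cboundedX/cbounded_cauchy.
Qed.

(** Differentiation under the integral sign: the second-order remainder of the kernel is bounded
    uniformly in [t] once [w] stays within [r = (1 - |z|) / 2] of [z], where both kernels are at
    most [1 / r]. *)
Lemma cder_cauchy_int q n z : per_integrable q -> disk z ->
  cder (cauchy_int q n) z (n%:R * cauchy_int q n.+1 z).
Proof.
move=> iq Dz e e0; set r := (1 - normc z) / 2.
have z1 : 0 < 1 - normc z by rewrite subr_gt0.
have r0 : 0 < r by rewrite divr_gt0.
have rV0 : 0 <= r^-1 by rewrite invr_ge0 ltW.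
have [C C0 HC] := cauchy_remainder n rV0.
set A := per_integral (fun t => `|q t|).
have A0 : 0 <= A by apply: per_integral_ge0.
set M := 2 * C * A + 1.
have M0 : 0 < M by rewrite /M ltr_wpDl// !mulr_ge0.
exists (Num.min r (e / M)) => [|w]; first by rewrite lt_min r0 divr_gt0.
rewrite lt_min => /andP[wr we].
have Dw : disk w.
  rewrite /disk /= -(subrK z w) (le_lt_trans (le_normcD _ _))//.
  by move: wr; rewrite /r; lra.
have E : cauchy_int q n w - cauchy_int q n z - n%:R * cauchy_int q n.+1 z * (w - z) =
  wint q (fun t => expi t * ((expi t - w)^-1 ^+ n - (expi t - z)^-1 ^+ n -
     n%:R * (w - z) * (expi t - z)^-1 ^+ n.+1)).
  have hb a u m : disk u -> cbounded (fun t => a * (expi t * (expi t - u)^-1 ^+ m)).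
    by move=> Du; apply: cboundedM; [exact: cbounded_cst|exact: cbounded_cauchyX].
  have h2 := hb (-1) z n Dz; have h3 := hb (- n%:R * (w - z)) z n.+1 Dz.
  have hD := cboundedD (cbounded_cauchyX n Dw) h2.
  transitivity (wint q (fun t => (expi t * (expi t - w)^-1 ^+ n +
      -1 * (expi t * (expi t - z)^-1 ^+ n)) +
      - n%:R * (w - z) * (expi t * (expi t - z)^-1 ^+ n.+1))).
    rewrite (wintD iq hD h3) (wintD iq (cbounded_cauchyX n Dw) h2).
    rewrite (wintZ _ iq (cbounded_cauchyX n Dz)) (wintZ _ iq (cbounded_cauchyX n.+1 Dz)).
    rewrite /cauchy_int; move: (wint q _) (wint q _) (wint q _) => A1 A2 A3.
    move: (w - z) (n%:R : R[i]) => u v; ring.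
  congr wint; apply/funext => t.
  move: (expi t) (expi t - z)^-1 (expi t - w)^-1 (w - z) (n%:R : R[i]) => c x y u v.
  by ring.
rewrite E.
have B t : normc (expi t * ((expi t - w)^-1 ^+ n - (expi t - z)^-1 ^+ n -
     n%:R * (w - z) * (expi t - z)^-1 ^+ n.+1)) <= C * normc (w - z) ^+ 2.
  rewrite normcM normc_expi mul1r; apply: HC.
  - rewrite (le_trans (cauchy_kernel_le t Dz))// lef_pV2 ?posrE// /r; lra.
  - rewrite (le_trans (cauchy_kernel_le t Dw))// lef_pV2 ?posrE ?subr_gt0//.
    have := le_normcD (w - z) z; rewrite subrK; move: wr; rewrite /r; lra.
  - by field; rewrite !expi_sub_neq0.
apply: (le_trans (normc_wint_le iq _ B)).
  apply: cboundedM; first exact: cbounded_expi.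
  apply: cboundedD; first apply: cboundedD.
  - exact/cboundedX/cbounded_cauchy.
  - under eq_fun do rewrite -mulN1r.
    by apply: cboundedM; [exact: cbounded_cst|exact/cboundedX/cbounded_cauchy].
  - under eq_fun do rewrite -mulNr.
    by apply: cboundedM; [exact: cbounded_cst|exact/cboundedX/cbounded_cauchy].
rewrite -/A; move: we; rewrite ltr_pdivlMr// => we.
have n0 := normc_ge0 (w - z).
rewrite expr2; apply: (@le_trans _ _ (normc (w - z) * M * normc (w - z))).
  have := mulr_ge0 n0 n0; rewrite /M; lra.
by rewrite ler_wpM2r// ltW.
Qed.

Lemma smooth_cauchy_int q m n : per_integrable q -> smooth m (@disk R) (cauchy_int q n).
Proof.
move=> iq; elim: m n => [//|m IH] n.
exists (fun z => n%:R * cauchy_int q n.+1 z); split.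
  by move=> z; apply: cder_cauchy_int.
by apply: smoothM => //; apply: smooth_cst.
Qed.

Definition herglotz h z : R[i] := ((pi *+ 2)^-1)%:C *
  wint (h \o @expi R) (fun t => (expi t + z) / (expi t - z)).

(** The kernel splits as [(zeta + z) / (zeta - z) = 2 zeta / (zeta - z) - 1], a Cauchy integral of
    order one and a constant. *)
Lemma smooth_herglotz h n : circle_integrable h -> smooth n (@disk R) (herglotz h).
Proof.
move=> ih; have iq : per_integrable (h \o @expi R) by [].
apply: (@smooth_eq _ _ _ (fun z => ((pi *+ 2)^-1)%:C *
   (2 * cauchy_int (h \o @expi R) 1 z + - wint (h \o @expi R) (fun=> 1)))).
- exact: open_disk.
- move=> z Dz; rewrite /herglotz; congr (_ * _).
  rewrite -mulN1r /cauchy_int -!wintZ//; try by [exact: cbounded_cauchyX|exact: cbounded_cst].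
  rewrite -wintD//.
  + congr wint; apply/funext => t; field.
    exact: expi_sub_neq0.
  + by apply: cboundedM; [exact: cbounded_cst|exact: cbounded_cauchyX].
  + by apply: cboundedM; exact: cbounded_cst.
- apply: smoothM; first exact: smooth_cst.
  apply: smoothD; last exact: smooth_cst.
  by apply: smoothM; [exact: smooth_cst|exact: smooth_cauchy_int].
Qed.

(** The real part of [(zeta + z) / (zeta - z)] is [(|zeta|^2 - |z|^2) / |zeta - z|^2], and
    [|zeta| = 1]. *)
Lemma Re_herglotz h z : disk z -> complex.Re (herglotz h z) = poisson_integral h z.
Proof.
move=> Dz; rewrite /herglotz /wint.
set A := per_integral _; set B := per_integral _.
rewrite /= mul0r subr0 /poisson_integral /circle_integral; congr (_ * _).
apply: per_integral_eq => t _ /=; rewrite mulrC; congr (_ * _).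
have := expi_sub_neq0 t Dz; rewrite -normc_gt0 => h0.
rewrite /poisson_kernel; move: h0; have := normc_expi t.
set e := expi t => e1 h0.
have e2 : normc e ^+ 2 = 1 by rewrite e1 expr1n.
have h2 : 0 < normc (e - z) ^+ 2 by rewrite exprn_gt0.
move: h2 e2; rewrite !sqr_normc_ReIm; case: (e) z {Dz A B h0 e1} => [x y] [u v] /=.
set D := (x - u) ^+ 2 + (y - v) ^+ 2 => h2 e2.
have D0 : D != 0 by rewrite gt_eqF.
by rewrite -{1}e2; field.
Qed.

Lemma poisson_kernel_ge0 z zeta : disk z -> 0 <= poisson_kernel z zeta.
Proof.
move=> Dz; rewrite divr_ge0 ?sqr_ge0// subr_ge0 -[leRHS](expr1n _ 2) lerXn2r ?nnegrE ?normc_ge0//.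
exact: ltW.
Qed.

Lemma poisson_kernel_gt0 z t : disk z -> 0 < poisson_kernel z (expi t).
Proof.
move=> Dz; rewrite divr_gt0//.
  rewrite subr_gt0 -[ltRHS](expr1n _ 2) ltrXn2r ?nnegrE ?normc_ge0//.
by rewrite exprn_gt0// normc_gt0 expi_sub_neq0.
Qed.

Lemma poisson_kernel_le z t : disk z ->
  poisson_kernel z (expi t) <= ((1 - normc z) ^+ 2)^-1.
Proof.
move=> Dz; have z1 : 0 < 1 - normc z by rewrite subr_gt0.
rewrite /poisson_kernel -[leRHS]mul1r; apply: ler_pM.
- rewrite subr_ge0 -[leRHS](expr1n _ 2) lerXn2r ?nnegrE ?normc_ge0//; exact: ltW.
- by rewrite invr_ge0 sqr_ge0.
- by rewrite gerBl sqr_ge0.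
- rewrite lef_pV2 ?posrE ?exprn_gt0 ?normc_gt0 ?expi_sub_neq0//.
  by rewrite lerXn2r ?nnegrE ?normc_ge0 ?(ltW z1)// expi_sub_ge.
Qed.

Lemma continuous_poisson_kernel z : disk z -> continuous (fun t => poisson_kernel z (expi t)).
Proof.
move=> Dz t; rewrite /poisson_kernel; apply: cvgM; first exact: cvg_cst.
apply: cvgV; first by rewrite gt_eqF// exprn_gt0// normc_gt0 expi_sub_neq0.
have hN : (fun s => normc (expi s - z)) @ t --> normc (expi t - z).
  by apply: normc_cvg; apply: cvgcD; [exact: continuous_expi|exact: cvg_cst].
exact: (cvgM hN hN).
Qed.

Lemma per_integrable_poisson h z : circle_integrable h -> disk z ->
  per_integrable (fun t => poisson_kernel z (expi t) * h (expi t)).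
Proof.
move=> ih Dz; rewrite /per_integrable; under eq_fun do rewrite mulrC.
apply: (@per_integrableM (h \o @expi R) _ ((1 - normc z) ^+ 2)^-1) => //.
  by apply: continuous_mfun; exact: continuous_poisson_kernel.
by move=> t; rewrite ger0_norm ?poisson_kernel_ge0 ?poisson_kernel_le.
Qed.

End PoissonIntegrals.

(** * Boundary behaviour of Poisson integrals and comparison with them *)

Section PoissonPrinciple.
Variable R : realType.
Implicit Types (z w a b : R[i]) (g : R[i] -> R[i]) (s t : R) (h k : R[i] -> R).
Local Notation per := (@period R).

(* [P_z = 1 + 2 A'] with [A t = arg (1 - z exp(-it))]. *)
Lemma per_integral_poisson_kernel z : disk z -> per_integral (fun t => poisson_kernel z (expi t)) = pi *+ 2.
Proof.
move=> Dz; set f := fun t => _.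
have zE := sqr_normc_ReIm z.
have [x [y E]] : exists x y, z = x +i* y by case: (z) => x y; exists x, y.
pose N t := x * sin t - y * cos t.
pose D t := 1 - (x * cos t + y * sin t).
have D0 t : 0 < D t.
  rewrite /D subr_gt0 (le_lt_trans _ Dz)// E.
  have -> : x * cos t + y * sin t = complex.Re ((x +i* y) * conjc (expi t)) by rewrite /=; ring.
  by rewrite (le_trans (Re_le_normc _))// normcM normcJ normc_expi mulr1.
have ND t : D t ^+ 2 + N t ^+ 2 = normc (expi t - z) ^+ 2.
  rewrite sqr_normc_ReIm E /=.
  have := cos2Dsin2 t; rewrite /D /N => h.
  transitivity (1 - 2 * (x * cos t + y * sin t) + (x ^+ 2 + y ^+ 2) * (cos t ^+ 2 + sin t ^+ 2)).
    by ring.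
  by rewrite h -{1}h; ring.
pose F t := t + 2 * atan (N t / D t).
have dF t : is_derive t 1 F (f t).
  have dN : is_derive t 1 N (x * cos t + y * sin t).
    apply: is_derive_eq (is_deriveB (is_deriveZ x (is_derive_sin t)) (is_deriveZ y (is_derive_cos t))) _.
    by rewrite -[x *: _]/(x * _) -[y *: _]/(y * _); ring.
  have dD : is_derive t 1 D (N t).
    apply: is_derive_eq (is_deriveB (is_derive_cst (1 : R) t 1)
       (is_deriveD (is_deriveZ x (is_derive_cos t)) (is_deriveZ y (is_derive_sin t)))) _.
    by rewrite -[x *: _]/(x * _) -[y *: _]/(y * _) /N; ring.
  have Dn : D t != 0 by rewrite gt_eqF.
  have dQ := is_deriveM dN (is_deriveV Dn dD).
  have dA := @is_derive1_comp R atan (fun t => N t / D t) t _ _ (is_derive1_atan _) dQ.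
  apply: is_derive_eq (is_deriveD (is_derive_id t (1 : R)) (is_deriveZ (2 : R) dA)) _.
  rewrite -[2 *: _]/(2 * _) -[N t *: _]/(N t * (- (D t) ^- 2 * N t)).
  rewrite -[_ *: (x * _ + _)]/((D t)^-1 * (x * cos t + y * sin t)).
  have -> : x * cos t + y * sin t = 1 - D t by rewrite /D; ring.
  have S0 : D t ^+ 2 + N t ^+ 2 != 0.
    by rewrite gt_eqF// ltr_wpDr ?sqr_ge0// exprn_gt0.
  rewrite /f /poisson_kernel -ND.
  have -> : normc z ^+ 2 = (1 - D t) ^+ 2 + N t ^+ 2.
    rewrite zE E /=; transitivity ((x ^+ 2 + y ^+ 2) * (cos t ^+ 2 + sin t ^+ 2)).
      by rewrite cos2Dsin2 mulr1.
    by rewrite /D /N; ring.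
  by field; rewrite S0 Dn.
have cF : continuous F.
  move=> t; apply: differentiable_continuous; apply/derivable1_diffP.
  by have [] := dF t.
have cf : continuous f by exact: continuous_poisson_kernel.
rewrite /per_integral /Rintegral (@continuous_FTC2 R f F 0 (pi *+ 2) (pi2_gt0 R)).
- rewrite /= /F /N /D cos2pi sin2pi cos0 sin0; ring.
- exact: continuous_subspaceT.
- split.
  + by move=> t _; have [] := dF t.
  + by apply: cvg_at_right_filter; exact: cF.
  + by apply: cvg_at_left_filter; exact: cF.
- by move=> t _; rewrite derive1E; have [] := dF t.
Qed.

Lemma poisson_cst (c : R) z : disk z -> poisson_integral (fun=> c) z = c.
Proof.
move=> Dz; rewrite /poisson_integral /circle_integral.
rewrite -[Rintegral _ _ _]/(per_integral (fun t => poisson_kernel z (expi t) * c)).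
have -> : (fun t => poisson_kernel z (expi t) * c) = (fun t => c * poisson_kernel z (expi t)).
  by apply/funext => t; rewrite mulrC.
rewrite per_integralZ; first by rewrite per_integral_poisson_kernel// mulrC mulfK// gt_eqF// pi2_gt0.
have := @per_integrable_poisson R (fun=> 1) z (per_integrable_cst 1) Dz.
by rewrite /per_integrable; under eq_fun do rewrite /= mulr1.
Qed.

Lemma circle_integrableD h k : circle_integrable h -> circle_integrable k ->
  circle_integrable (fun x => h x + k x).
Proof. exact: per_integrableD. Qed.

Lemma circle_integrableN h : circle_integrable h -> circle_integrable (fun x => - h x).
Proof. exact: per_integrableN. Qed.

Lemma poissonD h k z : circle_integrable h -> circle_integrable k -> disk z ->
  poisson_integral (fun x => h x + k x) z = poisson_integral h z + poisson_integral k z.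
Proof.
move=> ih ik Dz; rewrite /poisson_integral /circle_integral -mulrDr; congr (_ * _).
rewrite -[RHS](per_integralD (per_integrable_poisson ih Dz) (per_integrable_poisson ik Dz)).
by apply: per_integral_eq => t _; rewrite mulrDr.
Qed.

Lemma poissonN h z : circle_integrable h -> disk z ->
  poisson_integral (fun x => - h x) z = - poisson_integral h z.
Proof.
move=> ih Dz; rewrite /poisson_integral /circle_integral -mulrN; congr (_ * _).
rewrite -[RHS](per_integralN (per_integrable_poisson ih Dz)).
by apply: per_integral_eq => t _; rewrite mulrN.
Qed.

Lemma poisson_le h k z : circle_integrable h -> circle_integrable k -> disk z ->
  (forall t, per t -> h (expi t) <= k (expi t)) ->
  poisson_integral h z <= poisson_integral k z.
Proof.
move=> ih ik Dz hk; rewrite /poisson_integral /circle_integral.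
rewrite ler_pM2l ?invr_gt0 ?pi2_gt0//.
apply: (per_integral_le (per_integrable_poisson ih Dz) (per_integrable_poisson ik Dz)) => t pt.
by rewrite ler_wpM2l ?poisson_kernel_ge0 ?hk.
Qed.

Lemma poisson_ge0 h z : disk z -> (forall t, per t -> 0 <= h (expi t)) ->
  0 <= poisson_integral h z.
Proof.
move=> Dz h0; rewrite /poisson_integral /circle_integral mulr_ge0//.
  by rewrite invr_ge0 ltW// pi2_gt0.
by apply: per_integral_ge0 => t pt; rewrite mulr_ge0 ?poisson_kernel_ge0 ?h0.
Qed.

Lemma poisson0 h : poisson_integral h 0 = circle_integral h.
Proof.
rewrite /poisson_integral /circle_integral; congr (_ * _); apply: per_integral_eq => t _.
by rewrite /poisson_kernel subr0 normc_expi normc0 expr0n expr1n subr0 divr1 mul1r.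
Qed.

(** One half of the approximate identity property. Subtracting [c] leaves a density that is
    nonnegative near [zeta]; away from [zeta] the kernel is uniformly small and [|h - c|] is
    integrable. *)
Lemma poisson_liminf h zeta (c eta : R) : circle_integrable h -> circle zeta -> 0 < eta ->
  (forall t, per t -> normc (expi t - zeta) < eta -> c <= h (expi t)) ->
  forall e : R, 0 < e -> exists2 r : R, 0 < r &
    forall z, disk z -> normc (z - zeta) < r -> c - e <= poisson_integral h z.
Proof.
move=> ih z1 eta0 H e e0.
have ihc : circle_integrable (fun x => h x - c).
  by apply: circle_integrableD => //; apply: (per_integrable_cst (- c)).
pose A := circle_integral (fun x => `|h x - c|).
have A0 : 0 <= A.
  by rewrite mulr_ge0// ?invr_ge0 ?(ltW (pi2_gt0 R))//; apply: per_integral_ge0.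
have A1 : 0 < A + 1 by rewrite ltr_wpDl.
exists (Num.min (eta / 2) (e * eta ^+ 2 / (8 * (A + 1)))).
  by rewrite lt_min divr_gt0//= divr_gt0 ?mulr_gt0// exprn_gt0.
move=> z Dz; rewrite lt_min => /andP[r1 r2].
set d := normc (z - zeta) in r1 r2.
have d0 : 0 <= d by exact: normc_ge0.
have hE : poisson_integral h z = c + poisson_integral (fun x => h x - c) z.
  rewrite poissonD//; last exact: (per_integrable_cst (- c)).
  by rewrite poisson_cst// addrCA subrr addr0.
rewrite hE lerD2l.
(* Bounds the kernel at points at least [eta] away from [zeta]: its numerator is at most [2 d] and,
   as [d < eta / 2], its denominator is at least [(eta / 2)^2]. *)
pose K := 8 * d / eta ^+ 2.
have K0 : 0 <= K by rewrite /K divr_ge0 ?sqr_ge0// mulr_ge0.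
have KA : K * A <= e.
  have : d * (8 * (A + 1)) <= e * eta ^+ 2 by rewrite -ler_pdivlMr ?mulr_gt0// ltW.
  rewrite /K mulrAC ler_pdivrMr ?exprn_gt0//; nra.
apply: (@le_trans _ _ (- (K * A))); first by rewrite lerN2.
have iA : per_integrable (fun t => `|h (expi t) - c|) by apply: per_integrable_abs.
rewrite /poisson_integral /A /circle_integral mulrCA -mulrN.
rewrite ler_pM2l ?invr_gt0 ?pi2_gt0// -mulNr.
rewrite -[X in X <= _](per_integralZ (- K) iA).
apply: (per_integral_le (per_integrableZ (- K) iA) (per_integrable_poisson ihc Dz)) => t pt.
have P0 := poisson_kernel_ge0 (expi t) Dz.
have [near|far] := ltP (normc (expi t - zeta)) eta.
  apply: (@le_trans _ _ 0); first by rewrite mulNr oppr_le0 mulr_ge0.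
  by rewrite mulr_ge0// subr_ge0 H.
apply: (@le_trans _ _ (- (poisson_kernel z (expi t) * `|h (expi t) - c|))); last first.
  by rewrite -mulrN ler_wpM2l// lerNl -normrN ler_norm.
rewrite mulNr lerN2 ler_wpM2r//.
have g1 : eta / 2 <= normc (expi t - z).
  have := ler_distc (expi t) z zeta; rewrite -/d; move: r1; lra.
have g2 : 1 - normc z <= d.
  by have := ler_normcB zeta z; rewrite normcBC -/d z1.
have g3 : 1 - normc z ^+ 2 <= 2 * d.
  rewrite -[X in X - _](expr1n _ 2) subr_sqr.
  have := normc_ge0 z; have : normc z < 1 by []. nra.
have g4 : (eta / 2) ^+ 2 <= normc (expi t - z) ^+ 2.
  by rewrite lerXn2r// nnegrE ?normc_ge0// divr_ge0// ltW.
rewrite /poisson_kernel /K ler_pdivrMr; last by rewrite exprn_gt0// (lt_le_trans _ g1)// divr_gt0.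
apply: (le_trans g3).
have -> : 2 * d = (8 * d / eta ^+ 2) * (eta / 2) ^+ 2.
  by field; rewrite gt_eqF.
by rewrite ler_wpM2l.
Qed.

Lemma poisson_limsup h zeta (c eta : R) : circle_integrable h -> circle zeta -> 0 < eta ->
  (forall t, per t -> normc (expi t - zeta) < eta -> h (expi t) <= c) ->
  forall e : R, 0 < e -> exists2 r : R, 0 < r &
    forall z, disk z -> normc (z - zeta) < r -> poisson_integral h z <= c + e.
Proof.
move=> ih z1 eta0 H e e0.
have [|r r0 Hr] := @poisson_liminf _ _ (- c) _ (circle_integrableN ih) z1 eta0 _ e e0.
  by move=> t pt /(H t pt); rewrite lerN2.
exists r => // z Dz zr; have := Hr z Dz zr; rewrite poissonN//; lra.
Qed.

(** Division by [exp H[h]], whose modulus is [exp P[h]], reduces the comparison to the maximum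
    principle with bound [1]. *)
Lemma poisson_majorant g h : smooth 2 (@disk R) g -> circle_integrable h ->
  (forall zeta, circle zeta -> forall e : R, 0 < e -> exists2 r : R, 0 < r &
     forall z, disk z -> normc (z - zeta) < r ->
       normc (g z) <= expR (poisson_integral h z + e)) ->
  forall z, disk z -> normc (g z) <= expR (poisson_integral h z).
Proof.
move=> sg ih H.
pose G z := g z * cexp (-1 * herglotz h z).
have GE z : disk z -> normc (G z) = normc (g z) * expR (- poisson_integral h z).
  move=> Dz; rewrite /G normcM normc_cexp -Re_herglotz//.
  by congr (_ * expR _); case: (herglotz h z) => x y /=; ring.
have Hm : forall z, disk z -> normc (G z) <= 1.
  apply: max_modulus.
    apply: smoothM => //; apply: smooth_cexp; apply: smoothM; first exact: smooth_cst.
    exact: smooth_herglotz.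
  move=> zeta hz e e0.
  have [r r0 Hr] := H zeta hz e e0; exists r => // z Dz zr.
  rewrite GE// expRN ler_pdivrMr ?expR_gt0// -expRD addrC; exact: Hr.
move=> z Dz; have := Hm z Dz.
by rewrite GE// expRN ler_pdivrMr ?expR_gt0// mul1r.
Qed.

End PoissonPrinciple.

(** * Measurability and limit theorems on the period *)

Section PeriodConvergence.
Variable R : realType.
Implicit Types (s t : R) (q : R -> R).
Local Notation mu := (@lebesgue_measure R).
Local Notation per := (@period R).

(** Both endpoints of the period are parameters of the point [1], where the boundary functions to
    come may be discontinuous. *)
Lemma per_measurable_open q : (forall t, 0 < t < pi *+ 2 -> {for t, continuous q}) -> per_measurable q.
Proof.
move=> cq; apply: (@measurable_fun_itv_cc R 0 (pi *+ 2) false true).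
apply: open_continuous_measurable_fun; first exact: interval_open.
by move=> t; rewrite inE /= in_itv /=; exact: cq.
Qed.

Lemma expi_neq1 t : 0 < t < pi *+ 2 -> expi t != 1.
Proof.
move=> /andP[t0 t2]; have s0 : 0 < sin (t / 2).
  by apply: sin_gt0_pi; rewrite divr_gt0//= ltr_pdivrMr// mulr_natr.
apply/eqP => -[ct _]; move: s0.
have := cosD (t / 2) (t / 2); rewrite -splitr ct.
have := cos2Dsin2 (t / 2); rewrite -!expr2 => h1 h2.
have /eqP : sin (t / 2) ^+ 2 = 0 by lra.
by rewrite sqrf_eq0 => /eqP ->; rewrite ltxx.
Qed.

Lemma ae_expi_neq1 : {ae mu, forall t, per t -> expi t != 1}.
Proof.
apply: (@negligibleS _ _ _ mu ([set 0] `|` [set pi *+ 2])).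
  move=> t /= /not_implyP[]; rewrite /period /= in_itv /= => /andP[t0 t2] h.
  have [->|tn0] := eqVneq t 0; first by left.
  have [->|tn2] := eqVneq t (pi *+ 2); first by right.
  by exfalso; apply: h; apply: expi_neq1; rewrite !lt_neqAle eq_sym tn0 t0 tn2.
have N1 (a : R) : mu.-negligible [set a].
  have m1 : measurable ([set a] : set (measurableTypeR R)) by exact: measurable_set1.
  by apply: (negligibleP mu m1).2; exact: lebesgue_measure_set1.
by apply: negligibleU.
Qed.

Lemma aeS (P Q : R -> Prop) : (forall t, P t -> Q t) ->
  {ae mu, forall t, P t} -> {ae mu, forall t, Q t}.
Proof. by move=> PQ; apply: negligibleS => t /= nQ /PQ. Qed.

Lemma aeI (P Q : R -> Prop) : {ae mu, forall t, P t} -> {ae mu, forall t, Q t} ->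
  {ae mu, forall t, P t /\ Q t}.
Proof.
move=> aP aQ; apply: (@negligibleS _ _ _ mu _ _ _ (negligibleU aP aQ)).
by move=> t /= /not_andP.
Qed.

Lemma per_integral_EFin q : per_integrable q -> (\int[mu]_(t in per) (q t)%:E)%E = (per_integral q)%:E.
Proof. by move=> iq; rewrite /per_integral /Rintegral fineK//; exact: (integrable_fin_num (@measurable_per R) iq). Qed.

(** Monotone convergence with the limit kept implicit: the extended-real limit has finite integral,
    hence is finite almost everywhere. The test on [q] says that [q] lies below this limit, and
    bounds nothing from above where the limit is infinite. *)
Lemma monotone_bounded (q_ : nat -> R -> R) (M : R) :
  (forall n, per_integrable (q_ n)) -> (forall n t, per t -> 0 <= q_ n t) ->
  (forall t, per t -> {homo q_^~ t : n m / (n <= m)%N >-> n <= m}) ->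
  (forall n, per_integral (q_ n) <= M) ->
  {ae mu, forall t, per t -> exists C, forall n, q_ n t <= C} /\
  forall q, per_measurable q -> (forall t, per t -> 0 <= q t /\
     forall C, (forall n, q_ n t <= C) -> q t <= C) -> per_integrable q.
Proof.
move=> iq q0 qh qM.
pose g (n : nat) (t : measurableTypeR R) : \bar R := (q_ n t)%:E.
pose L (t : measurableTypeR R) : \bar R := limn (g^~ t).
have mg n : measurable_fun (per : set (measurableTypeR R)) (g n).
  by have /measurable_int := iq n.
have g0 n t : per t -> (0 <= g n t)%E by move=> pt; rewrite lee_fin q0.
have gh t : per t -> {homo g^~ t : n m / (n <= m)%N >-> (n <= m)%E}.
  by move=> pt n m nm; rewrite lee_fin qh.
have cg t : per t -> cvgn (g^~ t).
  by move=> pt; apply: ereal_nondecreasing_is_cvgn => n m nm; exact: gh.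
have gL n t : per t -> (g n t <= L t)%E.
  move=> pt; have nd : nondecreasing_seq (g^~ t) by move=> a b ab; exact: gh.
  rewrite /L (cvg_lim _ (ereal_nondecreasing_cvgn nd))//.
  by apply: ereal_sup_ubound; exists n.
have mL : measurable_fun (per : set (measurableTypeR R)) L.
  by apply: (@emeasurable_fun_cvg _ (measurableTypeR R) R per g L mg) => t pt; exact: cg.
have L0 t : per t -> (0 <= L t)%E by move=> pt; exact: le_trans (g0 0%N t pt) (gL 0%N t pt).
have LM : (\int[mu]_(t in per) L t <= M%:E)%E.
  have cv := @cvg_monotone_convergence _ _ R mu per (@measurable_per R) g mg g0 gh.
  rewrite -(cvg_lim _ cv)//; apply: lime_le; first exact: cvgP cv.
  by apply: nearW => n; rewrite /g per_integral_EFin// lee_fin.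
have iL : mu.-integrable per L.
  apply/integrableP; split => //.
  under eq_integral => t do [move=> /set_mem pt; rewrite gee0_abs ?L0//].
  exact: le_lt_trans LM (ltry _).
split.
  have := @integrable_ae _ _ _ mu per (@measurable_per R) L iL.
  apply: filterS => t h pt; exists (fine (L t)) => n.
  by rewrite -lee_fin fineK ?h//; exact: gL.
move=> q mq Hq; apply: (le_integrable (@measurable_per R) _ _ iL).
  exact/measurable_EFinP.
move=> t pt /=; have [qt0 qC] := Hq t pt.
rewrite (gee0_abs (L0 t pt)) ger0_norm//.
move: (fun n => gL n t pt) (L0 t pt); case: (L t) => [l| |] //= h _; last exact: leey.
by rewrite lee_fin; apply: qC => n; have := h n; rewrite lee_fin.
Qed.

Lemma dominated_period (q_ : nat -> R -> R) q p :
  (forall n, per_measurable (q_ n)) -> per_measurable q -> per_integrable p ->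
  {ae mu, forall t, per t -> q_^~ t @ \oo --> q t} ->
  {ae mu, forall t, per t -> forall n, `|q_ n t| <= p t} ->
  (fun n => per_integral (q_ n)) @ \oo --> per_integral q.
Proof.
move=> mq_ mq ip cv le.
have mE (k : R -> R) : per_measurable k -> measurable_fun (per : set (measurableTypeR R)) (EFin \o k : measurableTypeR R -> \bar R).
  by move=> mk; exact/measurable_EFinP.
have [|||||Iq _ H] := @dominated_convergence _ _ _ mu per (@measurable_per R)
  (fun n => EFin \o q_ n) (EFin \o q) (EFin \o p).
- by move=> n; exact: mE.
- exact: mE.
- apply: aeS cv => t h pt; apply: cvg_EFin; last exact: h.
  by apply: nearW.
- exact: ip.
- by apply: aeS le => t h n pt; rewrite /= lee_fin h.
have H' : (fun n => \int[mu]_(t in per) (q_ n t)%:E)%E @ \oo --> (per_integral q)%:E.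
  by rewrite -per_integral_EFin.
exact: fine_cvg H'.
Qed.
End PeriodConvergence.

(** * The logarithm of the boundary modulus and the inner part *)

Section Majorization.
Variable R : realType.
Implicit Types (z w zeta : R[i]) (s t : R).
Local Notation mu := (@lebesgue_measure R).
Local Notation per := (@period R).
Variables (g : R[i] -> R[i]) (u k : R[i] -> R) (z0 : R[i]).
Hypothesis sg : smooth 2 (@disk R) g.
Hypothesis ug : forall z, disk z -> u z = normc (g z).
Hypothesis u0 : forall z, 0 <= u z.
(* A normalization at the point where [u] is not assumed continuous. *)
Hypothesis u1 : u 1 = 0.
Hypothesis uc : forall zeta, circle zeta -> zeta != 1 -> forall e : R, 0 < e ->
  exists2 r : R, 0 < r & forall z, closed_disk z -> normc (z - zeta) < r -> `|u z - u zeta| < e.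
Hypothesis ik : circle_integrable k.
Hypothesis k0 : forall z, 0 <= k z.
Hypothesis gk : forall z, disk z -> normc (g z) <= expR (poisson_integral k z).
Hypothesis Dz0 : disk z0.
Hypothesis gz0 : g z0 != 0.

Lemma circle_expi t : circle (expi t : R[i]).
Proof. exact: normc_expi. Qed.

Lemma circle_closed zeta : circle zeta -> closed_disk zeta.
Proof. by rewrite /circle /closed_disk /= => ->. Qed.

Lemma disk_closed z : disk z -> closed_disk z.
Proof. exact: ltW. Qed.

Lemma boundary_continuous (F : R -> R) zeta : circle zeta -> zeta != 1 ->
  {for u zeta, continuous F} -> forall e : R, 0 < e ->
  exists2 r : R, 0 < r &
    forall z, closed_disk z -> normc (z - zeta) < r -> `|F (u z) - F (u zeta)| < e.
Proof.
move=> hz z1 cF e e0.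
have : \forall x \near u zeta, `|F (u zeta) - F x| < e.
  by move/cvgrPdist_lt: cF => /(_ _ e0).
move=> /nbhs_ballP[d /= d0 Hd].
have [r r0 Hr] := uc hz z1 d0; exists r => // z cz zr.
rewrite distrC; apply: Hd; rewrite -ball_normE /= distrC; exact: Hr.
Qed.

Lemma per_measurable_boundary (F : R -> R) : (forall t, 0 < t < pi *+ 2 -> {for u (expi t), continuous F}) ->
  per_measurable (fun t => F (u (expi t))).
Proof.
move=> cF; apply: per_measurable_open => t ht; apply/cvgrPdist_lt => e e0.
have [r r0 Hr] := boundary_continuous (circle_expi t) (expi_neq1 ht) (cF t ht) e0.
have /cvgC/(_ _ r0) := @continuous_expi R t; apply: filterS => s hs.
rewrite distrC; apply: Hr => //; exact/circle_closed/circle_expi.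
Qed.

(** Cutting at [c > 0] makes the logarithm a continuous function of [u] even where [u] vanishes;
    [q 1] is the positive part of [log u]. *)
Let q (c : R) zeta : R := ln (Num.max (u zeta) c).

Lemma continuous_ln_max (c x : R) : 0 < c -> {for x, continuous (fun y => ln (Num.max y c))}.
Proof.
move=> c0; have h : (fun y => Num.max y c) @ x --> Num.max x c.
  apply/cvgrPdist_lt => e e0.
  have /cvgrPdist_lt/(_ _ e0) : id @ x --> x by exact: cvg_id.
  apply: filterS => y; rewrite !ltr_norml => /andP[h1 h2].
  by case: (leP x c); case: (leP y c); lra.
by apply: (cvg_comp _ _ h); apply: continuous_ln; rewrite lt_max c0 orbT.
Qed.

Lemma q_ge c zeta : 0 < c -> ln c <= q c zeta.
Proof. by move=> c0; rewrite ler_ln ?posrE ?lt_max ?c0 ?orbT// le_max lexx orbT. Qed.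

Lemma q1_ge0 zeta : 0 <= q 1 zeta.
Proof. by rewrite -ln1 q_ge. Qed.

Lemma q_le1 c zeta : 0 < c <= 1 -> q c zeta <= q 1 zeta.
Proof.
move=> /andP[c0 c1]; rewrite ler_ln ?posrE ?lt_max ?c0 ?ltr01 ?orbT//.
by rewrite ge_max !le_max lexx c1 orbT.
Qed.

Lemma u_le_q c zeta : 0 < c -> u zeta <= expR (q c zeta).
Proof. by move=> c0; rewrite lnK ?posrE ?lt_max ?c0 ?orbT// le_max lexx. Qed.

Lemma q_near c zeta : 0 < c -> circle zeta -> zeta != 1 -> forall e : R, 0 < e ->
  exists2 r : R, 0 < r & forall z, closed_disk z -> normc (z - zeta) < r ->
    `|q c z - q c zeta| < e.
Proof.
move=> c0 hz z1; apply: (@boundary_continuous (fun y => ln (Num.max y c))) => //.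
exact: continuous_ln_max.
Qed.

Lemma per_measurable_q c : 0 < c -> per_measurable (fun t => q c (expi t)).
Proof. by move=> c0; apply: (@per_measurable_boundary (fun y => ln (Num.max y c))) => t _; exact: continuous_ln_max. Qed.

(* Cutting [q 1] down to [p m] removes the exceptional point [1]: [p m] tends to [0] there. *)
Let p (m : nat) zeta : R := Num.min (q 1 zeta) (m%:R * normc (zeta - 1)).

Lemma p_ge0 m zeta : 0 <= p m zeta.
Proof. by rewrite le_min q1_ge0 mulr_ge0// normc_ge0. Qed.

Lemma continuous_dist1 : continuous (fun t : R => normc (expi t - 1)).
Proof.
move=> t; apply: (@normc_cvg _ _ _ (nbhs_filter t)).
by apply: cvgcD; [exact: continuous_expi|exact: cvg_cst].
Qed.

Lemma circle_integrable_p m : circle_integrable (p m).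
Proof.
apply: (@per_integrable_bounded _ _ (m%:R * 2)).
  apply: (measurable_minr (per_measurable_q ltr01)); apply: continuous_mfun => t.
  by apply: cvgM; [exact: cvg_cst|exact: continuous_dist1].
move=> t; rewrite ger0_norm ?p_ge0// ge_min; apply/orP; right.
by rewrite ler_wpM2l// (le_trans (le_normcB _ _))// normc_expi normc1.
Qed.

(** The majorant principle is applied to the constant function [1] and the density [k - p m]. At the
    boundary point [1], [p m] is small and [P[k] >= 0]; elsewhere [p m <= q 1], which is continuous
    there and at most [P[k]] inside the disk. *)
Lemma poisson_p_le m z : disk z -> poisson_integral (p m) z <= poisson_integral k z.
Proof.
move=> Dz; have ip := circle_integrable_p m.
have ikp : circle_integrable (fun x => k x + - p m x).
  by apply: circle_integrableD => //; exact: circle_integrableN.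
have E w : disk w -> poisson_integral (fun x => k x + - p m x) w =
    poisson_integral k w - poisson_integral (p m) w.
  by move=> Dw; rewrite poissonD ?poissonN//; exact: circle_integrableN.
rewrite -subr_ge0 -E// -[leLHS](ln1 R).
rewrite -ler_expR lnK ?posrE// -(normc1 R).
apply: (@poisson_majorant _ (fun=> 1) _ (smooth_cst _ _ _) ikp) => // zeta hz e e0.
have e2 : 0 < e / 2 by rewrite divr_gt0.
have e4 : 0 < e / 4 by rewrite divr_gt0.
suff [r r0 Hr] : exists2 r : R, 0 < r & forall w, disk w -> normc (w - zeta) < r ->
    poisson_integral (p m) w <= poisson_integral k w + e.
  exists r => // w Dw wr; rewrite normc1 -expR0 ler_expR E//.
  by have := Hr w Dw wr; lra.
have [->|z1] := eqVneq zeta 1.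
  have m0 : 0 < e / 2 / (m%:R + 1) by rewrite divr_gt0// ltr_wpDl.
  have [||r r0 Hr] := @poisson_limsup _ _ 1 (e / 2) _ ip _ m0 _ _ e2.
  - exact: normc1.
  - move=> t _; rewrite ltr_pdivlMr ?ltr_wpDl// => h.
    rewrite ge_min; apply/orP; right; have := normc_ge0 (expi t - 1); lra.
  exists r => // w Dw wr; have := Hr w Dw wr.
  have := @poisson_ge0 _ _ _ Dw (fun t _ => k0 (expi t)); lra.
have [r1 r10 H1] := q_near ltr01 hz z1 e4.
have [|r2 r20 H2] := @poisson_limsup _ _ zeta (q 1 zeta + e / 4) _ ip hz r10 _ _ e4.
  move=> t _ /(H1 _ (circle_closed (circle_expi t))); rewrite ltr_distl => /andP[_ h].
  by rewrite ge_min ltW.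
exists (Num.min r1 r2) => [|w Dw]; first by rewrite lt_min r10.
rewrite lt_min => /andP[/(H1 _ (disk_closed Dw))]; rewrite ltr_distl => /andP[h _] /(H2 _ Dw).
have : q 1 w <= poisson_integral k w.
  rewrite -[leRHS]expRK ler_ln ?posrE ?expR_gt0 ?lt_max ?ltr01 ?orbT//.
  rewrite ge_max ug// gk//= -expR0 ler_expR.
  exact: (@poisson_ge0 _ _ _ Dw (fun t _ => k0 (expi t))).
lra.
Qed.

(** At the origin the comparison bounds all integrals of [p m] by that of [k]. The sequence
    increases to [q 1]: off the point [1] because the factor [m] grows, at [1] because [u 1 = 0]. *)
Lemma circle_integrable_q1 : circle_integrable (q 1).
Proof.
have [||||_ H] := @monotone_bounded R (fun m t => p m (expi t)) (per_integral (k \o @expi R)).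
- exact: circle_integrable_p.
- by move=> m t _; exact: p_ge0.
- move=> t _ m n mn; rewrite le_min !ge_min lexx/=.
  by apply/orP; right; rewrite ler_wpM2r ?normc_ge0// ler_nat.
- move=> m; have := @poisson_p_le m 0; rewrite !poisson0 /circle_integral.
  by rewrite ler_pM2l ?invr_gt0 ?pi2_gt0//; apply; rewrite diskE normc0.
apply: H; first exact: per_measurable_q.
move=> t _; split; first exact: q1_ge0.
move=> C HC; have [e1|e1] := eqVneq (expi t : R[i]) 1.
  rewrite /= e1 /q u1 (max_idPr _)// ln1.
  by have := HC 0%N; apply: le_trans; exact: p_ge0.
have d0 : 0 < normc (expi t - 1 : R[i]) by rewrite normc_gt0 subr_eq0.
pose m := Num.truncn (q 1 (expi t) / normc (expi t - 1 : R[i])).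
have := HC m.+1; rewrite /p (min_idPl _)//.
by rewrite -ler_pdivrMr// ltW// truncnS_gt.
Qed.

Let c_ (N : nat) : R := expR (- N%:R).

Lemma c_gt0 N : 0 < c_ N. Proof. exact: expR_gt0. Qed.

Lemma c_le1 N : 0 < c_ N <= 1.
Proof. by rewrite c_gt0/= -[leRHS]expR0 ler_expR oppr_le0 ler0n. Qed.

Lemma q_geN N zeta : - N%:R <= q (c_ N) zeta.
Proof. by rewrite -[leLHS]expRK q_ge// c_gt0. Qed.

Lemma circle_integrable_q N : circle_integrable (q (c_ N)).
Proof.
apply: (@per_integrable_le _ _ (fun t => q 1 (expi t) + N%:R)).
- by apply: per_measurable_q; exact: c_gt0.
- by apply: per_integrableD; [exact: circle_integrable_q1|exact: per_integrable_cst].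
- move=> t _; rewrite ler_norml; have := q_geN N (expi t); have := ler0n R N.
  by have := q_le1 (expi t) (c_le1 N); have := q1_ge0 (expi t); lra.
Qed.

(* Added to [q (c_ N)], it dominates [k] near the exceptional point [1]; its integral
   tends to [0] as the arc shrinks. *)
Let r_ (N m : nat) zeta : R :=
  (k zeta + N%:R) * (normc (zeta - 1) < m.+1%:R^-1)%R%:R.

Lemma r_ge0 N m zeta : 0 <= r_ N m zeta.
Proof. by rewrite mulr_ge0// addr_ge0. Qed.

Lemma per_measurable_r N m : per_measurable (fun t => r_ N m (expi t)).
Proof.
have mk := per_integrable_measurable ik.
apply: measurable_funM; first by apply: measurable_funD => //; exact: measurable_cst.
pose F (x : R) : R := (x < m.+1%:R^-1)%R%:R.
have -> : (fun t => (normc (expi t - 1 : R[i]) < m.+1%:R^-1)%R%:R : R) =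
  F \o (fun t => normc (expi t - 1 : R[i])) by [].
apply: (@measurableT_comp _ _ _ (measurableTypeR R) _ _ F).
  rewrite (_ : F = \1_(`]-oo, m.+1%:R^-1[)); last first.
    by apply/funext => x; rewrite indicE /F; congr (_%:R); rewrite mem_setE in_itv.
  by apply: measurable_indic; exact: measurable_itv.
by apply: continuous_mfun; exact: continuous_dist1.
Qed.

Lemma circle_integrable_r N m : circle_integrable (r_ N m).
Proof.
apply: (@per_integrable_le _ _ (fun t => k (expi t) + N%:R)).
- exact: per_measurable_r.
- by apply: per_integrableD => //; exact: per_integrable_cst.
- move=> t _; rewrite ger0_norm ?r_ge0// ler_piMr ?addr_ge0//.
  by case: (_ < _); rewrite ?lexx ?ler01.
Qed.

Lemma per_integral_r_cvg0 N : (fun m => per_integral (fun t => r_ N m (expi t))) @ \oo --> (0 : R).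
Proof.
rewrite -[X in _ --> X](_ : per_integral (fun=> 0) = _); last by rewrite per_integral_cst mul0r mul0rn.
apply: (@dominated_period _ _ _ (fun t => k (expi t) + N%:R)).
- exact: per_measurable_r.
- exact: measurable_cst.
- by apply: per_integrableD => //; exact: per_integrable_cst.
- apply: aeS (@ae_expi_neq1 R) => t h /h e1.
  have d0 : 0 < normc (expi t - 1 : R[i]) by rewrite normc_gt0 subr_eq0.
  apply/cvgrPdist_lt => e e0; near=> m; rewrite /r_.
  have -> : (normc (expi t - 1 : R[i]) < m.+1%:R^-1)%R = false.
    apply/negbTE; rewrite -leNgt.
    near: m; exists (Num.truncn (normc (expi t - 1 : R[i]))^-1) => // m /= mn.
    rewrite -[leRHS]invrK lef_pV2 ?posrE ?invr_gt0//.
    by rewrite ltW// (lt_le_trans (truncnS_gt _))// ler_nat ltnS.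
  by rewrite mulr0 subrr normr0.
- apply: aeS (@ae_expi_neq1 R) => t _ _ m.
  rewrite ger0_norm ?r_ge0// ler_piMr ?addr_ge0//.
  by case: (_ < _); rewrite ?lexx ?ler01.
Unshelve. all: by end_near. Qed.

(** Near [1] the density is at least [k], since [q (c_ N) >= - N] and [r_ N m = k + N] there, so the
    known majorant is inherited. At the other boundary points continuity of [q (c_ N)] suffices, as
    [r_ N m >= 0]. *)
Lemma majorant_qr N m z : disk z ->
  normc (g z) <= expR (poisson_integral (fun x => q (c_ N) x + r_ N m x) z).
Proof.
have iq := circle_integrable_q N; have ir := circle_integrable_r N m.
have iqr : circle_integrable (fun x => q (c_ N) x + r_ N m x) by exact: circle_integrableD.
move=> Dz; apply: (poisson_majorant sg iqr) => // zeta hz e e0 {z Dz}.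
have [->|z1] := eqVneq zeta 1.
  have m0 : 0 < m.+1%:R^-1 :> R by rewrite invr_gt0.
  have ih : circle_integrable (fun x => (q (c_ N) x + r_ N m x) + - k x).
    by apply: circle_integrableD => //; exact: circle_integrableN.
  have [||r r0 Hr] := @poisson_liminf _ _ 1 0 _ ih _ m0 _ _ e0.
  - exact: normc1.
  - move=> t _ h; rewrite /r_ h mulr1; have := q_geN N (expi t); lra.
  exists r => // w Dw wr; apply: le_trans (gk Dw) _; rewrite ler_expR.
  have := Hr w Dw wr; rewrite (poissonD iqr (circle_integrableN ik) Dw) poissonN//; lra.
have e3 : 0 < e / 3 by rewrite divr_gt0.
have [r1 r10 H1] := q_near (c_gt0 N) hz z1 e3.
have [|r2 r20 H2] := @poisson_liminf _ _ zeta (q (c_ N) zeta - e / 3) _ iqr hz r10 _ _ e3.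
  move=> t _ /(H1 _ (circle_closed (circle_expi t))); rewrite ltr_distl => /andP[h _].
  by have := r_ge0 N m (expi t); lra.
exists (Num.min r1 r2) => [|w Dw]; first by rewrite lt_min r10.
rewrite lt_min => /andP[/(H1 _ (disk_closed Dw))]; rewrite ltr_distl => /andP[_ h] /(H2 _ Dw) h2.
rewrite -ug// (le_trans (u_le_q _ (c_gt0 N)))// ler_expR; lra.
Qed.

(** At a fixed [z] the Poisson kernel is bounded, so the contribution of [r_ N m] disappears as the
    arc shrinks. *)
Lemma majorant_q N z : disk z -> normc (g z) <= expR (poisson_integral (q (c_ N)) z).
Proof.
move=> Dz; have iq := circle_integrable_q N.
suff H e : 0 < e -> normc (g z) <= expR (poisson_integral (q (c_ N)) z + e).
  have [->|gz] := eqVneq (g z) 0; first by rewrite normc0 expR_ge0.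
  have gp : 0 < normc (g z) by rewrite normc_gt0.
  rewrite -(lnK gp) ler_expR; apply/ler_addgt0Pr => e /H.
  by rewrite -{1}(lnK gp) ler_expR.
move=> e0; pose C := ((1 - normc z) ^+ 2)^-1.
have C0 : 0 < C by rewrite invr_gt0 exprn_gt0// subr_gt0.
have e1 : 0 < e * (pi *+ 2) / C by rewrite divr_gt0// mulr_gt0// pi2_gt0.
have /cvgrPdist_lt/(_ _ e1)[m _ /(_ m (leqnn m))] := per_integral_r_cvg0 N.
rewrite sub0r normrN ger0_norm; last by apply: per_integral_ge0 => t _; exact: r_ge0.
move=> hm; have ir := circle_integrable_r N m.
apply: (le_trans (majorant_qr N m Dz)); rewrite ler_expR poissonD// lerD2l.
rewrite /poisson_integral /circle_integral mulrC ler_pdivrMr ?pi2_gt0//.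
apply: (@le_trans _ _ (per_integral (fun t => C * r_ N m (expi t)))).
  apply: (per_integral_le (per_integrable_poisson ir Dz) (per_integrableZ C ir)) => t _.
  by rewrite ler_wpM2r ?r_ge0// poisson_kernel_le.
by rewrite per_integralZ// mulrC -ler_pdivlMr// ltW.
Qed.

(** A boundary point is at distance at most [2] from [z0]. The bound converts the value at [z0] of
    the Poisson integral of a nonnegative density into a bound for its integral. *)
Lemma poisson_kernel_lower t : (1 - normc z0 ^+ 2) / 4 <= poisson_kernel z0 (expi t).
Proof.
have h0 : 0 < normc (expi t - z0) by rewrite normc_gt0 expi_sub_neq0.
have h2 : normc (expi t - z0) <= 2.
  rewrite (le_trans (le_normcB _ _))// normc_expi.
  by have : normc z0 < 1 by []; lra.
rewrite /poisson_kernel ler_wpM2l//.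
  rewrite subr_ge0 -[leRHS](expr1n _ 2) lerXn2r ?nnegrE ?normc_ge0//; exact: ltW.
rewrite lef_pV2 ?posrE ?exprn_gt0//.
have -> : 4 = 2 ^+ 2 :> R by rewrite -natrX.
by rewrite lerXn2r ?nnegrE// ltW.
Qed.

(** Increases with [N] to the negative part of [log u], read as infinite where [u] vanishes. *)
Let d (N : nat) t : R := q 1 (expi t) - q (c_ N) (expi t).

(** Since [g z0] is nonzero, [majorant_q] keeps [P[q (c_ N)]] at [z0] above the fixed number
    [ln |g z0|]. The Poisson integrals of [d N] at [z0] are therefore bounded, and by the lower
    bound of the kernel so are the integrals. *)
Lemma per_integral_d_le : exists M : R, forall N, per_integral (d N) <= M.
Proof.
pose C := (1 - normc z0 ^+ 2) / 4.
have C0 : 0 < C.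
  by rewrite divr_gt0// subr_gt0 -[ltRHS](expr1n _ 2) ltrXn2r ?nnegrE ?normc_ge0.
have gp : 0 < normc (g z0) by rewrite normc_gt0.
exists ((pi *+ 2) * (poisson_integral (q 1) z0 - ln (normc (g z0))) / C) => N.
have iq := circle_integrable_q N; have iq1 := circle_integrable_q1.
have idd : circle_integrable (fun x => q 1 x + - q (c_ N) x).
  by apply: circle_integrableD => //; exact: circle_integrableN.
rewrite ler_pdivlMr// mulrC -[X in X <= _](per_integralZ C idd).
apply: (@le_trans _ _ ((pi *+ 2) * poisson_integral (fun x => q 1 x + - q (c_ N) x) z0)).
  rewrite /poisson_integral /circle_integral mulrA mulfV ?gt_eqF ?pi2_gt0// mul1r.
  apply: (per_integral_le (per_integrableZ C idd) (per_integrable_poisson idd Dz0)) => t _ /=.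
  by rewrite ler_wpM2r ?poisson_kernel_lower// subr_ge0 q_le1// c_le1.
rewrite ler_pM2l ?pi2_gt0// (poissonD iq1 (circle_integrableN iq) Dz0) poissonN// lerD2l lerN2.
by rewrite -ler_expR lnK ?posrE//; exact: majorant_q.
Qed.

Lemma d_ge0 N t : 0 <= d N t.
Proof. by rewrite subr_ge0 q_le1// c_le1. Qed.

Lemma q_c_eq N zeta : c_ N <= u zeta -> q (c_ N) zeta = ln (u zeta).
Proof. by move=> h; rewrite /q (max_idPl h). Qed.

Lemma c_small (x : R) : 0 < x -> exists N0, forall N, (N0 <= N)%N -> c_ N <= x.
Proof.
move=> x0; exists (Num.truncn (- ln x)).+1 => N hN.
rewrite -[leRHS](lnK x0) ler_expR lerNl ltW//.
by rewrite (lt_le_trans (truncnS_gt _))// ler_nat.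
Qed.

(** At a zero of [u] the value of [d N] is exactly [N]. *)
Lemma d_unbounded t : (exists C, forall N, d N t <= C) -> 0 < u (expi t).
Proof.
move=> [C HC]; rewrite lt_neqAle u0 andbT eq_sym; apply/eqP => ut.
have := HC (Num.truncn C).+1; rewrite /d /q ut.
rewrite (max_idPr (ltW (c_gt0 _))) (max_idPr ler01) ln1 /c_ expRK sub0r opprK leNgt.
by rewrite truncnS_gt.
Qed.

Lemma d_monotone t : {homo d^~ t : m n / (m <= n)%N >-> m <= n}.
Proof.
move=> m n mn; rewrite lerD2l lerN2 ler_ln ?posrE ?lt_max ?c_gt0 ?orbT//.
rewrite ge_max !le_max lexx/=; apply/orP; right.
by rewrite ler_expR lerN2 ler_nat.
Qed.

Lemma bounded_d : {ae mu, forall t, per t -> exists C, forall N, d N t <= C} /\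
  forall q, per_measurable q -> (forall t, per t -> 0 <= q t /\
     forall C, (forall n, d n t <= C) -> q t <= C) -> per_integrable q.
Proof.
have [M HM] := per_integral_d_le; apply: (@monotone_bounded R d M) => //.
- by move=> N; apply: per_integrableB; [exact: circle_integrable_q1|exact: circle_integrable_q].
- by move=> N t _; exact: d_ge0.
- by move=> t _; exact: d_monotone.
Qed.

Lemma ae_boundary_gt0 : {ae mu, forall t, per t -> 0 < u (expi t)}.
Proof. by apply: aeS bounded_d.1 => t h /h; exact: d_unbounded. Qed.

Lemma circle_integrable_ln : circle_integrable (fun x => ln (u x)).
Proof.
have mu0 : per_measurable (fun t => u (expi t)) by apply: (@per_measurable_boundary id) => t _; exact: cvg_id.
have mlnu : per_measurable (fun t => ln (u (expi t))).
  by apply: (@measurableT_comp _ _ _ (measurableTypeR R) _ _ (@ln R)).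
have iq := circle_integrable_q1.
have /(per_integrableB iq) : per_integrable (fun t => q 1 (expi t) - ln (u (expi t))).
  apply: bounded_d.2.
    by apply: measurable_funB => //; apply: per_measurable_q.
  (* The convention [ln 0 = 0] makes the difference vanish at a zero of [u], where the test is then
     trivial. *)
  move=> t _; have [ut|ut] := eqVneq (u (expi t)) 0.
    rewrite /q ut (max_idPr ler01) ln1 [ln 0]ln0// subr0; split => // C HC.
    exact: le_trans (d_ge0 0 t) (HC 0%N).
  have up : 0 < u (expi t) by rewrite lt_neqAle eq_sym ut u0.
  split; first by rewrite subr_ge0 ler_ln ?posrE ?lt_max ?up// le_max lexx.
  move=> C HC; have [N0 /(_ N0 (leqnn _)) hN] := c_small up.
  by have := HC N0; rewrite /d q_c_eq.
by rewrite /per_integrable; under eq_fun do rewrite /= opprB addrC subrK.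
Qed.

(** Limit of [majorant_q]: at almost every point [q (c_ N)] is eventually equal to [ln u], under the
    dominating function [q 1 + |ln u|]. *)
Lemma majorant_ln z : disk z -> normc (g z) <= expR (poisson_integral (fun x => ln (u x)) z).
Proof.
move=> Dz; have ih := circle_integrable_ln.
have [->|gz] := eqVneq (g z) 0; first by rewrite normc0 expR_ge0.
have gp : 0 < normc (g z) by rewrite normc_gt0.
rewrite -(lnK gp) ler_expR.
have B N : ln (normc (g z)) <= poisson_integral (q (c_ N)) z.
  by rewrite -ler_expR lnK ?posrE//; exact: majorant_q.
have mP : per_measurable (fun t => poisson_kernel z (expi t)).
  by apply: continuous_mfun; exact: continuous_poisson_kernel.
have cv : (fun N => poisson_integral (q (c_ N)) z) @ \oo -->
    poisson_integral (fun x => ln (u x)) z.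
  apply: cvgM; first exact: cvg_cst.
  apply: (@dominated_period R (fun N t => poisson_kernel z (expi t) * q (c_ N) (expi t))
    (fun t => poisson_kernel z (expi t) * ln (u (expi t)))
    (fun t => poisson_kernel z (expi t) * (q 1 (expi t) + `|ln (u (expi t))|))).
  - by move=> N; apply: measurable_funM => //; by apply: per_measurable_q; exact: c_gt0.
  - by apply: measurable_funM => //; exact: per_integrable_measurable ih.
  - apply: (@per_integrable_poisson _ (fun x => q 1 x + `|ln (u x)|)) => //.
    by apply: per_integrableD; [exact: circle_integrable_q1|exact: per_integrable_abs].
  - apply: aeS ae_boundary_gt0 => t h /h ut; apply: cvgM; first exact: cvg_cst.
    have [N0 HN] := c_small ut; apply/cvgrPdist_lt => e e0.
    by exists N0 => // N /= /HN hN; rewrite q_c_eq// subrr normr0.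
  - apply: aeS ae_boundary_gt0 => t h /h ut N.
    rewrite normrM (ger0_norm (poisson_kernel_ge0 _ Dz)).
    rewrite ler_wpM2l ?poisson_kernel_ge0// ler_norml.
    have h1 : ln (u (expi t)) <= q (c_ N) (expi t).
      by rewrite ler_ln ?posrE ?lt_max ?ut// le_max lexx.
    have := q_le1 (expi t) (c_le1 N); have := q1_ge0 (expi t).
    by have := ler_norm (- ln (u (expi t))); rewrite normrN;
       have := normr_ge0 (ln (u (expi t))); lra.
have : ln (normc (g z)) <= lim ((fun N => poisson_integral (q (c_ N)) z) @ \oo).
  by apply: limr_ge; [exact: cvgP cv|exact: nearW].
by rewrite (cvg_lim _ cv).
Qed.

Definition inner_part z := g z * cexp (-1 * herglotz (fun x => ln (u x)) z).

Lemma inner_part_eq z : g z = inner_part z * cexp (herglotz (fun x => ln (u x)) z).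
Proof. by rewrite /inner_part -mulrA -cexpD mulN1r addNr cexp0 mulr1. Qed.

Lemma normc_inner_part z : disk z ->
  normc (inner_part z) = normc (g z) * expR (- poisson_integral (fun x => ln (u x)) z).
Proof.
move=> Dz; rewrite /inner_part normcM normc_cexp -Re_herglotz//.
by congr (_ * expR _); case: (herglotz _ z) => x y /=; ring.
Qed.

Lemma smooth_inner_part : smooth 2 (@disk R) inner_part.
Proof.
apply: smoothM => //; apply: smooth_cexp; apply: smoothM; first exact: smooth_cst.
exact/smooth_herglotz/circle_integrable_ln.
Qed.

Lemma inner_part_le1 z : disk z -> normc (inner_part z) <= 1.
Proof.
move=> Dz; rewrite normc_inner_part// expRN ler_pdivrMr ?expR_gt0// mul1r.
exact: majorant_ln.
Qed.

(** Near [zeta] the Poisson integral of [ln u] is at most slightly above [ln (u zeta)], while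
    [ln |g|] is at most slightly below it; their difference is the logarithm of the modulus of
    [inner_part]. The approach to [zeta] is unrestricted. *)
Lemma inner_part_boundary zeta : circle zeta -> zeta != 1 -> 0 < u zeta ->
  forall e : R, 0 < e -> exists2 r : R, 0 < r &
    forall z, disk z -> normc (z - zeta) < r -> expR (- e) <= normc (inner_part z).
Proof.
move=> hz z1 up e e0; have ih := circle_integrable_ln.
have e3 : 0 < e / 3 by rewrite divr_gt0.
have [r1 r10 H1] := boundary_continuous hz z1 (continuous_ln up) e3.
have [|r2 r20 H2] := @poisson_limsup _ _ zeta (ln (u zeta) + e / 3) _ ih hz r10 _ _ e3.
  move=> t _ /(H1 _ (circle_closed (circle_expi t))); rewrite ltr_distl => /andP[_ h].
  exact: ltW.
have [r3 r30 H3] := uc hz z1 up.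
exists (Num.min (Num.min r1 r3) r2) => [|z Dz]; first by rewrite !lt_min r10 r20 r30.
rewrite !lt_min => /andP[/andP[k1 k3] k2].
have := H1 _ (disk_closed Dz) k1; rewrite ltr_distl => /andP[h1 _].
have h2 := H2 _ Dz k2.
have := H3 _ (disk_closed Dz) k3; rewrite ltr_distl subrr => /andP[uz _].
rewrite normc_inner_part// -ug// -(lnK uz) -expRD ler_expR; lra.
Qed.

Lemma inner_part_radial zeta : circle zeta -> zeta != 1 -> 0 < u zeta ->
  normc (inner_part (r%:C * zeta)) @[r --> (1 : R)^'-] --> (1 : R).
Proof.
move=> hz z1 up; apply/cvgrPdist_lt => e e0.
have [y y0 Hy] : exists2 y : R, 0 < y & 1 - e < expR (- y).
  have /cvgrPdist_lt/(_ _ e0) := @continuous_expR R 0.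
  move=> /nbhs_ballP[y /= y0 Hy]; exists (y / 2); first by rewrite divr_gt0.
  have := Hy (- (y / 2)); rewrite -ball_normE /= sub0r opprK ger0_norm ?divr_ge0 ?(ltW y0)//.
  by rewrite expR0 ltr_pdivrMr// mulr_natr mulr2n ltrDl => /(_ y0); rewrite ltr_distl => /andP[_]; lra.
have [r r0 Hr] := inner_part_boundary hz z1 up y0.
near=> s.
have s1 : s < 1 by near: s; exact: nbhs_left_lt.
have s0 : 0 < s by near: s; apply: nbhs_left_gt; exact: ltr01.
have sr : 1 - r < s by near: s; apply: nbhs_left_gt; rewrite ltrBlDr ltrDl.
have n1 : normc (s%:C * zeta) = s by rewrite normcM normc_real gtr0_norm// hz mulr1.
have Ds : disk (s%:C * zeta) by rewrite /disk /= n1.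
have hr : normc (s%:C * zeta - zeta) < r.
  rewrite (_ : _ - zeta = (s - 1)%:C * zeta); last by rewrite real_complexB; ring.
  by rewrite normcM normc_real hz mulr1 distrC gtr0_norm; lra.
have := Hr _ Ds hr; have := inner_part_le1 Ds.
by move=> h1 h2; rewrite ger0_norm ?subr_ge0//; lra.
Unshelve. all: by end_near. Qed.

Lemma inner_function_inner_part : inner_function inner_part.
Proof.
split.
  split; last by exists 1 => z; exact: inner_part_le1.
  by move=> z Dz; apply: cder_derivable (smooth_cder smooth_inner_part Dz).
apply: aeS (aeI ae_boundary_gt0 (@ae_expi_neq1 R)) => t [h1 h2] pt.
by apply: inner_part_radial; [exact: circle_expi|exact: h2|exact: h1].
Qed.

Lemma outer_function_cexp : outer_function (fun z => cexp (herglotz (fun x => ln (u x)) z)).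
Proof.
have ih := circle_integrable_ln.
have sG : smooth 1 (@disk R) (fun z => cexp (herglotz (fun x => ln (u x)) z)).
  exact/smooth_cexp/smooth_herglotz.
split; first by move=> z Dz; apply: cder_derivable (smooth_cder sG Dz).
split; first by move=> z _; apply/eqP; exact: cexp_neq0.
exists (fun x => ln (u x)); split => // z Dz.
by rewrite normc_cexp expRK Re_herglotz.
Qed.

End Majorization.

(** * Series and products with bounds on derivatives *)

Section SmoothSeries.
Variable R : realType.
Implicit Types (z w a b c : R[i]) (f g : R[i] -> R[i]) (U V : set R[i]) (s t M N : R).

Definition cball c (r : R) : set R[i] := [set w | normc (w - c) < r].

Lemma cball_center c (r : R) : 0 < r -> cball c r c.
Proof. by rewrite /cball /mkset subrr normc0. Qed.

Lemma open_cball c (r : R) : open (cball c r).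
Proof.
apply/openC => z hz; exists (r - normc (z - c)); first by rewrite subr_gt0.
move=> w hw; apply: le_lt_trans (ler_distc w z c) _.
by rewrite -ltrBrDr.
Qed.

Definition segment_closed U := forall a b, U a -> U b ->
  forall s, 0 <= s <= 1 -> U (a + s%:C * (b - a)).

Lemma normc_segment a b c (r : R) s : normc (a - c) < r -> normc (b - c) < r ->
  0 <= s <= 1 -> normc (a + s%:C * (b - a) - c) < r.
Proof.
move=> ha hb /andP[s0 s1].
have -> : a + s%:C * (b - a) - c = (1 - s)%:C * (a - c) + s%:C * (b - c).
  by rewrite real_complexB; ring.
rewrite (le_lt_trans (le_normcD _ _))// !normcM !normc_real !ger0_norm ?subr_ge0//.
have [->|sn0] := eqVneq s 0; first by rewrite subr0 mul1r mul0r addr0.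
have s_gt0 : 0 < s by rewrite lt_neqAle eq_sym sn0.
have h1 : (1 - s) * normc (a - c) <= (1 - s) * r by rewrite ler_wpM2l ?subr_ge0// ltW.
have h2 : s * normc (b - c) < s * r by rewrite ltr_pM2l.
lra.
Qed.

Lemma segment_closed_cball c (r : R) : segment_closed (cball c r).
Proof. by move=> a b ha hb s; exact: normc_segment. Qed.

Lemma segment_closed_disk : segment_closed (@disk R).
Proof.
move=> a b ha hb s hs; have := @normc_segment a b 0 1 s.
by rewrite !subr0; exact.
Qed.

(** One constant bounds the function and its first [n] derivatives, so that one summable sequence
    serves for the Weierstrass test at every order. *)
Fixpoint bsmooth n M U f : Prop := (forall z, U z -> normc (f z) <= M) /\
  if n is m.+1 then exists g, (forall z, U z -> cder f z (g z)) /\ bsmooth m M U g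
  else True.

Lemma bsmooth_bound n M U f : bsmooth n M U f -> forall z, U z -> normc (f z) <= M.
Proof. by case: n => [|n] []. Qed.

Lemma bsmooth_smooth n M U f : bsmooth n M U f -> smooth n U f.
Proof.
by elim: n f => [//|n IH] f [_ [g [fg bg]]]; exists g; split => //; exact: IH.
Qed.

Lemma bsmoothW n M U f : bsmooth n.+1 M U f -> bsmooth n M U f.
Proof.
elim: n f => [|n IH] f [h1 [g [fg bg]]]; split => //.
by exists g; split => //; exact: IH.
Qed.

Lemma bsmooth_le n M N U f : M <= N -> bsmooth n M U f -> bsmooth n N U f.
Proof.
move=> MN; elim: n f => [|n IH] f [h1 h2]; split => //.
- by move=> z /h1 h; exact: le_trans h MN.
- by move=> z /h1 h; exact: le_trans h MN.
by case: h2 => g [fg bg]; exists g; split => //; exact: IH.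
Qed.

Lemma bsmooth_cst n U c : bsmooth n (normc c) U (fun=> c).
Proof.
have H0 m M : 0 <= M -> bsmooth m M U (fun=> 0).
  move=> M0; elim: m => [|m IH]; split => //; try by move=> z _; rewrite normc0.
  by exists (fun=> 0); split => // z _; exact: cder_cst.
case: n => [|n]; split => //; exists (fun=> 0); split; first by move=> z _; exact: cder_cst.
exact/H0/normc_ge0.
Qed.

Lemma bsmoothD n M N U f g : bsmooth n M U f -> bsmooth n N U g ->
  bsmooth n (M + N) U (fun z => f z + g z).
Proof.
elim: n f g => [|n IH] f g [hf df] [hg dg]; split => //.
- by move=> z Uz; rewrite (le_trans (le_normcD _ _))// lerD ?hf ?hg.
- by move=> z Uz; rewrite (le_trans (le_normcD _ _))// lerD ?hf ?hg.
case: df dg => [f' [ff bf]] [g' [gg bg]]; exists (fun z => f' z + g' z); split.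
  by move=> z Uz; apply: cderD; [exact: ff|exact: gg].
exact: IH.
Qed.

(** Each differentiation doubles the number of terms in the product rule, whence the factor
    [2 ^+ n]. *)
Lemma bsmoothM n M N U f g : 0 <= M -> 0 <= N -> bsmooth n M U f -> bsmooth n N U g ->
  bsmooth n (2 ^+ n * (M * N)) U (fun z => f z * g z).
Proof.
move=> M0 N0; elim: n f g => [|n IH] f g bf bg.
  rewrite expr0 mul1r; split => // z Uz.
  by rewrite normcM ler_pM ?normc_ge0// ?(bsmooth_bound bf)// (bsmooth_bound bg).
have [hf [f' [ff bf']]] := bf; have [hg [g' [gg bg']]] := bg.
split.
  move=> z Uz; apply: (@le_trans _ _ (M * N)).
    by rewrite normcM ler_pM ?normc_ge0 ?hf ?hg.
  by rewrite ler_peMl ?mulr_ge0// exprn_ege1// ler1n.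
exists (fun z => f' z * g z + f z * g' z); split.
  by move=> z Uz; apply: cderM; [exact: ff|exact: gg].
rewrite exprS mulrAC -mulrA mulr2n mulrDl mul1r [M * N * _]mulrC.
by apply: bsmoothD; apply: IH => //; exact: bsmoothW.
Qed.

Local Notation psum a := (fun n => \sum_(0 <= k < n) a k).

Lemma psum_le (a : nat -> R[i]) (m : nat -> R) n1 n2 :
  (forall k, normc (a k) <= m k) -> (n1 <= n2)%N ->
  normc (psum a n2 - psum a n1) <= series m n2 - series m n1.
Proof.
move=> am /subnK <-; elim: (n2 - n1)%N => [|n IH]; first by rewrite !subrr normc0.
rewrite addSn /series /= !big_nat_recr//= addrAC [leRHS]addrAC.
by rewrite (le_trans (le_normcD _ _))// lerD.
Qed.

Lemma series_le_lim (m : nat -> R) n : (forall k, 0 <= m k) -> cvgn (series m) ->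
  series m n <= limn (series m).
Proof.
move=> m0 cm; apply: nondecreasing_cvgn_le => //.
by apply: nondecreasing_series => k _ _; exact: m0.
Qed.

Lemma csum_cvg (a : nat -> R[i]) (m : nat -> R) : (forall k, normc (a k) <= m k) ->
  cvgn (series m) -> exists z, psum a @ \oo --> z.
Proof.
move=> am cm.
have m0 k : 0 <= m k by exact: le_trans (normc_ge0 _) (am k).
have RE : cvgn (series (fun k => complex.Re (a k))).
  apply: normed_cvg; apply: series_le_cvg cm => // k; first exact: normr_ge0.
  exact: le_trans (abs_Re_le _) (am k).
have IM : cvgn (series (fun k => complex.Im (a k))).
  apply: normed_cvg; apply: series_le_cvg cm => // k; first exact: normr_ge0.
  exact: le_trans (abs_Im_le _) (am k).
exists (limn (series (fun k => complex.Re (a k))) +i* limn (series (fun k => complex.Im (a k)))).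
apply/cvgnC => e e0; have e2 : 0 < e / 2 by rewrite divr_gt0.
have E n : psum a n = series (fun k => complex.Re (a k)) n +i* series (fun k => complex.Im (a k)) n.
  rewrite /series /=; elim: n => [|n IH]; first by rewrite !big_geq.
  by rewrite !big_nat_recr//= IH; case: (a n).
near=> n; rewrite E (le_lt_trans (normc_le_ReIm _))//= (splitr e) ltrD// distrC.
  near: n; move/cvgrPdist_lt: RE => /(_ _ e2); exact.
near: n; move/cvgrPdist_lt: IM => /(_ _ e2); exact.
Unshelve. all: by end_near. Qed.

Lemma normc_lim_le (u : nat -> R[i]) z (C : R) : u @ \oo --> z ->
  (\forall n \near \oo, normc (u n) <= C) -> normc z <= C.
Proof.
move=> /normc_cvg cu hC; rewrite -(cvg_lim _ cu)//.
by apply: limr_le => //; exact: cvgP cu.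
Qed.

Lemma csum_tail (a : nat -> R[i]) (m : nat -> R) z n : (forall k, normc (a k) <= m k) ->
  cvgn (series m) -> psum a @ \oo --> z ->
  normc (z - psum a n) <= limn (series m) - series m n.
Proof.
move=> am cm ca; have m0 k : 0 <= m k by exact: le_trans (normc_ge0 _) (am k).
apply: (@normc_lim_le (fun k => psum a k - psum a n)).
  by apply: (cvgcD ca); exact: cvg_cst.
exists n => // k /= nk; apply: le_trans (psum_le am nk) _.
by rewrite lerD2r series_le_lim.
Qed.

Lemma csum_fun_cvg U (d : nat -> R[i] -> R[i]) (m : nat -> R) : cvgn (series m) ->
  (forall k z, U z -> normc (d k z) <= m k) ->
  exists f, forall z, U z -> psum (d^~ z) @ \oo --> f z.
Proof.
move=> cm dm; have h z : exists y : R[i], U z -> psum (d^~ z) @ \oo --> y.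
  have [Uz|nU] := pselect (U z); last by exists 0.
  by have [y hy] := csum_cvg (fun k => dm k z Uz) cm; exists y.
by have [f hf] := choice h; exists f.
Qed.

Lemma cder_psum (d dd : nat -> R[i] -> R[i]) z n :
  (forall k, cder (d k) z (dd k z)) ->
  cder (fun w => psum (d^~ w) n) z (psum (dd^~ z) n).
Proof.
move=> H; elim: n => [|n IH].
  rewrite big_geq//; have -> : (fun w => \sum_(0 <= k < 0) d k w) = fun=> 0.
    by apply/funext => w; rewrite big_geq.
  exact: cder_cst.
have -> : (fun w => \sum_(0 <= k < n.+1) d k w) =
  (fun w => \sum_(0 <= k < n) d k w + d n w).
  by apply/funext => w; rewrite big_nat_recr.
by rewrite big_nat_recr//=; exact: cderD.
Qed.

(** The mean value inequality turns the bound [m k] on a derivative into [m k |w - z|] for the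
    increment, so the tails of the difference quotients are uniformly small. This is why segments
    must stay in [U]. *)
Lemma cder_series U (d dd : nat -> R[i] -> R[i]) (s s' : R[i] -> R[i]) (m : nat -> R) :
  open U -> segment_closed U -> cvgn (series m) ->
  (forall k z, U z -> cder (d k) z (dd k z)) ->
  (forall k z, U z -> normc (dd k z) <= m k) ->
  (forall z, U z -> psum (d^~ z) @ \oo --> s z) ->
  (forall z, U z -> psum (dd^~ z) @ \oo --> s' z) ->
  forall z, U z -> cder s z (s' z).
Proof.
move=> oU cU cm dE ddm sE s'E z Uz e e0.
have e3 : 0 < e / 3 by rewrite divr_gt0.
have /cvgrPdist_lt/(_ _ e3)[n _ /(_ n (leqnn n)) hn] := cm.
have hn' : limn (series m) - series m n <= e / 3 by rewrite (le_trans (ler_norm _))// ltW.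
have [r1 r10 H1] := @cder_psum d dd z n (fun k => dE k z Uz) _ e3.
have [r2 r20 H2] := (openC U).1 oU z Uz.
exists (Num.min r1 r2) => [|w]; first by rewrite lt_min r10.
rewrite lt_min => /andP[w1 w2]; have Uw := H2 w w2.
have k1 := H1 w w1.
have m0 k : 0 <= m k by exact: le_trans (normc_ge0 _) (ddm k z Uz).
have wz0 := normc_ge0 (w - z).
have am k : normc (d k w - d k z) <= m k * normc (w - z).
  apply: (@mvt_ineq _ (d k) (dd k)) => t ht; first exact/dE/cU.
  exact/ddm/cU.
have k2 : normc ((s w - s z) - psum (fun k => d k w - d k z) n) <= e / 3 * normc (w - z).
  apply: (@normc_lim_le (fun k => psum (fun k => d k w - d k z) k - psum (fun k => d k w - d k z) n)).
    apply: cvgcD; last exact: cvg_cst.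
    have -> : psum (fun k => d k w - d k z) = (fun k => psum (d^~ w) k + -1 * psum (d^~ z) k).
      by apply/funext => k; rewrite mulN1r -sumrB.
    rewrite (_ : s w - s z = s w + -1 * s z); last by rewrite mulN1r.
    by apply: (cvgcD (sE w Uw)); apply: cvgcM (sE z Uz); exact: cvg_cst.
  exists n => // k /= nk; apply: le_trans (psum_le am nk) _.
  rewrite /series /= -!mulr_suml -mulrBl ler_wpM2r//.
  by apply: le_trans hn'; rewrite lerD2r; exact: (series_le_lim k m0 cm).
have k3 : normc (s' z - psum (dd^~ z) n) <= e / 3.
  by apply: le_trans hn'; apply: csum_tail => //; [move=> k; exact: ddm|exact: s'E].
have -> : s w - s z - s' z * (w - z) =
  (psum (d^~ w) n - psum (d^~ z) n - psum (dd^~ z) n * (w - z)) +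
  (((s w - s z) - psum (fun k => d k w - d k z) n) - (s' z - psum (dd^~ z) n) * (w - z)).
  by rewrite sumrB; ring.
apply: (le_trans (le_normcD _ _)).
have k4 := le_normcB ((s w - s z) - psum (fun k => d k w - d k z) n) ((s' z - psum (dd^~ z) n) * (w - z)).
move: k4; rewrite normcM => k4.
have k5 := ler_wpM2r wz0 k3.
lra.
Qed.

Lemma bsmooth_series n U (d : nat -> R[i] -> R[i]) (m : nat -> R) :
  open U -> segment_closed U -> cvgn (series m) ->
  (forall k, bsmooth n (m k) U (d k)) ->
  exists s : R[i] -> R[i], (forall z, U z -> psum (d^~ z) @ \oo --> s z) /\ smooth n U s.
Proof.
move=> oU cU cm; elim: n d => [|n IH] d bd.
  have [f fE] := csum_fun_cvg cm (fun k z => bsmooth_bound (bd k) (z := z)).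
  by exists f.
have [s sE] := csum_fun_cvg cm (fun k z => bsmooth_bound (bd k) (z := z)).
have h k : exists g, (forall z, U z -> cder (d k) z (g z)) /\ bsmooth n (m k) U g.
  by have [_] := bd k.
have [dd hdd] := choice h.
have [s' [s'E ss']] := IH dd (fun k => (hdd k).2).
exists s; split => //; exists s'; split => // z Uz.
apply: (@cder_series U d dd s s' m) => //.
  by move=> k w Uw; exact: (hdd k).1.
by move=> k w Uw; exact: bsmooth_bound (hdd k).2 _ Uw.
Qed.

(** A product is the series of its increments [P N * (b N - 1)]. The partial products and their
    derivatives are bounded through [1 + x <= exp x] by [exp(D sum m)], where [D = 2 ^+ n.+1] comes
    from [bsmoothM]; the increments are then dominated by a multiple of [m N]. Convergence of the
    first derivatives later gives [B'] at a zero. *)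
Lemma bsmooth_product n U (b : nat -> R[i] -> R[i]) (m : nat -> R) :
  open U -> segment_closed U -> cvgn (series m) -> (forall k, 0 <= m k) ->
  (forall k, bsmooth n.+1 (m k) U (fun z => b k z - 1)) ->
  exists B : R[i] -> R[i], smooth n.+1 U B /\ forall z, U z ->
    (fun N : nat => \prod_(0 <= k < N) b k z) @ \oo --> B z /\
    (fun N : nat => derive1 (fun w => \prod_(0 <= k < N) b k w) z) @ \oo --> derive1 B z.
Proof.
move=> oU cU cm m0 bm.
pose P (N : nat) z := \prod_(0 <= k < N) b k z.
pose S (N : nat) := \sum_(0 <= k < N) m k.
pose D : R := 2 ^+ n.+1.
have D0 : 0 <= D by rewrite exprn_ge0.
have PS (N : nat) z : P N.+1 z = P N z + P N z * (b N z - 1).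
  by rewrite /P big_nat_recr//=; ring.
have bP (N : nat) : bsmooth n.+1 (expR (D * S N)) U (P N).
  elim: N => [|N IH].
    rewrite /S big_geq// mulr0 expR0 -(normc1 R).
    have -> : P 0%N = fun=> 1 by apply/funext => z; rewrite /P big_geq.
    exact: bsmooth_cst.
  have -> : P N.+1 = fun z => P N z + P N z * (b N z - 1) by apply/funext => z; exact: PS.
  apply: (@bsmooth_le _ (expR (D * S N) + D * (expR (D * S N) * m N))).
    rewrite /S big_nat_recr//= mulrDr expRD mulrCA -{1}[expR _]mulr1 -mulrDr.
    by rewrite ler_wpM2l ?expR_ge0// expR_ge1Dx.
  by apply: bsmoothD => //; apply: bsmoothM => //; exact: expR_ge0.
pose K := expR (D * limn (series m)).
have SK (N : nat) : expR (D * S N) <= K.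
  by rewrite ler_expR ler_wpM2l//; exact: (series_le_lim N m0 cm).
pose d (N : nat) z := P N z * (b N z - 1).
have bd (N : nat) : bsmooth n.+1 (D * K * m N) U (d N).
  rewrite -mulrA; apply: bsmoothM => //; first exact: expR_ge0.
  exact: bsmooth_le (SK N) (bP N).
have cDm : cvgn (series (fun N : nat => D * K * m N)) by apply: is_cvg_seriesZ.
have [s [sE ss]] := bsmooth_series oU cU cDm bd.
have PE (N : nat) z : P N z = 1 + psum (d^~ z) N.
  elim: N => [|N IH]; first by rewrite /P !big_geq// addr0.
  by rewrite PS big_nat_recr//= {1}IH addrA.
have sB : smooth n.+1 U (fun z => 1 + s z) by apply: smoothD => //; exact: smooth_cst.
exists (fun z => 1 + s z); split => // z Uz; split.
  under eq_fun do rewrite -/(P _ z) PE.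
  by apply: cvgcD; [exact: cvg_cst|exact: sE].
have h k : exists g, forall w, U w -> cder (d k) w (g w) /\ normc (g w) <= D * K * m k.
  have [_ [g [dg bg]]] := bd k; exists g => w Uw; split; first exact: dg.
  exact: bsmooth_bound bg _ Uw.
have [dd hdd] := choice h.
have [s' s'E] := csum_fun_cvg cDm (fun k w Uw => (hdd k w Uw).2).
have ds : cder s z (s' z).
  apply: (@cder_series U d dd s s' _ oU cU cDm) => //.
    by move=> k w Uw; exact: (hdd k w Uw).1.
  by move=> k w Uw; exact: (hdd k w Uw).2.
have -> : derive1 (fun w => 1 + s w) z = s' z.
  apply: cder_derive1; rewrite -[s' z]add0r; apply: cderD => //; exact: cder_cst.
have -> : (fun N : nat => derive1 (fun w => \prod_(0 <= k < N) b k w) z) = psum (dd^~ z).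
  apply/funext => N; apply: cder_derive1.
  have -> : (fun w => \prod_(0 <= k < N) b k w) = fun w => 1 + psum (d^~ w) N.
    by apply/funext => w; rewrite -PE.
  rewrite -[X in cder _ _ X]add0r; apply: cderD; first exact: cder_cst.
  by apply: cder_psum => k; exact: (hdd k z Uz).1.
exact: s'E.
Qed.

Definition cinv1 a z := (1 - conjc a * z)^-1.

Lemma cder_cinv1 a z : 1 - conjc a * z != 0 ->
  cder (cinv1 a) z (conjc a * (cinv1 a z * cinv1 a z)).
Proof.
move=> n0; have d1 : cder (fun w => 1 - conjc a * w) z (- conjc a).
  have := cderD (cder_cst 1 z) (cderN (cderM (cder_cst (conjc a) z) (cder_id z))).
  by rewrite mul0r add0r mulr1 add0r.
have := cder_comp d1 (cderV n0).
by rewrite mulrNN -expr2 mulrC.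
Qed.

(** The derivative of [cinv1 a] is [conj a] times its square, so bounds propagate by induction. The
    constant does not depend on [a], hence serves all factors of a product at once. *)
Lemma bsmooth_cinv1 n U (e : R) : 0 < e -> exists2 M : R, 0 <= M &
  forall a, normc a <= 1 -> (forall z, U z -> e <= normc (1 - conjc a * z)) ->
    bsmooth n M U (cinv1 a).
Proof.
move=> e0; have H0 a : (forall z, U z -> e <= normc (1 - conjc a * z)) ->
    forall z, U z -> normc (cinv1 a z) <= e^-1.
  move=> h z /h hz; rewrite normcV lef_pV2 ?posrE//; exact: lt_le_trans hz.
elim: n => [|n [M M0 IH]].
  by exists e^-1; [rewrite invr_ge0 ltW|move=> a _ h; split => //; exact: H0].
have c0 : 0 <= 2 ^+ n * (1 * (2 ^+ n * (M * M))) :> R by rewrite !mulr_ge0 ?exprn_ge0.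
exists (e^-1 + 2 ^+ n * (1 * (2 ^+ n * (M * M)))).
  by rewrite addr_ge0// invr_ge0 ltW.
move=> a a1 h; split; first by move=> z Uz; rewrite (le_trans (H0 a h z Uz))// lerDl.
exists (fun z => conjc a * (cinv1 a z * cinv1 a z)); split.
  move=> z Uz; apply: cder_cinv1.
  by rewrite -normc_gt0 (lt_le_trans e0)// h.
apply: (@bsmooth_le _ (2 ^+ n * (1 * (2 ^+ n * (M * M))))).
  by rewrite lerDr invr_ge0 ltW.
apply: bsmoothM => //; first by rewrite !mulr_ge0 ?exprn_ge0.
  by apply: bsmooth_le (bsmooth_cst _ _ _); rewrite normcJ.
by apply: bsmoothM => //; apply: IH.
Qed.

End SmoothSeries.

(** * Blaschke products in the disk and across the circle *)

Section BlaschkeProducts.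
Variable R : realType.
Implicit Types (z w a : R[i]).

Lemma normc_cvgn (u : nat -> R[i]) a : u @ \oo --> a ->
  (fun n => normc (u n)) @ \oo --> normc a.
Proof. exact: normc_cvg. Qed.

Lemma bsmooth_eq n (M : R) (U : set R[i]) (f g : R[i] -> R[i]) : open U -> (forall z, U z -> f z = g z) ->
  bsmooth n M U f -> bsmooth n M U g.
Proof.
move=> oU fg; case: n => [|n] [h1 h2]; split => //.
- by move=> z Uz; rewrite -fg//; exact: h1.
- by move=> z Uz; rewrite -fg//; exact: h1.
case: h2 => f' [ff bf]; exists f'; split => // z Uz; apply: cder_near_eq (ff _ Uz).
by have [r r0 Hr] := (openC U).1 oU z Uz; exists r => // w /Hr /fg.
Qed.

Lemma blaschke_factorE a z : a != 0 ->
  blaschke_factor a z = (normc a)%:C / a * ((a - z) * cinv1 a z).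
Proof. by move=> a0; rewrite /blaschke_factor (negbTE a0). Qed.

Lemma pseudohyperbolicE a z : pseudohyperbolic a z = normc (a - z) * (normc (1 - conjc a * z))^-1.
Proof. by rewrite -normcV -normcM. Qed.

Lemma normc_blaschke_factor a z : a != 0 ->
  normc (blaschke_factor a z) = pseudohyperbolic a z.
Proof.
move=> a0; have n0 : normc a != 0 by rewrite normc_eq0.
rewrite blaschke_factorE// normcM normcM normc_real normcV.
by rewrite ger0_norm ?normc_ge0// mulfV// mul1r.
Qed.

Lemma conjc_normc a : a != 0 -> conjc a = ((normc a) ^+ 2)%:C / a.
Proof.
move=> a0; apply: (mulIf a0); rewrite mulfVK// sqr_normc_ReIm.
by case: a {a0} => x y; apply/eqP; rewrite eq_complex /=; apply/andP; split; apply/eqP; ring.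
Qed.

(** Isolates [1 - |a|], the general term of the Blaschke condition, from an expression whose
    derivatives are bounded away from the pole. *)
Lemma blaschke_factor_sub1 a z : a != 0 -> 1 - conjc a * z != 0 ->
  blaschke_factor a z - 1 =
  ((1 - normc a) / normc a)%:C * (1 + (- (1 + normc a))%:C * cinv1 a z).
Proof.
move=> a0 d0; have n0 : normc a != 0 by rewrite normc_eq0.
have nC0 : (normc a)%:C != 0 by apply/eqP => -[/eqP]; rewrite (negbTE n0).
have nV : (normc a)^-1%:C = ((normc a)%:C)^-1.
  apply: (mulIf nC0); rewrite mulVf// -real_complexM mulVf//.
rewrite blaschke_factorE// /cinv1; move: d0; rewrite conjc_normc// => d0.
have d1 : a - ((normc a) ^+ 2)%:C * z != 0.
  apply: contra d0 => /eqP h; rewrite mulrAC; apply/eqP.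
  by apply: (mulIf a0); rewrite mul0r mulrBl mul1r mulfVK.
move: d0 d1; rewrite !real_complexM nV.
rewrite (_ : (1 - normc a)%:C = 1 - (normc a)%:C) ?real_complexB//.
rewrite (_ : (- (1 + normc a))%:C = - (1 + (normc a)%:C)); last first.
  by rewrite -sub0r real_complexB real_complexD sub0r.
move: (normc a)%:C nC0 => x x0 d0 d1.
by field; rewrite x0 a0 d1.
Qed.

(** The identity behind the Schwarz-Pick estimates: it gives modulus at most [1] in the disk,
    modulus [1] on the circle and, later, the defect in Julia's inequality. *)
Lemma sqr_pseudo_gap a z :
  normc (1 - conjc a * z) ^+ 2 - normc (a - z) ^+ 2 = (1 - normc a ^+ 2) * (1 - normc z ^+ 2).
Proof. by rewrite !sqr_normc_ReIm; case: a z => [x y] [u v] /=; ring. Qed.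

Lemma pseudo_den_ge a z : normc z <= 1 -> 1 - normc a <= normc (1 - conjc a * z).
Proof.
move=> z1; rewrite -(normc1 R); apply: le_trans (ler_normcB _ _).
by rewrite lerD2l lerN2 normcM normcJ ler_piMr ?normc_ge0.
Qed.

Lemma pseudo_den_gt0 a z : disk a -> normc z <= 1 -> 0 < normc (1 - conjc a * z).
Proof. by move=> Da z1; rewrite (lt_le_trans _ (pseudo_den_ge a z1))// subr_gt0. Qed.

Lemma pseudohyperbolic_le1 a z : disk a -> normc z <= 1 -> pseudohyperbolic a z <= 1.
Proof.
move=> Da z1; rewrite pseudohyperbolicE ler_pdivrMr ?pseudo_den_gt0// mul1r.
rewrite -ler_sqr ?nnegrE ?normc_ge0// -subr_ge0 sqr_pseudo_gap.
by rewrite mulr_ge0// subr_ge0 -[leRHS](expr1n _ 2) lerXn2r ?nnegrE ?normc_ge0// ltW.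
Qed.

Lemma pseudohyperbolic_circle a z : disk a -> circle z -> pseudohyperbolic a z = 1.
Proof.
move=> Da z1; have z1' : normc z <= 1 by rewrite z1.
have d0 := pseudo_den_gt0 Da z1'.
have E : normc (a - z) = normc (1 - conjc a * z).
  apply/eqP; rewrite -(@eqrXn2 _ 2)// ?normc_ge0// eq_sym -subr_eq0 sqr_pseudo_gap.
  by rewrite z1 expr1n subrr mulr0.
by rewrite pseudohyperbolicE E mulfV// gt_eqF.
Qed.

Lemma pos_lower_bound (v : nat -> R) (c : R) n : 0 < c -> (forall k, 0 < v k) ->
  (forall k, (n <= k)%N -> c <= v k) -> exists2 m : R, 0 < m & forall k, m <= v k.
Proof.
move=> c0 v0; elim: n c c0 => [|n IH] c c0 H; first by exists c => // k; exact: H.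
apply: (IH (Num.min c (v n))); first by rewrite lt_min c0 v0.
move=> k; rewrite leq_eqVlt => /predU1P[<-|nk]; first by rewrite ge_min lexx orbT.
by rewrite ge_min H.
Qed.

Variable z_ : nat -> R[i].
Hypothesis zB : blaschke_sequence z_.
Hypothesis zn0 : forall n, z_ n != 0.
Hypothesis z1 : z_ @ \oo --> (1 : R[i]).

(** The factors have poles at [1 / conj (z_ k)], which accumulate only at [1]. Uniformity in [k] is
    what locally uniform convergence requires, on the circle as well as inside. *)
Definition pole_free w := exists2 e : R, 0 < e & forall k, e <= normc (1 - conjc (z_ k) * w).

Lemma pole_free_disk w : disk w -> pole_free w.
Proof.
move=> Dw; exists (1 - normc w); first by rewrite subr_gt0.
move=> k; rewrite -(normc1 R); apply: le_trans (ler_normcB _ _).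
rewrite lerD2l lerN2 normcM normcJ ler_piMl ?normc_ge0//.
exact: ltW (zB.1 k).
Qed.

Lemma pole_free_closed w : closed_disk w -> w != 1 -> pole_free w.
Proof.
move=> Dw w1; have d0 : 0 < normc (1 - w) by rewrite normc_gt0 subr_eq0 eq_sym.
have d2 : 0 < normc (1 - w) / 2 by rewrite divr_gt0.
have /cvgnC/(_ _ d2)[n _ Hn] := z1.
apply: (@pos_lower_bound _ (normc (1 - w) / 2) n d2).
  by move=> k; apply: pseudo_den_gt0 => //; exact: zB.1.
move=> k /Hn /= hk.
have -> : 1 - conjc (z_ k) * w = (1 - w) - (conjc (z_ k) - 1) * w by ring.
apply: le_trans (ler_normcB _ _); rewrite normcM.
have -> : normc (conjc (z_ k) - 1) = normc (z_ k - 1).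
  rewrite -[RHS]normcJ; congr normc; case: (z_ k) => x y.
  by apply/eqP; rewrite eq_complex /=; apply/andP; split; apply/eqP; ring.
have : normc (z_ k - 1) * normc w <= normc (z_ k - 1) by rewrite ler_piMr ?normc_ge0.
lra.
Qed.

Local Notation prodB := (fun z (N : nat) => \prod_(0 <= k < N) blaschke_factor (z_ k) z).
Local Notation B := (blaschke_product z_).

(** On the ball of radius [e / 2] all denominators stay above [e / 2], because [|z_ k| <= 1]. The
    factor [1 / |z_ k|] is bounded since the zeros are nonzero and tend to [1]; what remains is a
    constant times the summable [1 - |z_ k|]. *)
Lemma blaschke_local n w : pole_free w -> exists U, [/\ open U, U w, smooth n.+1 U B &
  forall z, U z -> prodB z @ \oo --> B z /\
    (fun N : nat => derive1 (prodB^~ N) z) @ \oo --> derive1 B z].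
Proof.
move=> [e e0 He]; pose U := cball w (e / 2).
have e2 : 0 < e / 2 by rewrite divr_gt0.
have oU : open U by exact: open_cball.
have [al al0 Hal] : exists2 m : R, 0 < m & forall k, m <= normc (z_ k).
  have h2 : 0 < 1 / 2 :> R by rewrite divr_gt0.
  have /cvgnC/(_ _ h2)[m _ Hm] := z1.
  apply: (@pos_lower_bound _ (1 / 2) m h2) => [k|k /Hm /= hk].
    by rewrite normc_gt0.
  have := ler_normcB 1 (z_ k); rewrite normcBC normc1; lra.
have HU k z : U z -> e / 2 <= normc (1 - conjc (z_ k) * z).
  move=> Uz; have -> : 1 - conjc (z_ k) * z = (1 - conjc (z_ k) * w) - conjc (z_ k) * (z - w) by ring.
  apply: le_trans (ler_normcB _ _); rewrite normcM normcJ.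
  have : normc (z_ k) * normc (z - w) <= normc (z - w).
    by rewrite ler_piMl ?normc_ge0//; exact: ltW (zB.1 k).
  by have := He k; move: Uz; rewrite /U /cball /mkset; lra.
have [M M0 HM] := @bsmooth_cinv1 R n.+1 U (e / 2) e2.
pose P : R := 2 ^+ n.+1.
have P0 : 0 <= P by rewrite exprn_ge0.
pose C : R := P * (al^-1 * (1 + P * (2 * M))).
have C0 : 0 <= C by rewrite !mulr_ge0// ?invr_ge0 ?(ltW al0)// addr_ge0// !mulr_ge0.
have nk k : 0 <= 1 - normc (z_ k) by rewrite subr_ge0; exact: ltW (zB.1 k).
have [|||B' [sB' HB']] := @bsmooth_product R n U (fun k => blaschke_factor (z_ k))
  (fun k => C * (1 - normc (z_ k))) oU (@segment_closed_cball R w (e / 2)).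
- by apply: is_cvg_seriesZ; exact: zB.2.
- by move=> k; rewrite mulr_ge0.
- move=> k; apply: (bsmooth_eq oU (f := fun z => ((1 - normc (z_ k)) / normc (z_ k))%:C *
      (1 + (- (1 + normc (z_ k)))%:C * cinv1 (z_ k) z))).
    move=> z Uz; rewrite blaschke_factor_sub1//.
    by rewrite -normc_gt0 (lt_le_trans e2)// HU.
  apply: (@bsmooth_le _ _ (P * (((1 - normc (z_ k)) / al) * (1 + P * (2 * M))))).
    by rewrite /C le_eqVlt; apply/orP; left; apply/eqP; ring.
  apply: bsmoothM.
  + by rewrite divr_ge0// ltW.
  + by rewrite addr_ge0// !mulr_ge0.
  + apply: bsmooth_le (bsmooth_cst _ _ _); rewrite normc_real ger0_norm ?divr_ge0 ?normc_ge0//.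
    by rewrite ler_wpM2l// lef_pV2 ?posrE// normc_gt0.
  + apply: bsmoothD; first by rewrite -{1}(normc1 R); exact: bsmooth_cst.
    apply: bsmoothM => //.
      apply: bsmooth_le (bsmooth_cst _ _ _); rewrite normc_real normrN ger0_norm ?addr_ge0 ?normc_ge0//.
      by have := nk k; lra.
    apply: HM; first exact: ltW (zB.1 k).
    exact: HU.
have BE z : U z -> B' z = B z.
  move=> Uz; have cv := (HB' z Uz).1.
  by rewrite /blaschke_product (limnC cv).
exists U; split; [exact: oU|exact: cball_center|exact: smooth_eq oU BE sB'|].
move=> z Uz; have [c1 c2] := HB' z Uz; split; first by rewrite -BE.
suff -> : derive1 B z = derive1 B' z by [].
apply: cder_derive1; apply: cder_near_eq (smooth_cder sB' Uz).
by have [r r0 Hr] := (openC U).1 oU z Uz; exists r => // x /Hr /BE.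
Qed.

Lemma blaschke_smooth n : smooth n pole_free B.
Proof.
apply: smoothW; apply: smooth_local => z /(blaschke_local n)[U [oU Uz sU _]].
by exists U.
Qed.

Lemma blaschke_cvg z : pole_free z -> prodB z @ \oo --> B z.
Proof. by move=> /(blaschke_local 0)[U [_ Uz _ /(_ z Uz)[]]]. Qed.

Lemma prodB_D1 n (N : nat) z : (n < N)%N -> prodB z N = blaschke_factor (z_ n) z *
  \prod_(0 <= k < N | k != n) blaschke_factor (z_ k) z.
Proof. by move=> nN /=; rewrite (bigD1_seq n) ?iota_uniq// mem_index_iota. Qed.

Lemma normc_prodB (P : pred nat) (N : nat) z :
  normc (\prod_(0 <= k < N | P k) blaschke_factor (z_ k) z) =
  \prod_(0 <= k < N | P k) pseudohyperbolic (z_ k) z.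
Proof.
rewrite (big_morph _ (@normcM R) (@normc1 R)).
by apply: eq_bigr => k _; rewrite normc_blaschke_factor.
Qed.

Lemma pseudohyperbolic_ge0 a z : 0 <= pseudohyperbolic a z.
Proof. exact: normc_ge0. Qed.

Lemma prod_pseudo_le1 (P : pred nat) (N : nat) z : normc z <= 1 ->
  \prod_(0 <= k < N | P k) pseudohyperbolic (z_ k) z <= 1.
Proof.
move=> hz; apply: prodr_ile1 => k _.
by rewrite pseudohyperbolic_ge0 pseudohyperbolic_le1//; exact: zB.1.
Qed.

(** All factors but one are dropped. The result is the bound at a single zero that Julia's
    inequality starts from. *)
Lemma blaschke_le n z : disk z -> normc (B z) <= pseudohyperbolic (z_ n) z.
Proof.
move=> Dz; apply: normc_lim_le (blaschke_cvg (pole_free_disk Dz)) _.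
exists n.+1 => // N /= nN; rewrite (prodB_D1 z nN) normcM normc_blaschke_factor// normc_prodB.
by rewrite ler_piMr ?pseudohyperbolic_ge0// prod_pseudo_le1// ltW.
Qed.

Lemma blaschke_le1 z : disk z -> normc (B z) <= 1.
Proof.
move=> Dz; apply: le_trans (blaschke_le 0 Dz) _.
by rewrite pseudohyperbolic_le1// ?ltW//; exact: zB.1.
Qed.

Lemma blaschke_circle zeta : circle zeta -> zeta != 1 -> normc (B zeta) = 1.
Proof.
move=> hz h1; have pf : pole_free zeta by apply: pole_free_closed; rewrite // /closed_disk /mkset hz.
have := normc_cvgn (blaschke_cvg pf).
have -> : (fun N => normc (prodB zeta N)) = fun=> 1.
  apply/funext => N; rewrite normc_prodB big1// => k _.
  by rewrite pseudohyperbolic_circle//; exact: zB.1.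
by move=> cv; rewrite -(cvg_lim _ cv)// lim_cst.
Qed.

Lemma cder_blaschke_factor a z : a != 0 -> 1 - conjc a * z != 0 ->
  cder (blaschke_factor a) z ((normc a)%:C / a *
    (- cinv1 a z + (a - z) * (conjc a * (cinv1 a z * cinv1 a z)))).
Proof.
move=> a0 d0; set c := (normc a)%:C / a.
have d1 : cder (fun w => a - w) z (- 1).
  by have := cderD (cder_cst a z) (cderN (cder_id z)); rewrite add0r.
have := cderM (cder_cst c z) (cderM d1 (cder_cinv1 d0)); rewrite mul0r add0r mulN1r.
by apply: cder_near_eq; exists 1 => // w _; rewrite blaschke_factorE.
Qed.

(** Existence is enough: at the zero of the omitted factor, the derivative of the cofactor gets
    multiplied by [0]. *)
Lemma cder_prod (P : pred nat) (N : nat) z : pole_free z -> exists d,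
  cder (fun w => \prod_(0 <= k < N | P k) blaschke_factor (z_ k) w) z d.
Proof.
move=> [e e0 He]; elim: N => [|N [d IH]].
  exists 0; have -> : (fun w => \prod_(0 <= k < 0 | P k) blaschke_factor (z_ k) w) = fun=> 1.
    by apply/funext => w; rewrite big_geq.
  exact: cder_cst.
have -> : (fun w => \prod_(0 <= k < N.+1 | P k) blaschke_factor (z_ k) w) =
  fun w => \prod_(0 <= k < N | P k) blaschke_factor (z_ k) w *
           (if P N then blaschke_factor (z_ N) w else 1).
  by apply/funext => w; rewrite big_mkcond big_nat_recr//= -big_mkcond.
have d0 : 1 - conjc (z_ N) * z != 0 by rewrite -normc_gt0 (lt_le_trans e0).
case: (P N); last by eexists; exact: cderM IH (cder_cst 1 z).
by eexists; exact: cderM IH (cder_blaschke_factor (zn0 N) d0).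
Qed.

Lemma blaschke_zero n : B (z_ n) = 0.
Proof.
apply/eqP; rewrite -normc_eq0 eq_le normc_ge0 andbT.
by apply: le_trans (blaschke_le n (zB.1 n)) _; rewrite pseudohyperbolicE subrr normc0 mul0r.
Qed.

(** In the product rule at [z_ n] only the term with the differentiated [n]th factor survives. That
    derivative has modulus [1 / (1 - |z_ n|^2)], and the other factors form the product defining the
    separation. *)
Lemma blaschke_derive_zero_cvg n :
  (fun N : nat => \prod_(0 <= k < N | k != n) pseudohyperbolic (z_ k) (z_ n)) @ \oo -->
    normc (derive1 B (z_ n)) * (1 - normc (z_ n) ^+ 2).
Proof.
set a := z_ n; have Da : disk a by exact: zB.1.
have pa : pole_free a by exact: pole_free_disk.
have d1 : 0 < 1 - normc a ^+ 2.
  by rewrite subr_gt0 -[ltRHS](expr1n _ 2) ltrXn2r ?nnegrE ?normc_ge0.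
have dE : 1 - conjc a * a = (1 - normc a ^+ 2)%:C.
  rewrite sqr_normc_ReIm; case: (a) => x y; apply/eqP; rewrite eq_complex /=.
  by apply/andP; split; apply/eqP; ring.
have d0 : 1 - conjc a * a != 0 by rewrite -normc_gt0 pseudo_den_gt0// ltW.
have [U [_ Ua _ /(_ a Ua)[_ /normc_cvgn cv]]] := blaschke_local 0 pa.
have E (N : nat) : (n < N)%N -> normc (derive1 (prodB^~ N) a) =
    (1 - normc a ^+ 2)^-1 * \prod_(0 <= k < N | k != n) pseudohyperbolic (z_ k) a.
  move=> nN; have [d hd] := cder_prod (fun k => k != n) N pa.
  have := cderM (cder_blaschke_factor (zn0 n) d0) hd.
  have -> : (fun w => blaschke_factor (z_ n) w *
      \prod_(0 <= k < N | k != n) blaschke_factor (z_ k) w) = prodB^~ N.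
    by apply/funext => w; rewrite (prodB_D1 w nN).
  move=> /cder_derive1 ->; rewrite -/a blaschke_factorE ?zn0// subrr !mul0r mulr0 mul0r !addr0.
  rewrite normcM normc_prodB; congr (_ * _).
  have n0 : normc a != 0 by rewrite normc_eq0 zn0.
  rewrite normcM normcM normc_real normcV ger0_norm ?normc_ge0// mulfV// mul1r normcN.
  by rewrite /cinv1 normcV dE normc_real gtr0_norm.
have cvc : (fun _ : nat => 1 - normc a ^+ 2) @ \oo --> 1 - normc a ^+ 2 by exact: cvg_cst.
have h : (fun N => normc (derive1 (prodB^~ N) a) * (1 - normc a ^+ 2)) @ \oo -->
    normc (derive1 B a) * (1 - normc a ^+ 2) by exact: (cvgM cv cvc).
move: h; apply: cvg_trans; apply: near_eq_cvg.
exists n.+1 => // N /= nN; rewrite /= E// mulrAC mulVf ?mul1r//.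
by rewrite gt_eqF.
Qed.

Lemma blaschke_derive_zero n :
  normc (derive1 B (z_ n)) * (1 - normc (z_ n) ^+ 2) = separation z_ n.
Proof. by rewrite /separation (cvg_lim _ (@blaschke_derive_zero_cvg n)). Qed.

Lemma separation_le1 n : separation z_ n <= 1.
Proof.
have cv := @blaschke_derive_zero_cvg n.
rewrite -blaschke_derive_zero -(cvg_lim _ cv)//.
apply: limr_le; first exact: cvgP cv.
by apply: nearW => N; apply: prod_pseudo_le1; exact: ltW (zB.1 n).
Qed.

End BlaschkeProducts.

(** * Outer functions, extension to the closed disk and the logarithm of the kernel *)

Section OuterAndKernels.
Variable R : realType.
Implicit Types (z w a b zeta : R[i]) (s t : R).
Local Notation per := (@period R).

(** If [d] were nonzero, a step in the direction [g z / d] would increase the modulus to first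
    order. *)
Lemma cder_normc1 (g : R[i] -> R[i]) z d (r : R) : 0 < r ->
  (forall w, normc (w - z) < r -> normc (g w) = 1) -> cder g z d -> d = 0.
Proof.
move=> r0 g1 dg; apply/eqP; apply: contrapT => /negP d0.
have nd : 0 < normc d by rewrite normc_gt0.
have [s s0 Hs] := dg (normc d / 2) (divr_gt0 nd (ltr0Sn _ 1)).
have gz : normc (g z) = 1 by rewrite g1// subrr normc0.
(* Chosen so that [|w - z|] is half the smaller radius: the first-order gain in modulus is [t] and
   the error at most [t / 2]. *)
pose t := Num.min r s * normc d / 2.
have m0 : 0 < Num.min r s by rewrite lt_min r0.
have t0 : 0 < t by rewrite divr_gt0// mulr_gt0.
pose w := z + t%:C * (g z / d).
have wz : w - z = t%:C * (g z / d) by rewrite /w addrC addKr.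
have nw : normc (w - z) = Num.min r s / 2.
  rewrite wz normcM normcM normcV normc_real gtr0_norm// gz mul1r /t.
  by field; rewrite gt_eqF.
have lt_wm : normc (w - z) < Num.min r s by rewrite nw ltr_pdivrMr// mulr_natr mulr2n ltrDl.
move: lt_wm; rewrite lt_min => /andP[wr ws].
have := Hs w ws; rewrite nw.
have -> : g w - g z - d * (w - z) = g w - (1 + t)%:C * g z.
  by rewrite wz real_complexD; field.
move=> H; have := ler_normcB ((1 + t)%:C * g z) (g w).
rewrite normcBC normcM normc_real gz mulr1 g1// gtr0_norm ?addr_gt0//.
move/le_trans => /(_ _ H); rewrite /t; nra.
Qed.

(** The quotient of [F] by its Herglotz exponential has modulus one, hence derivative zero, hence is
    constant. Thus [F] is a constant times [exp H], which has derivatives of every order. *)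
Lemma outer_smooth n (F : R[i] -> R[i]) : outer_function F -> smooth n (@disk R) F.
Proof.
move=> [hF [F0 [k [ik Fk]]]]; pose H := herglotz k.
pose G z := cexp (-1 * H z).
have sG m : smooth m (@disk R) G.
  apply: smooth_cexp; apply: smoothM; first exact: smooth_cst.
  exact: smooth_herglotz.
have GE z : G z * cexp (H z) = 1 by rewrite /G -cexpD mulN1r addNr cexp0.
have FG1 z : disk z -> normc (F z * G z) = 1.
  move=> Dz; rewrite normcM normc_cexp.
  have -> : complex.Re (-1 * H z) = - poisson_integral k z.
    by rewrite -Re_herglotz// /H; case: (herglotz k z) => x y /=; ring.
  rewrite -Fk// expRN lnK ?mulfV ?normc_eq0 ?posrE ?normc_gt0//; exact/eqP/F0.
have dFG z : disk z -> cder (fun w => F w * G w) z 0.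
  move=> Dz; have h := cderM (derivable_cder (hF z Dz)) (smooth_cder (sG 1%N) Dz).
  have [r r0 Hr] := (openC _).1 (@open_disk R) z Dz.
  have e0 := cder_normc1 r0 (fun w hw => FG1 w (Hr w hw)) h.
  by move: h; rewrite e0.
pose c := F 0 * G 0.
have D0 : disk (0 : R[i]) by rewrite diskE normc0.
have cE z : disk z -> F z * G z = c.
  move=> Dz; apply: (@cder0_cst _ (fun w => F w * G w) (@disk R)) => //.
  by move=> s; exact: segment_closed_disk.
apply: (@smooth_eq _ _ _ (fun z => c * cexp (H z))).
- exact: open_disk.
- by move=> z Dz; rewrite -(cE z Dz) -mulrA GE mulr1.
- apply: smoothM; first exact: smooth_cst.
  exact/smooth_cexp/smooth_herglotz.
Qed.

Lemma radial_point zeta s : closed_disk zeta -> 0 <= s < 1 ->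
  disk (s%:C * zeta) /\ normc (s%:C * zeta - zeta) <= 1 - s.
Proof.
rewrite /closed_disk /mkset => h /andP[s0 s1]; rewrite diskE; split.
  rewrite normcM normc_real ger0_norm//; apply: le_lt_trans s1.
  by rewrite ler_piMr.
have -> : s%:C * zeta - zeta = - ((1 - s)%:C * zeta) by rewrite real_complexB; ring.
rewrite normcN normcM normc_real ger0_norm ?subr_ge0 ?(ltW s1)//.
by rewrite ler_piMr// subr_ge0 ltW.
Qed.

(* Along [(1 - 2^-n) zeta] the increments of [F] are summable. *)
Lemma lipschitz_extension (F : R[i] -> R[i]) (M : R) : 0 <= M ->
  (forall z w, disk z -> disk w -> normc (F z - F w) <= M * normc (z - w)) ->
  exists Fe : R[i] -> R[i],
    forall zeta z, closed_disk zeta -> disk z -> normc (F z - Fe zeta) <= M * normc (z - zeta).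
Proof.
move=> M0 LF.
suff h zeta : exists y, closed_disk zeta -> forall z, disk z -> normc (F z - y) <= M * normc (z - zeta).
  by have [Fe hFe] := choice h; exists Fe => zeta z hz; exact: hFe.
have [hz|nz] := pselect (closed_disk zeta); last by exists 0.
pose p n : R := 1 - 2^-1 ^+ n.
have half0 n : 0 < 2^-1 ^+ n :> R by rewrite exprn_gt0// invr_gt0.
have half1 n : 2^-1 ^+ n <= 1 :> R by rewrite exprn_ile1// invf_le1// ler1n.
have p01 n : 0 <= p n < 1 by rewrite /p subr_ge0 half1 ltrBlDr ltrDl half0.
pose d n := F ((p n.+1)%:C * zeta) - F ((p n)%:C * zeta).
have dM n : normc (d n) <= M * 2^-1 ^+ n.
  have [Dn _] := radial_point hz (p01 n); have [Dn1 _] := radial_point hz (p01 n.+1).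
  apply: le_trans (LF _ _ Dn1 Dn) _; rewrite ler_wpM2l// -mulrBl -real_complexB.
  have -> : p n.+1 - p n = 2^-1 ^+ n / 2 by rewrite /p exprS; field.
  rewrite normcM normc_real ger0_norm ?divr_ge0 ?(ltW (half0 n))//.
  have h1 : normc zeta <= 1 by [].
  have := half0 n; have := normc_ge0 zeta; nra.
have cM : cvgn (series (fun n => M * 2^-1 ^+ n)).
  have h : `|2^-1| < 1 :> R; last exact: (@is_cvg_geometric_series R M 2^-1 h).
  by rewrite ger0_norm ?invr_ge0// invf_lt1// ltr1n.
have [y hy] := csum_cvg dM cM.
exists (y + F 0) => _ z Dz.
have E n : \sum_(0 <= k < n) d k = F ((p n)%:C * zeta) - F 0.
  elim: n => [|n IH]; first by rewrite big_geq// /p expr0 subrr mul0r subrr.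
  by rewrite big_nat_recr//= IH /d; ring.
apply/ler_addgt0Pr => e e0.
have cp : (fun n => M * 2^-1 ^+ n) @ \oo --> 0 by apply: cvg_series_cvg_0.
have /cvgrPdist_le/(_ _ e0)[N _ HN] := cp.
have -> : F z - (y + F 0) = (F z - F 0) + -1 * y by ring.
apply: (@normc_lim_le _ (fun n => (F z - F 0) + -1 * \sum_(0 <= k < n) d k)).
  by apply: cvgcD; [exact: cvg_cst|apply: cvgcM hy; exact: cvg_cst].
exists N => // n /= /HN; rewrite sub0r normrN ger0_norm; last by rewrite mulr_ge0// ltW.
move=> hn; rewrite E.
have -> : F z - F 0 + -1 * (F ((p n)%:C * zeta) - F 0) = F z - F ((p n)%:C * zeta) by ring.
have [Dn hpn] := radial_point hz (p01 n).
apply: le_trans (LF _ _ Dz Dn) _.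
have := ler_distc z zeta ((p n)%:C * zeta); rewrite [normc (zeta - _)]normcBC => h2.
have h3 : 1 - p n = 2^-1 ^+ n by rewrite /p; ring.
move: hpn; rewrite h3 => hpn.
have := ler_wpM2l M0 (le_trans h2 (lerD (lexx _) hpn)); rewrite mulrDr; lra.
Qed.

Lemma smooth_cinv1 n a : disk a -> smooth n (@disk R) (cinv1 a).
Proof.
move=> Da; have e0 : 0 < 1 - normc a by rewrite subr_gt0.
have [M _ HM] := @bsmooth_cinv1 R n (@disk R) _ e0.
apply: (@bsmooth_smooth _ n M); apply: HM; first exact: ltW.
by move=> z Dz; apply: pseudo_den_ge; exact: ltW.
Qed.

Lemma normc_den_circle a zeta : circle zeta -> normc (1 - conjc a * zeta) = normc (zeta - a).
Proof.
move=> hz; have hz2 : normc zeta ^+ 2 = 1 by rewrite hz expr1n.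
apply/eqP; rewrite -(@eqrXn2 _ 2)// ?normc_ge0// -subr_eq0 [normc (zeta - a)]normcBC.
by rewrite sqr_pseudo_gap hz2 subrr mulr0.
Qed.

Lemma poisson_kernel_circle a zeta : circle zeta ->
  poisson_kernel a zeta = (1 - normc a ^+ 2) * normc (cinv1 a zeta) ^+ 2.
Proof.
by move=> hz; rewrite /poisson_kernel -normc_den_circle// /cinv1 normcV exprVn.
Qed.

Lemma circle_integrable_log_kernel a : disk a ->
  circle_integrable (fun x => ln (poisson_kernel a x)).
Proof.
move=> Da.
have c : continuous (fun t => ln (poisson_kernel a (expi t))).
  move=> t; have cp : (fun s => poisson_kernel a (expi s)) @ t --> poisson_kernel a (expi t).
    exact: continuous_poisson_kernel.
  by apply: (cvg_comp _ _ cp); apply: continuous_ln; exact: poisson_kernel_gt0.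
apply: continuous_compact_integrable; first exact: segment_compact.
exact: continuous_subspaceT.
Qed.

(* Equality holds, since [log P_a] is the boundary function of
   [log |(1 - |a|^2) / (1 - conj a z)^2|]. *)
Lemma poisson_log_kernel a : disk a ->
  (1 - normc a ^+ 2)^-1 <= expR (poisson_integral (fun x => ln (poisson_kernel a x)) a).
Proof.
move=> Da; have e0 : 0 < 1 - normc a by rewrite subr_gt0.
have d1 : 0 < 1 - normc a ^+ 2.
  by rewrite subr_gt0 -[ltRHS](expr1n _ 2) ltrXn2r ?nnegrE ?normc_ge0.
have ik := circle_integrable_log_kernel Da.
pose g z := (1 - normc a ^+ 2)%:C * (cinv1 a z * cinv1 a z).
have gE z : normc (g z) = (1 - normc a ^+ 2) * normc (cinv1 a z) ^+ 2.
  by rewrite /g normcM normcM normc_real gtr0_norm// expr2.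
have -> : (1 - normc a ^+ 2)^-1 = normc (g a).
  rewrite gE /cinv1 normcV.
  have -> : 1 - conjc a * a = (1 - normc a ^+ 2)%:C.
    rewrite sqr_normc_ReIm; case: (a) => x y; apply/eqP; rewrite eq_complex /=.
    by apply/andP; split; apply/eqP; ring.
  by rewrite normc_real gtr0_norm//; field; rewrite gt_eqF.
apply: poisson_majorant => //.
  apply: smoothM; first exact: smooth_cst.
  by apply: smoothM; exact: smooth_cinv1.
move=> zeta hz e ee.
have den0 z : normc z <= 1 -> 1 - conjc a * z != 0.
  by move=> z1; rewrite -normc_gt0; exact: pseudo_den_gt0.
have g0 z : normc z <= 1 -> 0 < normc (g z).
  move=> /den0 h; rewrite gE mulr_gt0// exprn_gt0// normc_gt0 /cinv1 invr_neq0//.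
have hz1 : normc zeta <= 1 by rewrite hz.
have cg : (fun z => ln (normc (g z))) @ zeta --> ln (normc (g zeta)).
  have dc := cder_cinv1 (den0 zeta hz1).
  have dg := cderM (cder_cst (1 - normc a ^+ 2)%:C zeta) (cderM dc dc).
  have cng : (fun z => normc (g z)) @ zeta --> normc (g zeta).
    by apply: (@normc_cvg _ _ _ (nbhs_filter zeta)); exact: cder_cvg dg.
  by apply: (cvg_comp _ _ cng); apply: continuous_ln; exact: g0.
have e3 : 0 < e / 3 by rewrite divr_gt0.
move/(@cvgrPdist_lt _ _ _ _ (nbhs_filter zeta)): cg => /(_ _ e3) /nbhsC[r r0 Hr].
have [|r2 r20 H2] := @poisson_liminf _ _ zeta (ln (normc (g zeta)) - e / 3) _ ik hz r0 _ _ e3.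
  move=> t _ /Hr; rewrite ltr_distl => /andP[_ h].
  rewrite poisson_kernel_circle ?normc_expi -?gE; last exact: normc_expi.
  by lra.
exists (Num.min r r2) => [|z Dz]; first by rewrite lt_min r0.
rewrite lt_min => /andP[/Hr + /(H2 z Dz) h2]; rewrite ltr_distl => /andP[h _].
rewrite -(lnK (g0 z (ltW Dz))) ler_expR; lra.
Qed.

(** On the lower half of the circle [sin t <= 0], and the position of [z] in the upper half plane
    decides. On the remaining upper part, points beyond [t0] are at distance at least
    [|1 - expi t0| >= 2 |1 - z|] from [1]. *)
Lemma dist_off_arc (t0 : R) z t : 0 < t0 -> t0 <= pi -> 0 < complex.Im z -> 0 <= complex.Re z ->
  normc (1 - z) <= normc (1 - expi t0) / 2 -> t0 < t <= pi *+ 2 ->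
  normc (1 - z) <= normc (expi t - z).
Proof.
move=> t00 t0pi Iz Rz hz /andP[tt0 t2].
have sq (w : R[i]) s : normc (expi s - w) ^+ 2 =
    1 + normc w ^+ 2 - 2 * (complex.Re w * cos s + complex.Im w * sin s).
  rewrite !sqr_normc_ReIm; case: w => x y /=.
  transitivity ((cos s ^+ 2 + sin s ^+ 2) + (x ^+ 2 + y ^+ 2) - 2 * (x * cos s + y * sin s)).
    by ring.
  by rewrite cos2Dsin2.
have e0 : (1 : R[i]) = expi 0 by rewrite /expi cos0 sin0.
have [tp|tp] := leP pi t.
  rewrite -ler_sqr ?nnegrE ?normc_ge0// e0 !sq cos0 sin0 mulr0 addr0 mulr1.
  have s0 : sin t <= 0.
    have := @sin_ge0_pi R (t - pi); rewrite subr_ge0 tp /= lerBlDr -mulr2n => /(_ t2).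
    by rewrite sinB cospi sinpi mulr0 subr0 mulrN1 oppr_ge0.
  have c1 := cos_le1 t.
  have := ler_wpM2l Rz c1; have : complex.Im z * sin t <= 0 by rewrite mulr_ge0_le0// ltW.
  lra.
have ct : cos t <= cos t0.
  by apply: ltW; rewrite ltr_cos ?in_itv //=; rewrite ?(ltW t00) ?t0pi ?(ltW tp)// ltW// (lt_trans t00).
have far : normc (1 - expi t0) <= normc (1 - expi t).
  rewrite -ler_sqr ?nnegrE ?normc_ge0// !(normcBC 1) -[1]/(1%:C) !sq !normc_real.
  by rewrite /= !mul0r !mul1r; lra.
have := ler_distc 1 z (expi t); rewrite [normc (z - _)]normcBC => tri.
by lra.
Qed.

End OuterAndKernels.

(** * Continuity up to the circle and Julia's inequality *)

Section BoundaryBehaviour.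
Variable R : realType.
Implicit Types (z w a b zeta : R[i]) (s t : R) (f g : R[i] -> R[i]).

Lemma within_cvgC (A : set R[i]) f zeta y :
  f @ within A (nbhs zeta) --> y <-> forall e : R, 0 < e -> exists2 r : R, 0 < r &
    forall z, A z -> normc (z - zeta) < r -> normc (f z - y) < e.
Proof.
split.
  move=> /cvgC H e e0; have /nbhsC[r r0 Hr] := H e e0.
  by exists r => // z Az zr; exact: Hr.
move=> H; apply/cvgC => e /H[r r0 Hr]; apply/nbhsC; exists r => // z zr Az.
exact: Hr.
Qed.

Lemma cder_within (A : set R[i]) f zeta d : cder f zeta d -> f @ within A (nbhs zeta) --> f zeta.
Proof.
move=> /cder_continuous H; apply/within_cvgC => e /H[r r0 Hr]; exists r => // z _.
exact: Hr.
Qed.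

Lemma disk_algebra_bound g : {within @closed_disk R, continuous g} ->
  exists2 M : R, 0 <= M & forall z, closed_disk z -> normc (g z) <= M.
Proof.
move=> cg; have [|||z0 K0 H] := compact_EVT_max (f := fun z => normc (g z)) (A := @closed_disk R).
- by exists 0; rewrite /closed_disk /mkset normc0.
- exact: compact_closed_disk.
- apply/subspace_continuousP => z Az.
  by apply: normc_cvg; move/subspace_continuousP: cg => /(_ z Az).
by exists (normc (g z0)) => [|z cz]; [exact: normc_ge0|apply: H; rewrite inE].
Qed.

Lemma HinftyD f g : Hinfty f -> Hinfty g -> Hinfty (fun z => f z + g z).
Proof.
move=> [hf [M HM]] [hg [N HN]]; split.
  move=> z Dz; exact: cder_derivable (cderD (derivable_cder (hf z Dz)) (derivable_cder (hg z Dz))).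
by exists (M + N) => z Dz; rewrite (le_trans (le_normcD _ _))// lerD ?HM ?HN.
Qed.

Lemma HinftyM f g : Hinfty f -> Hinfty g -> Hinfty (fun z => f z * g z).
Proof.
move=> [hf [M HM]] [hg [N HN]]; split.
  move=> z Dz; exact: cder_derivable (cderM (derivable_cder (hf z Dz)) (derivable_cder (hg z Dz))).
by exists (M * N) => z Dz; rewrite normcM ler_pM ?normc_ge0 ?HM ?HN.
Qed.

Lemma Hinfty_norm_ub f z : Hinfty f -> disk z -> normc (f z) <= Hinfty_norm f.
Proof.
move=> [_ [M HM]] Dz; apply: ub_le_sup; last by exists z.
by exists M => _ [w Dw <-]; exact: HM.
Qed.

(** The point [z] is replaced by a radial interior point within [x] of it, at a cost of at most
    [2 M x]. *)
Lemma lipschitz_closed (F Fe : R[i] -> R[i]) (M : R) : 0 <= M ->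
  (forall zeta z, closed_disk zeta -> disk z -> normc (F z - Fe zeta) <= M * normc (z - zeta)) ->
  forall z zeta, closed_disk z -> closed_disk zeta -> normc (Fe z - Fe zeta) <= M * normc (z - zeta).
Proof.
move=> M0 H z zeta cz czeta; apply/ler_addgt0Pr => e e0.
have M2 : 0 < 2 * M + 1 by rewrite ltr_wpDl// mulr_ge0.
pose x := Num.min 1 (e / (2 * M + 1)).
have x0 : 0 < x by rewrite lt_min ltr01 divr_gt0.
have x1 : x <= 1 by rewrite ge_min lexx.
have hs : 0 <= 1 - x < 1 by rewrite subr_ge0 x1 ltrBlDr ltrDl.
have [Dw hw] := radial_point cz hs; set w := _ * z in Dw hw.
have xe : x * (2 * M + 1) <= e by rewrite -ler_pdivlMr// ge_min lexx orbT.
have := ler_distc (Fe z) (F w) (Fe zeta); rewrite [normc (Fe z - F w)]normcBC.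
have h1 := H _ _ cz Dw; have h2 := H _ _ czeta Dw.
have h3 := ler_distc w z zeta.
have hx : normc (w - z) <= x by move: hw; lra.
have h4 := ler_wpM2l M0 h3; have h5 := ler_wpM2l M0 hx.
by move: h4 h5 xe x0 h1 h2; rewrite !mulrDr; lra.
Qed.

Lemma quadratic_limit (A D d x0 : R) : 0 <= A -> 0 <= D -> 0 <= d -> 0 < x0 ->
  (forall x, 0 < x < x0 -> A * (2 - x) <= 2 * D * (d + x) ^+ 2) -> A <= D * d ^+ 2.
Proof.
move=> A0 D0 d0 x00 H; rewrite leNgt; apply/negP => lt.
pose eta := A - D * d ^+ 2; have eta0 : 0 < eta by rewrite subr_gt0.
(* Expanding the hypothesis at [x <= 1] gives [2 eta <= x S], against the choice [x S <= eta]. *)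
pose S := A + 4 * D * d + 2 * D + 1.
have S0 : 0 < S by rewrite ltr_wpDl// !addr_ge0// !mulr_ge0.
pose x := Num.min (x0 / 2) (Num.min 1 (eta / S)).
have xp : 0 < x by rewrite !lt_min ltr01 !divr_gt0.
have xx0 : x < x0.
  by rewrite /x gt_min ltr_pdivrMr// mulr_natr mulr2n ltrDl x00.
have x1 : x <= 1 by rewrite !ge_min lexx orbT.
have xS : x * S <= eta by rewrite -ler_pdivlMr// !ge_min lexx !orbT.
have := H x; rewrite xp xx0 => /(_ isT) h.
have Dx : D * x * x <= D * x by rewrite ler_piMr// mulr_ge0// ltW.
move: h xS; rewrite /S /eta expr2; lra.
Qed.

(* Julia's inequality for a function vanishing at [a]: the Schwarz-Pick bound
   [1 - |f| >= 1 - rho(a, .)] is divided by the distance to the boundary point. *)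
Lemma julia_bound (f f1 : R[i] -> R[i]) a zeta y (C : R) : circle zeta -> disk a ->
  (forall z, disk z -> cder f z (f1 z)) ->
  (forall z, disk z -> normc (f z) <= pseudohyperbolic a z) -> normc y = 1 ->
  (forall e : R, 0 < e -> exists2 r : R, 0 < r &
     forall z, disk z -> normc (z - zeta) < r -> normc (f z - y) < e) ->
  (forall e : R, 0 < e -> exists2 r : R, 0 < r &
     forall z, disk z -> normc (z - zeta) < r -> normc (f1 z) <= C + e) ->
  poisson_kernel a zeta <= C.
Proof.
move=> hz Da df fa y1 fy f1C.
have cz : closed_disk zeta by rewrite /closed_disk /mkset hz.
pose A := 1 - normc a ^+ 2.
have A0 : 0 < A by rewrite subr_gt0 -[ltRHS](expr1n _ 2) ltrXn2r ?nnegrE ?normc_ge0.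
pose d := normc (1 - conjc a * zeta).
have d0 : 0 < d by apply: pseudo_den_gt0.
have -> : poisson_kernel a zeta = A / d ^+ 2 by rewrite /d normc_den_circle.
apply/ler_addgt0Pr => e e0; rewrite ler_pdivrMr ?exprn_gt0//.
have [r r0 Hr] := f1C e e0; set D := C + e in Hr *.
have pt x : 0 < x < Num.min r 1 -> disk ((1 - x)%:C * zeta) /\
    normc ((1 - x)%:C * zeta - zeta) <= x.
  move=> /andP[x0]; rewrite lt_min => /andP[xr x1].
  have hs : 0 <= 1 - x < 1 by rewrite subr_ge0 (ltW x1) ltrBlDr ltrDl.
  by have [h1 h2] := radial_point cz hs; split => //; move: h2; lra.
(* The bound [D] on the derivative near [zeta] is integrated from [w] to a second radial point [w'],
   so close to [zeta] that [|f w'|] is within [e'] of [1]. *)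
have key x : 0 < x < Num.min r 1 -> 1 - normc (f ((1 - x)%:C * zeta)) <= D * x.
  move=> hx; have [Dw hw] := pt x hx; set w := _ * zeta in Dw hw *.
  have /andP[x0] := hx; rewrite lt_min => /andP[xr x1].
  apply/ler_addgt0Pr => e' e'0; have [r' r'0 Hr'] := fy e' e'0.
  pose x' := Num.min x (r' / 2).
  have x'0 : 0 < x' by rewrite lt_min x0 divr_gt0.
  have x'x : x' <= x by rewrite ge_min lexx.
  have x'r : x' < r' by rewrite gt_min ltr_pdivrMr// mulr_natr mulr2n ltrDl r'0 orbT.
  have hx' : 0 < x' < Num.min r 1 by rewrite x'0 (le_lt_trans x'x)//; case/andP: hx.
  have [Dw' hw'] := pt x' hx'; set w' := _ * zeta in Dw' hw'.
  have k1 := Hr' w' Dw' (le_lt_trans hw' x'r).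
  have k2 : normc (f w' - f w) <= D * normc (w' - w).
    apply: (@mvt_ineq _ f f1) => s hs; first by apply: df; exact: segment_closed_disk.
    apply: Hr; first exact: segment_closed_disk.
    apply: normc_segment => //; first exact: le_lt_trans hw xr.
    by apply: le_lt_trans hw' _; exact: le_lt_trans x'x xr.
  have ww : normc (w' - w) <= x.
    have -> : w' - w = (x - x')%:C * zeta by rewrite /w' /w !real_complexB; ring.
    by rewrite normcM hz mulr1 normc_real ger0_norm ?subr_ge0//; move: x'0; lra.
  have D0 : 0 <= D by apply: le_trans (normc_ge0 _) (Hr w Dw (le_lt_trans hw xr)).
  have k3 := ler_wpM2l D0 ww.
  have k4 := ler_normcB y (f w'); move: k4; rewrite normcBC y1 => k4.
  have k5 := ler_normcB (f w') (f w).
  lra.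
have D0 : 0 <= D.
  have h0 : 0 < Num.min r 1 by rewrite lt_min r0 ltr01.
  have hx : 0 < Num.min r 1 / 2 < Num.min r 1.
    by rewrite divr_gt0//= ltr_pdivrMr// mulr_natr mulr2n ltrDl.
  have [Dw hw] := pt _ hx; have /andP[_] := hx; rewrite lt_min => /andP[xr _].
  by apply: le_trans (normc_ge0 _) (Hr _ Dw (le_lt_trans hw xr)).
apply: (@quadratic_limit A D d (Num.min r 1)) => //; try exact: ltW.
  by rewrite lt_min r0 ltr01.
move=> x hx; have [Dw hw] := pt x hx; have := key x hx.
set w := _ * zeta in Dw hw * => k.
have /andP[x0] := hx; rewrite lt_min => /andP[_ x1].
have wn : normc w = 1 - x.
  by rewrite /w normcM normc_real hz mulr1 gtr0_norm// subr_gt0.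
have := sqr_pseudo_gap a w; rewrite wn -/A.
pose dw := normc (1 - conjc a * w); pose nw := normc (a - w).
rewrite -/dw -/nw => gap.
have dw0 : 0 < dw by apply: pseudo_den_gt0 => //; exact: ltW.
have nd : nw <= dw.
  have := pseudohyperbolic_le1 Da (ltW Dw).
  by rewrite pseudohyperbolicE ler_pdivrMr ?mul1r.
have n0 : 0 <= nw by exact: normc_ge0.
have k2 : dw - nw <= D * x * dw.
  have : 1 - nw / dw <= D * x.
    apply: le_trans k; rewrite lerD2l lerN2.
    by have := fa w Dw; rewrite pseudohyperbolicE.
  move=> /(ler_wpM2r (ltW dw0)); rewrite mulrBl mul1r mulfVK// gt_eqF//.
have dwd : dw <= d + x.
  have -> : dw = normc ((1 - conjc a * zeta) - conjc a * (w - zeta)).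
    by rewrite /dw; congr normc; ring.
  apply: le_trans (le_normcB _ _) _; rewrite lerD2l normcM normcJ.
  apply: le_trans hw; rewrite ler_piMl ?normc_ge0//; exact: ltW.
(* By the gap identity the left side is [A (2 - x) x], since [|w| = 1 - x]. Dividing by [x] and
   using [dw <= d + x] gives the hypothesis of [quadratic_limit]. *)
have g2 : (dw - nw) * (dw + nw) <= (D * x * dw) * (2 * dw).
  by apply: ler_pM => //; rewrite ?subr_ge0 ?addr_ge0 ?(ltW dw0)//; lra.
have g3 : A * (2 - x) <= 2 * D * dw ^+ 2.
  rewrite -(ler_pM2r x0).
  have -> : A * (2 - x) * x = (dw - nw) * (dw + nw) by move: gap; rewrite !expr2; lra.
  by apply: le_trans g2 _; rewrite expr2; lra.
apply: le_trans g3 _; rewrite ler_wpM2l ?mulr_ge0// lerXn2r ?nnegrE ?(ltW dw0)//.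
by rewrite addr_ge0 ?ltW.
Qed.

Lemma poisson_kernel_far a b c : disk a -> a != b -> normc (b - a) <= normc (c - a) ->
  poisson_kernel a c <= poisson_kernel a b.
Proof.
move=> Da ab h; have b0 : 0 < normc (b - a) by rewrite normc_gt0 subr_eq0 eq_sym.
rewrite /poisson_kernel ler_wpM2l//.
  rewrite subr_ge0 -[leRHS](expr1n _ 2) lerXn2r ?nnegrE ?normc_ge0//; exact: ltW.
rewrite lef_pV2 ?posrE ?exprn_gt0 ?(lt_le_trans b0)//.
by rewrite lerXn2r ?nnegrE ?normc_ge0.
Qed.

(** The empty set is an admissible exceptional set, so the spectrum is empty. *)
Lemma boundary_spectrum_constant (J : R[i] -> R[i]) : constant_on_disk J ->
  ~ boundary_spectrum J 1.
Proof.
move=> [c Jc] /(_ set0) H; suff : @set0 R[i] 1 by [].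
apply: H; split; first exact: closed0.
split; first by move=> z [].
move=> zeta _; exists setT, (fun=> c); split; first exact: openT.
split => //; split; last by move=> z _ Dz; rewrite Jc.
by move=> z _; exact: cder_derivable (cder_cst c z).
Qed.

End BoundaryBehaviour.

(** * Lower bound for the outer factor and regular boundary points *)

Section InnerFactor.
Variable R : realType.
Implicit Types (z w a b zeta : R[i]) (s t : R).
Local Notation per := (@period R).

(** Compared with [ln P_a], the density [ln u] loses nothing where [P_a <= u]. Where
    [P_a <= k <= 1], the logarithm of [P_a] is nonpositive and the weight [P_a] is itself at most
    [k], so the loss is at most [k |ln u|]. *)
Lemma poisson_log_lower (u : R[i] -> R) a (k : R) : circle_integrable (fun x => ln (u x)) ->
  disk a -> 0 <= k <= 1 ->
  (forall t, per t -> poisson_kernel a (expi t) <= u (expi t) \/ poisson_kernel a (expi t) <= k) ->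
  expR (- (k * circle_integral (fun x => `|ln (u x)|))) / (1 - normc a ^+ 2) <=
  expR (poisson_integral (fun x => ln (u x)) a).
Proof.
move=> ih Da /andP[k0 k1] H; pose h x := ln (u x); pose l x := ln (poisson_kernel a x).
have il : circle_integrable l by exact: circle_integrable_log_kernel.
have iA : per_integrable (fun t => `|h (expi t)|) by apply: per_integrable_abs.
have ihl : circle_integrable (fun x => h x + - l x).
  by apply: circle_integrableD => //; exact: circle_integrableN.
have kp t : 0 < poisson_kernel a (expi t) by exact: poisson_kernel_gt0.
have key : - (k * circle_integral (fun x => `|h x|)) <=
    poisson_integral (fun x => h x + - l x) a.
  rewrite /poisson_integral /circle_integral mulrCA -mulrN ler_pM2l ?invr_gt0 ?pi2_gt0//.
  rewrite -mulNr -[X in X <= _](per_integralZ (- k) iA).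
  apply: (per_integral_le (per_integrableZ (- k) iA) (per_integrable_poisson ihl Da)) => t pt.
  have n0 := normr_ge0 (h (expi t)).
  have [le|le] := H t pt.
    apply: (@le_trans _ _ 0); first by rewrite mulNr oppr_le0 mulr_ge0.
    by rewrite mulr_ge0 ?(ltW (kp t))// subr_ge0 ler_ln ?posrE// (lt_le_trans _ le).
  have l0 : l (expi t) <= 0 by apply: ln_le0; exact: le_trans le k1.
  have hn : - `|h (expi t)| <= h (expi t) by rewrite lerNl -normrN ler_norm.
  apply: (@le_trans _ _ (poisson_kernel a (expi t) * - `|h (expi t)|)).
    by rewrite mulrN mulNr lerN2 ler_wpM2r.
  by rewrite ler_wpM2l ?(ltW (kp t))//; lra.
move: key; rewrite (poissonD ih (circle_integrableN il) Da) (poissonN il Da) lerBrDr => key.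
apply: (@le_trans _ _ (expR (- (k * circle_integral (fun x => `|h x|)) + poisson_integral l a))).
  by rewrite expRD ler_wpM2l ?expR_ge0//; exact: poisson_log_kernel.
by rewrite ler_expR.
Qed.

(** A point outside the spectrum avoids some admissible closed set, so [J] has a continuation [g] at
    [1]. The radial limits give [|g| = 1] at arc points near [1], and continuity carries this to
    [1]; an arc on one side is enough. *)
Lemma regular_point_modulus (J : R[i] -> R[i]) (t0 : R) (a : nat -> R[i]) : 0 < t0 -> t0 <= pi ->
  (forall zeta, circle_arc t0 zeta -> zeta != 1 ->
     normc (J (r%:C * zeta)) @[r --> (1 : R)^'-] --> (1 : R)) ->
  ~ boundary_spectrum J 1 -> (forall n, disk (a n)) -> a @ \oo --> (1 : R[i]) ->
  (fun n => normc (J (a n))) @ \oo --> (1 : R).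
Proof.
move=> t00 t0pi radJ nspec Da a1.
have [E [[cE Ecirc ext] nE]] : exists E : set R[i], [/\ closed E, E `<=` @circle R &
    extends_analytically_across J (@circle R `\` E)] /\ ~ E 1.
  apply: contrapT => H; apply: nspec => E [cE [Ec ext]].
  by apply: contrapT => nE; apply: H; exists E.
have [|U [g [oU [U1 [hg gJ]]]]] := ext 1; first by split=> //; exact: normc1.
have cg z : U z -> (fun w => normc (g w)) @ z --> normc (g z).
  move=> Uz; apply: (@normc_cvg _ _ _ (nbhs_filter z)).
  exact: cder_cvg (derivable_cder (hg z Uz)).
have g1 : normc (g 1) = 1.
  apply/eqP; rewrite -subr_eq0 -normr_eq0 eq_le normr_ge0 andbT.
  apply/ler_addgt0Pr => e e0; rewrite add0r.
  have e1 : (1 : R[i]) = expi 0 by rewrite /expi cos0 sin0.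
  move/(@cvgrPdist_lt _ _ _ _ (nbhs_filter (1 : R[i]))): (cg 1 U1) => /(_ _ e0) /nbhsC[r r0 Hr].
  have [s s0 Hs] := (openC U).1 oU 1 U1.
  have rs0 : 0 < Num.min r s by rewrite lt_min r0.
  have /cvgC/(_ _ rs0) := @continuous_expi R 0.
  move=> /nbhs_ballP[d /= d0 Hd].
  pose t := Num.min t0 (d / 2).
  have t_gt0 : 0 < t by rewrite lt_min t00 divr_gt0.
  have tt0 : t <= t0 by rewrite ge_min lexx.
  have td : t < d by rewrite gt_min ltr_pdivrMr// mulr_natr mulr2n ltrDl d0 orbT.
  have hb : ball 0 d t by rewrite -ball_normE /= sub0r normrN gtr0_norm.
  have : normc (expi t - expi 0) < Num.min r s by exact: Hd.
  rewrite -e1 lt_min => /andP[/Hr hr /Hs Ut].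
  suff -> : (1 : R) = normc (g (expi t)) by rewrite ltW.
  have arc : circle_arc t0 (expi t) by exists t => //=; rewrite in_itv /= (ltW t_gt0).
  have t1 : expi t != 1 :> R[i].
    apply: expi_neq1; rewrite t_gt0 (le_lt_trans (le_trans tt0 t0pi))//.
    by rewrite mulr2n ltrDl pi_gt0.
  have cr := radJ _ arc t1.
  have cg1 : normc (J (x%:C * expi t)) @[x --> (1 : R)^'-] --> normc (g (expi t)).
    apply/cvgrPdist_lt => e' e'0.
    move/(@cvgrPdist_lt _ _ _ _ (nbhs_filter (expi t : R[i]))): (cg _ Ut) => /(_ _ e'0) /nbhsC[r' r'0 Hr'].
    have [s' s'0 Hs'] := (openC U).1 oU _ Ut.
    near=> x.
    have x1 : x < 1 by near: x; exact: nbhs_left_lt.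
    have x0 : 0 < x by near: x; apply: nbhs_left_gt; exact: ltr01.
    have xr : 1 - Num.min r' s' < x.
      by near: x; apply: nbhs_left_gt; rewrite ltrBlDr ltrDl lt_min r'0.
    have x01 : 0 <= x < 1 by rewrite x1 ltW.
    have [Dx hx] := radial_point (circle_closed (circle_expi t)) x01.
    have : normc (x%:C * expi t - expi t) < Num.min r' s' by move: hx xr; lra.
    by rewrite lt_min => /andP[h1 h2]; rewrite -gJ//; [exact: Hr'|exact: Hs'].
  by rewrite -(cvg_lim _ cr)// -(cvg_lim _ cg1).
have [s s0 Hs] := (openC U).1 oU 1 U1.
have /cvgnC/(_ _ s0)[N _ HN] := a1.
rewrite -g1; apply/cvgrPdist_lt => e e0.
move/(@cvgrPdist_lt _ _ _ _ (nbhs_filter (1 : R[i]))): (cg 1 U1) => /(_ _ e0) /nbhsC[r r0 Hr].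
have /cvgnC/(_ _ r0)[N' _ HN'] := a1.
exists (maxn N N') => // n /=; rewrite geq_max => /andP[n1 n2].
by rewrite -gJ//; [apply: Hr; exact: HN'|apply: Hs; exact: HN].
Unshelve. all: by end_near. Qed.

End InnerFactor.

Theorem theorem1p4 (R : realType) (t0 : R) (F : R[i] -> R[i])
    (z_ : nat -> R[i])
    (t0_gt0 : 0 < t0) (t0_le_pi : t0 <= pi)
    (F_Hinfty : Hinfty F) (F_outer : outer_function F)
    (F_norm : Hinfty_norm F = 1)
    (dF_disk_algebra : disk_algebra (derive1 F))
    (F_unimodular : forall zeta, circle_arc t0 zeta ->
       exists w, radial_limit F zeta w /\ normc w = 1)
    (z_thick : thick z_)
    (z_upper : forall n, 0 < complex.Im (z_ n))
    (z_cvg : z_ @ \oo --> (1 : R[i]))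
    (z_sum : cvgn (series (fun n =>
       (1 - normc (z_ n) ^+ 2) / normc (1 - z_ n) ^+ 2)))
    (dB_smirnov : smirnov (derive1 (blaschke_product z_))) :
  let f := blaschke_product z_ \* F in
  smirnov (derive1 f) /\
  exists J : R[i] -> R[i],
    inner_factor (derive1 f) J /\ ~ constant_on_disk J /\ boundary_spectrum J 1.
Proof.
have [zB nthin] := z_thick.
have zn0 n : z_ n != 0.
  by apply/eqP => h; have := z_upper n; rewrite h /= ltxx.
pose B := blaschke_product z_.
have sB n : smooth n (@disk R) B.
  apply: smooth_sub (blaschke_smooth zB zn0 z_cvg n).
  by move=> z; exact: pole_free_disk.
have sF n : smooth n (@disk R) F by exact: outer_smooth.
move=> f.
have sf n : smooth n (@disk R) f by exact: smoothM.
have sf' : smooth 2 (@disk R) (derive1 f).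
  by apply: smooth_derive1 (sf 3%N); exact: open_disk.
have df z : disk z -> derive1 f z = derive1 B z * F z + B z * derive1 F z.
  move=> Dz; apply: cder_derive1.
  exact: (cderM (smooth_cder (sB 1%N) Dz) (smooth_cder (sF 1%N) Dz)).
have B1 z : disk z -> normc (B z) <= 1 by exact: blaschke_le1.
have F1 z : disk z -> normc (F z) <= 1 by rewrite -F_norm; exact: Hinfty_norm_ub.
have [hF' [G [cG GF]]] := dF_disk_algebra.
have [M M0 HM] := disk_algebra_bound cG.
have HB : Hinfty B.
  by split; [move=> z Dz; exact: cder_derivable (smooth_cder (sB 1%N) Dz)|exists 1].
have HF' : Hinfty (derive1 F).
  by split => //; exists M => z Dz; rewrite -GF//; exact: HM (ltW Dz).
have [v0 [v [Hv0 [Hv [ov dBv]]]]] := dB_smirnov.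
(* The denominator [v] of [B'] also serves for [f' = B' F + B F'], because [B F'] is bounded. *)
pose U z := v0 z * F z + v z * (B z * derive1 F z).
have HU : Hinfty U by exact: (HinftyD (HinftyM Hv0 F_Hinfty) (HinftyM Hv (HinftyM HB HF'))).
have fU z : disk z -> derive1 f z = U z / v z.
  move=> Dz; have v_neq0 : v z != 0 by apply/eqP; exact: ov.2.1.
  by rewrite df// dBv// /U; field.
split; first by exists U, v.
(* As [F'] is bounded, [F] is Lipschitz and extends to the closed disk with the same constant. *)
have LF z w : disk z -> disk w -> normc (F z - F w) <= M * normc (z - w).
  move=> Dz Dw; apply: (@mvt_ineq _ F (derive1 F)) => s hs.
    by apply: smooth_cder (sF 1%N) _; exact: segment_closed_disk.
  have Ds : disk (w + s%:C * (z - w)) by exact: segment_closed_disk.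
  by rewrite -GF//; exact: HM (ltW Ds).
have [Fe hFe] := lipschitz_extension M0 LF.
have FeF z : disk z -> Fe z = F z.
  move=> Dz; apply/eqP; rewrite eq_sym -subr_eq0 -normc_eq0 eq_le normc_ge0 andbT.
  by have := hFe z z (ltW Dz) Dz; rewrite subrr normc0 mulr0.
have LFe := lipschitz_closed M0 hFe.
(* The version of [f'] on the closed disk. [B] and its derivative need no extension: the product
   itself is differentiable across the circle off [1]. *)
pose Phi z := derive1 B z * Fe z + B z * G z.
have dPhi z : disk z -> derive1 f z = Phi z by move=> Dz; rewrite df// /Phi FeF// GF.
have FeW zeta : closed_disk zeta -> Fe @ within (@closed_disk R) (nbhs zeta) --> Fe zeta.
  move=> cz; apply/within_cvgC => e e0.
  have M1 : 0 < M + 1 by rewrite ltr_wpDl.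
  exists (e / (M + 1)); first by rewrite divr_gt0.
  move=> z Dz; rewrite ltr_pdivlMr// => h.
  apply: le_lt_trans (LFe z zeta Dz cz) _.
  by have := normc_ge0 (z - zeta); lra.
have BW zeta : circle zeta -> zeta != 1 -> B @ within (@closed_disk R) (nbhs zeta) --> B zeta /\
    derive1 B @ within (@closed_disk R) (nbhs zeta) --> derive1 B zeta.
  move=> hz z1; have pf := pole_free_closed zB z_cvg (circle_closed hz) z1.
  have [V [oV Vz sV _]] := blaschke_local zB zn0 z_cvg 1 pf.
  split; first exact: cder_within (smooth_cder sV Vz).
  exact: cder_within (smooth_cder (smooth_derive1 oV sV) Vz).
have PhiW zeta : circle zeta -> zeta != 1 ->
    Phi @ within (@closed_disk R) (nbhs zeta) --> Phi zeta.
  move=> hz z1; have cz := circle_closed hz; have [B0 B'0] := BW zeta hz z1.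
  have GW : G @ within (@closed_disk R) (nbhs zeta) --> G zeta.
    by move/subspace_continuousP: cG => /(_ zeta cz).
  exact: (cvgcD (cvgcM B'0 (FeW zeta cz)) (cvgcM B0 GW)).
pose u (z : R[i]) : R := if z == 1 then 0 else normc (Phi z).
have one_notin_disk (z : R[i]) : disk z -> z != 1.
  by move=> Dz; apply: contraTneq Dz => ->; rewrite /disk /mkset normc1 ltxx.
have ug z : disk z -> u z = normc (derive1 f z).
  by move=> Dz; rewrite /u (negbTE (one_notin_disk z Dz)) dPhi.
have u0 z : 0 <= u z by rewrite /u; case: ifP => // _; exact: normc_ge0.
have u1 : u 1 = 0 by rewrite /u eqxx.
have uE zeta : zeta != 1 -> u zeta = normc (Phi zeta) by move=> h; rewrite /u (negbTE h).
have uc zeta : circle zeta -> zeta != 1 -> forall e : R, 0 < e ->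
    exists2 r : R, 0 < r &
    forall z, closed_disk z -> normc (z - zeta) < r -> `|u z - u zeta| < e.
  move=> hz z1 e e0; have /within_cvgC/(_ e e0)[r r0 Hr] := PhiW zeta hz z1.
  have n0 : 0 < normc (zeta - 1) by rewrite normc_gt0 subr_eq0.
  exists (Num.min r (normc (zeta - 1))) => [|z cz]; first by rewrite lt_min r0.
  rewrite lt_min => /andP[zr zz].
  have zn1 : z != 1 by apply: contraTneq zz => ->; rewrite normcBC ltxx.
  by rewrite !uE//; apply: le_lt_trans (ler_abs_normcB _ _) _; exact: Hr.
have [_ [v_neq0 [h [ih vh]]]] := ov.
have [_ [N HN]] := HU.
(* Raising the bound to at least [1] makes [c], and with [|h|] the whole density [k], nonnegative,
   as the truncation argument requires. *)
pose c : R := ln (Num.max N 1).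
have c0 : 0 <= c by rewrite ln_ge0// le_max lexx orbT.
pose k x : R := c + `|h x|.
have k0 x : 0 <= k x by rewrite addr_ge0.
have ik : circle_integrable k.
  by apply: circle_integrableD; [exact: per_integrable_cst|exact: per_integrable_abs].
have gk z : disk z -> normc (derive1 f z) <= expR (poisson_integral k z).
  move=> Dz; have vp : 0 < normc (v z) by rewrite normc_gt0; apply/eqP; exact: v_neq0.
  have ich : circle_integrable (fun x => c + - h x).
    by apply: circle_integrableD; [exact: per_integrable_cst|exact: circle_integrableN].
  apply: (@le_trans _ _ (expR (poisson_integral (fun x => c + - h x) z))).
    rewrite (poissonD (per_integrable_cst c) (circle_integrableN ih) Dz) poisson_cst// poissonN//.
    rewrite -vh// expRD expRN !lnK ?posrE// ?lt_max ?ltr01 ?orbT//.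
    rewrite fU// normcM normcV ler_wpM2r ?invr_ge0 ?(ltW vp)// le_max HN//.
  rewrite ler_expR; apply: poisson_le => // t _.
  by rewrite lerD2l -normrN ler_norm.
(* The extension agrees with the radial limits of [F], so the assumption on the arc becomes a
   statement about [Fe]. *)
have Fe1 zeta : circle_arc t0 zeta -> normc (Fe zeta) = 1.
  move=> arc; have [w [rl w1]] := F_unimodular zeta arc.
  have cz : closed_disk zeta by have [t _ <-] := arc; exact/circle_closed/circle_expi.
  suff -> : Fe zeta = w by [].
  apply: cvgc_cst_eq rl; apply/cvgC => e e0.
  have M1 : 0 < M + 1 by rewrite ltr_wpDl.
  near=> x.
  have x1 : x < 1 by near: x; exact: nbhs_left_lt.
  have x0 : 0 < x by near: x; apply: nbhs_left_gt; exact: ltr01.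
  have xr : 1 - e / (M + 1) < x.
    by near: x; apply: nbhs_left_gt; rewrite ltrBlDr ltrDl divr_gt0.
  have x01 : 0 <= x < 1 by rewrite x1 ltW.
  have [Dx hx] := radial_point cz x01.
  apply: le_lt_trans (hFe zeta _ cz Dx) _.
  have h1 := ler_wpM2l M0 hx.
  have h2 : (1 - x) * (M + 1) < e by rewrite -ltr_pdivlMr//; lra.
  lra.
(* The function fed to Julia's inequality is [f] itself: [|F| <= 1] preserves the bound by the
   factor at [z_ n], and the boundary value [B Fe] is unimodular on the arc. *)
have julia zeta n : circle_arc t0 zeta -> zeta != 1 ->
    poisson_kernel (z_ n) zeta <= u zeta.
  move=> arc z1; have hz : circle zeta by have [t _ <-] := arc; exact: circle_expi.
  rewrite uE//; apply: (@julia_bound _ f Phi (z_ n) zeta (B zeta * Fe zeta)) => //.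
  - exact: zB.1.
  - by move=> z Dz; rewrite -dPhi//; exact: smooth_cder (sf 1%N) Dz.
  - move=> z Dz; rewrite normcM -[leRHS]mulr1 ler_pM ?normc_ge0 ?F1//.
    exact: blaschke_le.
  - by rewrite normcM Fe1// mulr1; exact: blaschke_circle.
  - move=> e e0.
    have H : (fun z => B z * Fe z) @ within (@closed_disk R) (nbhs zeta) --> B zeta * Fe zeta.
      exact: (cvgcM (BW zeta hz z1).1 (FeW zeta (circle_closed hz))).
    have /within_cvgC/(_ e e0)[r r0 Hr] := H.
    exists r => // z Dz zr; rewrite /f /= -FeF//; exact: Hr (ltW Dz) zr.
  - move=> e e0; have /within_cvgC/(_ e e0)[r r0 Hr] := PhiW zeta hz z1.
    exists r => // z Dz zr; have := Hr z (ltW Dz) zr.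
    by have := ler_normcB (Phi z) (Phi zeta); lra.
have t02 : 0 < t0 < pi *+ 2.
  by rewrite t0_gt0 (le_lt_trans t0_le_pi)// mulr2n ltrDl pi_gt0.
have arct0 : circle_arc t0 (expi t0) by exists t0 => //=; rewrite in_itv /= lexx ltW.
have arc_gt0 zeta : circle_arc t0 zeta -> zeta != 1 -> 0 < u zeta.
  move=> arc z1; apply: lt_le_trans (julia zeta 0%N arc z1).
  by have [t _ <-] := arc; apply: poisson_kernel_gt0; exact: zB.1.
(* Julia's inequality makes [u] positive at the end of the arc; continuity spreads this to a nearby
   interior point, so [f'] is not identically zero. *)
have [z0 Dz0 gz0] : exists2 z0, disk z0 & derive1 f z0 != 0.
  have e1 := expi_neq1 t02; have up := arc_gt0 _ arct0 e1.
  have [r r0 Hr] := uc _ (circle_expi t0) e1 _ up.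
  pose x := Num.min 1 (r / 2).
  have x0 : 0 < x by rewrite lt_min ltr01 divr_gt0.
  have xr : x < r by rewrite gt_min ltr_pdivrMr// mulr_natr mulr2n ltrDl r0 orbT.
  have hs : 0 <= 1 - x < 1 by rewrite subr_ge0 ge_min lexx ltrBlDr ltrDl.
  have [Dw hw] := radial_point (circle_closed (circle_expi t0)) hs.
  exists ((1 - x)%:C * expi t0) => //; rewrite -normc_gt0 -ug//.
  have := Hr _ (ltW Dw); rewrite ltr_distl subrr.
  have hr : normc ((1 - x)%:C * expi t0 - expi t0) < r by move: hw; lra.
  by move=> /(_ hr) /andP[].
pose J := inner_part (derive1 f) u.
have ilu := circle_integrable_ln sf' ug u0 u1 uc ik k0 gk Dz0 gz0.
have radJ zeta : circle_arc t0 zeta -> zeta != 1 ->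
     normc (J (r%:C * zeta)) @[r --> (1 : R)^'-] --> (1 : R).
  move=> arc z1; have hz : circle zeta by have [t _ <-] := arc; exact: circle_expi.
  exact: (inner_part_radial sf' ug u0 u1 uc ik k0 gk Dz0 gz0 hz z1 (arc_gt0 _ arc z1)).
suff spec : boundary_spectrum J 1.
  exists J; split.
    split; first exact: (inner_function_inner_part sf' ug u0 u1 uc ik k0 gk Dz0 gz0).
    exists (fun z => cexp (herglotz (fun x => ln (u x)) z)); split.
      exact: (outer_function_cexp sf' ug u0 u1 uc ik k0 gk Dz0 gz0).
    by move=> z _; exact: inner_part_eq.
  by split => // /boundary_spectrum_constant; exact.
apply: contrapT => nspec; apply: nthin; split => //.
have cJ := regular_point_modulus t0_gt0 t0_le_pi radJ nspec zB.1 z_cvg.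
(* Exactly the general term of the convergent series [z_sum]. *)
pose kap n := poisson_kernel (z_ n) 1.
have ckap : kap @ \oo --> 0 by exact: cvg_series_cvg_0 z_sum.
pose A := circle_integral (fun x => `|ln (u x)|).
have bound : \forall n \near \oo, normc (J (z_ n)) * expR (- (kap n * A)) <= separation z_ n.
  have half : 0 < 1 / 2 :> R by rewrite divr_gt0.
  have d0 : 0 < normc (1 - expi t0 : R[i]) / 2.
    by rewrite divr_gt0// normc_gt0 subr_eq0 eq_sym expi_neq1.
  near=> n; have Da := zB.1 n.
  have kap1 : kap n <= 1.
    apply: le_trans (ler_norm _) _; near: n.
    move/cvgrPdist_le: ckap => /(_ _ ltr01); apply: filterS => n.
    by rewrite sub0r normrN.
  have kap0 : 0 <= kap n by exact: poisson_kernel_ge0.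
  have Rz : 0 <= complex.Re (z_ n).
    have : normc (z_ n - 1) < 1 / 2 by near: n; move/cvgnC: z_cvg => /(_ _ half).
    move=> /(le_lt_trans (abs_Re_le _)); rewrite ltr_norml => /andP[+ _].
    by case: (z_ n) => x y /=; lra.
  have nz : normc (1 - z_ n) <= normc (1 - expi t0 : R[i]) / 2.
    by rewrite normcBC ltW//; near: n; move/cvgnC: z_cvg => /(_ _ d0).
  have H t : period t -> poisson_kernel (z_ n) (expi t) <= u (expi t) \/
      poisson_kernel (z_ n) (expi t) <= kap n.
    rewrite /period /= in_itv /= => /andP[t_ge0 t_le].
    (* The point [1] lies on the arc, but [u 1] is set to [0]; it goes into the second alternative,
       with equality. *)
    have [e1|e1] := eqVneq (expi t : R[i]) 1; first by right; rewrite e1.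
    have [tt0|tt0] := leP t t0.
      by left; apply: julia => //; exists t => //=; rewrite in_itv /= t_ge0.
    right; apply: poisson_kernel_far => //; first exact: one_notin_disk.
    by apply: (dist_off_arc t0_gt0) => //; rewrite tt0.
  have k01 : 0 <= kap n <= 1 by rewrite kap0.
  have low := poisson_log_lower ilu Da k01 H.
  have d1 : 0 < 1 - normc (z_ n) ^+ 2.
    by rewrite subr_gt0 -[ltRHS](expr1n _ 2) ltrXn2r ?nnegrE ?normc_ge0.
  (* At the zero [z_ n] only [B' F] remains of [f']. With [|F| <= 1] and the lower bound on the
     outer factor, [|J|] is compared with [|B'| (1 - |z_ n|^2)], which is the separation. *)
  rewrite -(blaschke_derive_zero zB zn0 z_cvg) -/B.
  rewrite /J (normc_inner_part _ _ Da) df//.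
  have -> : B (z_ n) = 0 by exact: blaschke_zero.
  rewrite mul0r addr0 normcM.
  move: low; rewrite ler_pdivrMr// -/A => low.
  set P := poisson_integral _ _ in low *.
  have low2 : expR (- (kap n * A)) * expR (- P) <= 1 - normc (z_ n) ^+ 2.
    by rewrite [expR (- P)]expRN ler_pdivrMr ?expR_gt0// [leRHS]mulrC.
  have nB := normc_ge0 (derive1 B (z_ n)).
  apply: (@le_trans _ _ (normc (derive1 B (z_ n)) * (expR (- (kap n * A)) * expR (- P)))).
    have -> : normc (derive1 B (z_ n)) * normc (F (z_ n)) * expR (- P) * expR (- (kap n * A)) =
      normc (F (z_ n)) * (normc (derive1 B (z_ n)) * (expR (- (kap n * A)) * expR (- P))) by ring.
    by rewrite ler_piMl ?F1// !mulr_ge0 ?expR_ge0.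
  by rewrite ler_wpM2l.
have cA : (fun n => normc (J (z_ n)) * expR (- (kap n * A))) @ \oo --> (1 : R).
  have c1 : (fun n => - (kap n * A)) @ \oo --> (0 : R).
    rewrite -oppr0 -(mul0r A); apply: cvgN; apply: cvgM => //; exact: cvg_cst.
  have c2 : (fun n => expR (- (kap n * A))) @ \oo --> expR (0 : R).
    by apply: (cvg_comp _ _ c1); exact: continuous_expR.
  by rewrite -[X in _ --> X]mulr1 -{2}expR0; exact: cvgM cJ c2.
have c3 : (fun _ : nat => 1 : R) @ \oo --> (1 : R) by exact: cvg_cst.
apply: squeeze_cvgr cA c3.
by apply: filterS bound => n hn; rewrite hn /=; exact: separation_le1.
Unshelve. all: by end_near. Qed.
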